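(* Let $n\ge 3$ and let $\mathbb{T}^{2n}=\mathbb{R}^{2n}/\mathbb{Z}^{2n}$ be the torus with the symplectic structure induced from the standard symplectic structure on $\mathbb{R}^{2n}$. Then the central extension of $\mathrm{Symp}(\mathbb{T}^{2n})$ by $\mathbb{R}$ defined by the cocycle $C$ is nontrivial.
   Context: $\mathrm{Symp}(\mathbb{T}^{2n})$ is the group of all $C^\infty$-smooth symplectomorphisms of $\mathbb{T}^{2n}$. The cocycle $C$: fix an open set $\Omega\subset\mathbb{R}^{2n}$ and a symplectic embedding $\iota:\Omega\to \mathbb{T}^{2n}$ with complement of $\iota(\Omega)$ of measure zero (for instance $\Omega=(0,1)^{2n}$ with $\iota$ the restriction of the quotient map); identify $g\in\mathrm{Symp}(\mathbb{T}^{2n})$ with the a.e. defined map $q=\iota^{-1}g\iota$ of $\Omega$; then $C(q_1,q_2)=\int_\Omega c\bigl(q_1'(q_2(m)),q_2'(m)\bigr)\,dm$, where $q'(x)$ is the Jacobi matrix. Up to coboundaries $C$ is independent of $(\Omega,\iota)$. Here $c$ is the Berezin cocycle on $\mathrm{Sp}(2n,\mathbb{R})=\{g: g^tKg=K\}$, $K=\begin{pmatrix}0&1\\-1&0\end{pmatrix}$: with $J=\frac1{\sqrt2}\begin{pmatrix}1&i\\i&1\end{pmatrix}$ and $J^{-1}gJ=\begin{pmatrix}\Phi&\Psi\\ \overline\Psi&\overline\Phi\end{pmatrix}$, $\Phi=\Phi(g)$, one sets $c(g_1,g_2)=\mathrm{Im}\,\mathrm{tr}\ln[\Phi(g_1)^{-1}\Phi(g_1g_2)\Phi(g_2)^{-1}]$,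 where the matrix in brackets is $1+Z$ with $\|Z\|<1$ and $\ln(1+Z)=\sum_{k\ge1}(-1)^{k+1}Z^k/k$. The extension of a group $G$ defined by an $\mathbb{R}$-valued 2-cocycle $C$ is trivial if there is a function $\gamma:G\to\mathbb{R}$ with $C(g_1,g_2)=\gamma(g_1)+\gamma(g_2)-\gamma(g_1g_2)$ for all $g_1,g_2\in G$; otherwise it is nontrivial. *)

(* Defs.v *)
From HB Require Import structures.
From mathcomp Require Import all_boot all_order all_algebra.
From mathcomp Require Import all_classical all_reals all_analysis.
From mathcomp Require Import generic_quotient complex.

Set Implicit Arguments.
Unset Strict Implicit.
Unset Printing Implicit Defensive.

Import Order.TTheory GRing.Theory Num.Theory.
Import numFieldNormedType.Exports.

Local Open Scope classical_set_scope.
Local Open Scope ring_scope.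
Local Open Scope complex_scope.
Local Open Scope quotient_scope.

(* Lebesgue measure on R^m, by recursion on m from the product measure.  The
   measurable structure of R^m is the library's one on [m.-tuple R]. *)
Section LebesgueTuple.
Context {R : realType}.
Local Notation RM := (measurableTypeR R).

Definition tuple_cons (m : nat) (p : RM * m.-tuple RM) : m.+1.-tuple RM :=
  [the m.+1.-tuple RM of p.1 :: p.2].

Lemma measurable_tuple_cons m : measurable_fun setT (@tuple_cons m).
Proof. by apply: measurable_cons. Qed.

Section LebesgueCons.
Variables (m : nat) (mu : {sigma_finite_measure set (m.-tuple RM) -> \bar R}).

Definition lebesgue_cons : set (m.+1.-tuple RM) -> \bar R :=
  pushforward (lebesgue_measure \x mu)%E (@tuple_cons m).

Let cons0 : lebesgue_cons set0 = 0%E.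
Proof.
by apply: (@measure0 _ _ _ (pushforward _ _)); exact: measurable_tuple_cons.
Qed.

Let cons_ge0 A : (0 <= lebesgue_cons A)%E.
Proof.
by apply: (@measure_ge0 _ _ _ (pushforward _ _)); exact: measurable_tuple_cons.
Qed.

Let cons_sigma_additive : semi_sigma_additive lebesgue_cons.
Proof.
by apply: (@measure_semi_sigma_additive _ _ _ (pushforward _ _));
  exact: measurable_tuple_cons.
Qed.

HB.instance Definition _ :=
  isMeasure.Build _ _ _ lebesgue_cons cons0 cons_ge0 cons_sigma_additive.

Let cons_sigma_finite : sigma_finite setT lebesgue_cons.
Proof.
have /sigma_finiteP[F [FT Fnd Ffin]] := sigma_finiteT (@lebesgue_measure R).
have /sigma_finiteP[G [GT Gnd Gfin]] := sigma_finiteT mu.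
exists (fun k => [set t : m.+1.-tuple RM |
                   F k (thead t) /\ G k [tuple of behead t]]).
  apply/esym; rewrite -subTset => t _.
  have : [set: RM] (thead t) by [].
  rewrite FT => -[i _ Fi].
  have : [set: m.-tuple RM] [tuple of behead t] by [].
  rewrite GT => -[j _ Gj].
  exists (maxn i j) => //; split.
    by have /subsetPset := Fnd _ _ (leq_maxl i j); exact.
  by have /subsetPset := Gnd _ _ (leq_maxr i j); exact.
move=> k; have [mF Fk] := Ffin k; have [mG Gk] := Gfin k; split.
  apply: measurableI; rewrite -[X in measurable X]setTI.
    exact: (@measurable_tnth _ RM m.+1 ord0).
  exact: (@measurable_behead _ RM m).
rewrite /lebesgue_cons /pushforward.
rewrite (_ : _ @^-1` _ = F k `*` G k); last first.
  have hK (x : RM) (t : m.-tuple RM) :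
    [tuple of behead (tuple_cons (x, t))] = t by apply: val_inj.
  by apply/seteqP; split=> -[x t]; rewrite /= hK.
rewrite product_measure1E//.
by apply: lte_mul_pinfty => //; rewrite ge0_fin_numE.
Qed.

HB.instance Definition _ :=
  @Measure_isSigmaFinite.Build _ _ _ lebesgue_cons cons_sigma_finite.

End LebesgueCons.

Fixpoint lebesgue_tuple (m : nat) :
    {sigma_finite_measure set (m.-tuple RM) -> \bar R} :=
  match m with
  | 0 => \d_([tuple] : 0.-tuple RM)
  | m'.+1 => lebesgue_cons (lebesgue_tuple m')
  end.

Definition row_of_tuple (m : nat) (t : m.-tuple RM) : 'rV[R]_m :=
  \row_i tnth t i.

End LebesgueTuple.

Definition lebesgue_null (R : realType) (m : nat) (A : set 'rV[R]_m) : Prop :=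
  (lebesgue_tuple m).-negligible (@row_of_tuple R m @^-1` A).

Definition lebesgue_Rintegral (R : realType) (m : nat) (A : set 'rV[R]_m)
    (f : 'rV[R]_m -> R) : R :=
  \int[lebesgue_tuple m]_(t in @row_of_tuple R m @^-1` A) f (row_of_tuple t).

Section Smooth.
Context {R : realType}.

Fixpoint Ck {V W : normedModType R} (k : nat) (U : set V) (f : V -> W) : Prop :=
  match k with
  | 0 => forall x, U x -> {for x, continuous f}
  | k'.+1 => (forall x, U x -> differentiable f x) /\
             (forall v, Ck k' U (fun x => 'D_v f x))
  end.

Definition Cinfty {V W : normedModType R} (U : set V) (f : V -> W) : Prop :=
  forall k, Ck k U f.

(* The library's ['J f x] acts on row vectors; the usual Jacobi matrix, with
   entries d f_i / d x_j, is its transpose. *)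
Definition jacobi_mx (m p : nat) (f : 'rV[R]_m -> 'rV[R]_p) (x : 'rV[R]_m) :
  'M[R]_(p, m) := ('J f x)^T.

End Smooth.

Definition std_symp (R : realType) (n : nat) : 'M[R]_(n + n) :=
  block_mx 0 1%:M (- 1%:M) 0.

Definition in_Sp (R : realType) (n : nat) (g : 'M[R]_(n + n)) : Prop :=
  g^T *m std_symp R n *m g = std_symp R n.

(* The torus R^m / Z^m, with the quotient topology. *)
Section Torus.
Variables (R : realType) (m : nat).

Definition int_congr (x y : 'rV[R]_m) : bool :=
  [forall i, x 0 i - y 0 i \is a Num.int].

Lemma int_congr_refl : reflexive int_congr.
Proof. by move=> x; apply/forallP => i; rewrite subrr rpred0. Qed.

Lemma int_congr_sym : symmetric int_congr.
Proof.
by move=> x y; apply: eq_forallb => i; rewrite -opprB rpredN.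
Qed.

Lemma int_congr_trans : transitive int_congr.
Proof.
move=> y x z /forallP xy /forallP yz; apply/forallP => i.
by rewrite -(subrKA (y 0 i)) rpredD.
Qed.

Canonical int_congr_equiv :=
  EquivRel int_congr int_congr_refl int_congr_sym int_congr_trans.

Definition torus : Type := quotient_topology {eq_quot int_congr}.
HB.instance Definition _ := Topological.on torus.
HB.instance Definition _ := Quotient.on torus.

Definition torus_pi (x : 'rV[R]_m) : torus := \pi_torus x.

End Torus.

Section Symplectic.
Variables (R : realType) (n : nat).
Local Notation V := 'rV[R]_(n + n).
Local Notation T := (torus R (n + n)).

(* [f], defined on the open set [U], is smooth and pulls the symplectic form
   of the torus back to the standard one.  Local inverses of [torus_pi] are
   symplectic charts of the torus, so this is read off local lifts of [f]. *)
Definition symplectic_on (U : set V) (f : V -> T) : Prop :=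
  forall x, U x -> exists W (F : V -> V),
    [/\ open_nbhs x W, W `<=` U, Cinfty W F,
        (forall y, W y -> f y = torus_pi (F y)) &
        (forall y, W y -> in_Sp (jacobi_mx F y))].

Definition Symp : set (T -> T) :=
  [set g : T -> T | symplectic_on setT (g \o @torus_pi R _) /\
     exists h : T -> T, [/\ cancel g h, cancel h g &
       symplectic_on setT (h \o @torus_pi R _)]].

(* An embedding between manifolds of the same dimension is a diffeomorphism
   onto an open subset, whence the last condition. *)
Definition symplectic_embedding (Omega : set V) (iota : V -> T) : Prop :=
  [/\ symplectic_on Omega iota, {in Omega &, injective iota} &
      forall U, open U -> U `<=` Omega -> open (iota @` U)].

Definition torus_null (A : set T) : Prop :=
  lebesgue_null (@torus_pi R (n + n) @^-1` A).

End Symplectic.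

Section Berezin.
Variables (R : realType) (n : nat).

Definition cayley_mx : 'M[R[i]]_(n + n) :=
  (Num.sqrt 2)^-1%:C *: block_mx 1%:M ('i%C)%:M ('i%C)%:M 1%:M.

Definition Phi (g : 'M[R]_(n + n)) : 'M[R[i]]_n :=
  ulsubmx (invmx cayley_mx *m map_mx (real_complex R) g *m cayley_mx).

(* The exponents are shifted by one: [k] here is k - 1 in
   ln (1 + Z) = \sum_(k >= 1) (-1)^(k+1) Z^k / k.  The exponent [^o] only
   selects the topology of the field of complex numbers. *)
Definition mx_ln1p (Z : 'M[R[i]]_n) : 'M[R[i]]_n :=
  lim (series (fun k : nat =>
         ((-1) ^+ k / k.+1%:R) *: Z ^+ k.+1 : 'M[R[i]^o]_n) @ \oo).

Definition berezin (g1 g2 : 'M[R]_(n + n)) : R :=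
  complex.Im (\tr (mx_ln1p
    (invmx (Phi g1) *m Phi (g1 *m g2) *m invmx (Phi g2) - 1%:M))).

End Berezin.

Section Cocycle.
Variables (R : realType) (n : nat).
Local Notation V := 'rV[R]_(n + n).
Local Notation T := (torus R (n + n)).

(* Only meaningful at the points of [Omega] that [g \o iota] sends into
   [iota @` Omega], which form an open subset of full measure. *)
Definition in_chart (Omega : set V) (iota : V -> T) (g : T -> T) : V -> V :=
  pinv Omega iota \o g \o iota.

Definition symp_cocycle (Omega : set V) (iota : V -> T) (g1 g2 : T -> T) : R :=
  let q1 := in_chart Omega iota g1 in
  let q2 := in_chart Omega iota g2 in
  lebesgue_Rintegral Omega
    (fun x => berezin (jacobi_mx q1 (q2 x)) (jacobi_mx q2 x)).

End Cocycle.

(* The group is a set [G] of self-maps, with composition as product. *)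
Definition trivial_extension (R : realType) (X : Type) (G : set (X -> X))
    (C : (X -> X) -> (X -> X) -> R) : Prop :=
  exists gamma : (X -> X) -> R, forall g1 g2, G g1 -> G g2 ->
    C g1 g2 = gamma g1 + gamma g2 - gamma (g1 \o g2).

(* Main.v *)
(* On Sp(2n, Z) the cocycle is the Berezin cocycle c up to a coboundary.  A
   matrix A in Sp(2n, Z) acts on the torus; read in the chart iota, whose Jacobi
   matrix at x is P(x), this action q_A has the Jacobi matrix P(q_A x)^-1 A P(x).
   Hence the integrand of C at (q_A, q_B) is c(A, B) plus terms b(AB, x),
   b(A, q_B x), b(B, x) which, b being bounded and q_B preserving the measure,
   integrate to a coboundary.  A trivialisation of C thus gives gamma with
   c(A, B) = gamma(A) + gamma(B) - gamma(AB) on Sp(2n, Z).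

   No such gamma exists.  Let T_e and w_e be the images of the matrices
   [1 1; 0 1] and [0 1; -1 0] of SL(2, Z) acting on the e-th symplectic plane.
   Since w_e is unitary of order 4, gamma(w_e) = 0, which determines gamma(T_e)
   and gives gamma(T_e^k) = k pi/6 - atan(k/2).  For e <> f the product
   T_e^(2k) T_f^(2k) is the product of the unipotents attached to
   k (x_e + x_f)^2 and k (x_e - x_f)^2, which are conjugate to powers of each
   other's type; as c is bounded, comparing the values of gamma bounds k pi/3,
   which is absurd for large k.

   Measure preservation is obtained without a change of variables theorem: a
   map with invertible derivative of determinant +-1 sends small dyadic cubes
   into parallelepipeds of almost the same volume. *)

From HB Require Import structures.
Require Import Defs.
From mathcomp Require Import all_boot all_order all_algebra generic_quotient.
From mathcomp Require Import all_classical all_reals all_analysis.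
From mathcomp Require Import fingroup perm measurable_realfun.
From mathcomp Require Import complex ring lra zify.

Set Implicit Arguments.
Unset Strict Implicit.
Unset Printing Implicit Defensive.

Import Order.TTheory GRing.Theory Num.Theory.
Import numFieldNormedType.Exports.

Local Open Scope classical_set_scope.
Local Open Scope ring_scope.
Local Open Scope complex_scope.

(** * Phase of the determinant *)

(** The determinant of 1 + Z gives its phase only modulo 2 pi, whereas the cocycle identity and the
    values of c are needed as real numbers. Two devices fix the integer: a deformation of Z to 0
    inside the unit ball and, on the subgroups SL(2), an a priori bound on the angles.

    The contradiction is arithmetic. As c is bounded, gamma is a quasi-morphism on Sp(2n, Z), so its
    linear rate along k |-> [1 kM; 0 1] is additive in M and invariant under M |-> A M A^T for A in
    GL(n, Z). The linear forms x_e, x_e + x_f and x_e - x_f are primitive, so their squares are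
    equivalent and share the rate pi/6. But x_e + x_f and x_e - x_f together generate a lattice of
    index two, and (x_e + x_f)^2 + (x_e - x_f)^2 = 2 x_e^2 + 2 x_f^2 equates two rates with four.
    The rate is nonzero because of the relation T F T = w in SL(2, Z), where F is the conjugate of T
    by w: the angle pi/2 of w is shared between three conjugates of T. *)

Section ScalarLog.
Variable R : realType.
Local Notation C := R[i].
Local Notation cabs := (@Normc.normc R).
Local Notation Re := (@complex.Re R).
Local Notation Im := (@complex.Im R).
Implicit Types (z w : C) (a b t r : R) (N : nat).

Lemma ReD z w : Re (z + w) = Re z + Re w.
Proof. by case: z; case: w. Qed.
Lemma ImD z w : Im (z + w) = Im z + Im w.
Proof. by case: z; case: w. Qed.
Lemma ReN z : Re (- z) = - Re z.
Proof. by case: z. Qed.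
Lemma ImN z : Im (- z) = - Im z.
Proof. by case: z. Qed.
Lemma ReM z w : Re (z * w) = Re z * Re w - Im z * Im w.
Proof. by case: z; case: w. Qed.
Lemma ImM z w : Im (z * w) = Re z * Im w + Im z * Re w.
Proof. by case: z; case: w. Qed.
Lemma Re_sum I (s : seq I) (P : pred I) (F : I -> C) :
  Re (\sum_(i <- s | P i) F i) = \sum_(i <- s | P i) Re (F i).
Proof. by apply: (big_morph Re ReD). Qed.
Lemma Im_sum I (s : seq I) (P : pred I) (F : I -> C) :
  Im (\sum_(i <- s | P i) F i) = \sum_(i <- s | P i) Im (F i).
Proof. by apply: (big_morph Im ImD). Qed.

Lemma cabsE z : cabs z = Num.sqrt (Re z ^+ 2 + Im z ^+ 2).
Proof. by case: z. Qed.
Lemma cabs_sqr z : cabs z ^+ 2 = Re z ^+ 2 + Im z ^+ 2.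
Proof. by rewrite cabsE sqr_sqrtr // addr_ge0 ?sqr_ge0. Qed.
Lemma cabs_ge0 z : 0 <= cabs z.
Proof. by rewrite cabsE sqrtr_ge0. Qed.
Lemma cabsM z w : cabs (z * w) = cabs z * cabs w.
Proof. exact: Normc.normcM. Qed.
Lemma cabsX z k : cabs (z ^+ k) = cabs z ^+ k.
Proof.
elim: k => [|k IH]; first by rewrite !expr0 Normc.normc1.
by rewrite !exprS cabsM IH.
Qed.
Lemma cabsD z w : cabs (z + w) <= cabs z + cabs w.
Proof. exact: le_normcD. Qed.
Lemma cabsN z : cabs (- z) = cabs z.
Proof. exact: normcN. Qed.
Lemma cabs_real a : cabs a%:C = `|a|.
Proof. by rewrite cabsE /= expr0n addr0 sqrtr_sqr. Qed.
Lemma Im_le_cabs z : `|Im z| <= cabs z.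
Proof. by rewrite cabsE -sqrtr_sqr ler_wsqrtr // lerDr sqr_ge0. Qed.
Lemma Re_le_cabs z : `|Re z| <= cabs z.
Proof. by rewrite cabsE -sqrtr_sqr ler_wsqrtr // lerDl sqr_ge0. Qed.
Lemma cabs_sum I (s : seq I) (P : pred I) (F : I -> C) :
  cabs (\sum_(i <- s | P i) F i) <= \sum_(i <- s | P i) cabs (F i).
Proof.
elim/big_ind2 : _ => [|x1 x2 y1 y2 h1 h2|//]; first by rewrite Normc.normc0.
exact: le_trans (cabsD _ _) (lerD _ _).
Qed.
Lemma cabs_eq0 z : cabs z = 0 -> z = 0.
Proof. exact: Normc.eq0_normc. Qed.

(* The argument of [1 + z] for |z| < 1. *)
Definition arg1p z : R := atan (Im z / (1 + Re z)).

Definition log1p_coef N : C := (-1) ^+ N / N.+1%:R.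

Definition log1p_sum N z : C := \sum_(k < N) log1p_coef k * z ^+ k.+1.

Lemma log1p_coefE k : log1p_coef k = ((-1) ^+ k / k.+1%:R : R)%:C.
Proof.
by rewrite /log1p_coef rmorphM rmorphXn rmorphN rmorph1 fmorphV rmorph_nat.
Qed.

(** The imaginary part of [log1p_sum N] at tz, with the powers of the real number t pulled out, so
    that it is a real polynomial in t. *)
Let g z N t : R := \sum_(k < N) Im (log1p_coef k * z ^+ k.+1) * t ^+ k.+1.

Let g_derive z N t : is_derive t 1 (g z N)
   (Im (\sum_(k < N) (- t%:C) ^+ k * z ^+ k.+1)).
Proof.
elim: N => [|N IH].
  rewrite big_ord0 /=.
  rewrite (_ : g z 0 = cst 0); first exact: is_derive_cst.
  by apply/funext => u; rewrite /g big_ord0.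
rewrite big_ord_recr /= ImD.
rewrite (_ : g z N.+1 =
  g z N \+ (fun u => Im (log1p_coef N * z ^+ N.+1) *: (u ^+ N.+1 : R))); last first.
  by apply/funext => u; rewrite /g big_ord_recr.
apply: is_deriveD => //.
have hX : is_derive t 1 (fun u : R => u ^+ N.+1) (N.+1%:R * t ^+ N).
  rewrite (_ : (fun u : R => u ^+ N.+1) = (id : R -> R) ^+ N.+1); last first.
    by apply/funext => u; rewrite exprfctE.
  apply: (is_derive_eq (@is_deriveX R _ (id : R -> R) N.+1 t 1 1 (is_derive_id _ _))).
  by rewrite /GRing.scale /= mulr1.
apply: (is_derive_eq (is_deriveZ (Im (log1p_coef N * z ^+ N.+1)) hX)).
rewrite /GRing.scale /= log1p_coefE.
have -> : (- t%:C) ^+ N = ((-1) ^+ N * t ^+ N)%:C.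
  by rewrite -rmorphN -rmorphXn -exprNn.
rewrite !ImM /= !mul0r !addr0.
have h : N.+1%:R != 0 :> R by rewrite pnatr_eq0.
by field; rewrite addrC natr1.
Qed.

Lemma one_plus_re_gt0 z : cabs z < 1 -> 0 < 1 + Re z.
Proof.
move=> h; have := le_lt_trans (Re_le_cabs z) h.
by rewrite ltr_norml => /andP[]; lra.
Qed.

(** Mean value theorem on [0, 1] for the argument of 1 + tz minus the partial sum at tz. By
    summation of a geometric progression the derivative is the imaginary part of z (-tz)^N / (1 +
    tz), which is at most r^N / (1 - r). *)
Lemma arg1p_log_sum z r N : cabs z <= r -> r < 1 ->
  `|arg1p z - Im (log1p_sum N z)| <= r ^+ N / (1 - r).
Proof.
move=> zr r1.
have r0 : 0 <= r by apply: le_trans zr; exact: cabs_ge0.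
pose a := Re z; pose b := Im z.
have za : z = Complex a b by case: (z) @a @b.
have pos t : 0 <= t <= 1 -> 0 < 1 + t * a.
  move=> /andP[t0 t1].
  have := le_trans (Re_le_cabs z) zr; rewrite ler_norml => /andP[h _].
  rewrite -/a in h.
  have : - 1 < t * a; last by lra.
  apply: (@lt_le_trans _ _ (- r)); first by rewrite ltrN2.
  by nra.
pose f t := atan (t * b / (1 + t * a)) - g z N t.
pose df t := Im (z * (- t%:C * z) ^+ N / (1 + t%:C * z)).
have one_tz t : 0 <= t <= 1 -> 1 + t%:C * z != 0.
  move=> ht; apply/eqP => /(congr1 Re); rewrite ReD ReM /= mul0r subr0 => h.
  by have := pos _ ht; rewrite /a h ltxx.
have fd t : 0 <= t <= 1 -> is_derive t 1 f (df t).
  move=> ht; have p := pos _ ht.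
  have -> : df t = b / ((1 + t * a) ^+ 2 + (t * b) ^+ 2)
       - Im (\sum_(k < N) (- t%:C) ^+ k * z ^+ k.+1).
    rewrite /df.
    have geom : (\sum_(k < N) (- t%:C) ^+ k * z ^+ k.+1) * (1 + t%:C * z)
      = z - z * (- t%:C * z) ^+ N.
      elim: (N) => [|M IH]; first by rewrite big_ord0 mul0r expr0 mulr1 subrr.
      rewrite big_ord_recr /= mulrDl IH !exprMn !exprS.
      by move: ((- t%:C) ^+ M) (z ^+ M) => u v; ring.
    have -> : \sum_(k < N) (- t%:C) ^+ k * z ^+ k.+1 =
       z / (1 + t%:C * z) - z * (- t%:C * z) ^+ N / (1 + t%:C * z).
      by rewrite -mulrBl -geom mulfK // one_tz.
    rewrite ImD ImN.
    have -> : Im (z / (1 + t%:C * z)) = b / ((1 + t * a) ^+ 2 + (t * b) ^+ 2).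
      have -> : z / (1 + t%:C * z) =
          Complex ((a * (1 + t * a) + b * (t * b)) / ((1 + t * a) ^+ 2 + (t * b) ^+ 2))
                  (b / ((1 + t * a) ^+ 2 + (t * b) ^+ 2)).
        apply: (mulIf (one_tz _ ht)); rewrite mulfVK ?one_tz // za.
        have h : (1 + t * a) ^+ 2 + (t * b) ^+ 2 != 0.
          by rewrite gt_eqF // ltr_pwDl ?sqr_ge0 // exprn_gt0.
        apply/eqP; rewrite eq_complex /=; apply/andP; split; apply/eqP; field.
          by move: h; congr (_ != 0); ring.
        by move: h; congr (_ != 0); ring.
      by [].
    by ring.
  apply: is_deriveB; last exact: g_derive.
  have h1 : is_derive t 1 (fun u : R => u * b / (1 + u * a)) (b / (1 + t * a) ^+ 2).
    have d1 : is_derive t 1 (fun u : R => u * b) b.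
      rewrite (_ : (fun u => u * b) = b \*: id); last first.
        by apply/funext => u; rewrite /= /GRing.scale /= mulrC.
      apply: (is_derive_eq (is_deriveZ b (is_derive_id t (1:R)))).
      by rewrite /GRing.scale /= mulr1.
    have d2 : is_derive t 1 (fun u : R => 1 + u * a) a.
      rewrite (_ : (fun u => 1 + u * a) = cst 1 \+ a \*: id); last first.
        by apply/funext => u; rewrite /= /GRing.scale /= mulrC.
      apply: (is_derive_eq (is_deriveD (is_derive_cst (1:R) t (1:R))
        (is_deriveZ a (is_derive_id t (1:R))))).
      by rewrite /GRing.scale /= mulr1 add0r.
    have pn : 1 + t * a != 0 by rewrite gt_eqF.
    have d4 := @is_deriveM R R^o _ _ t 1 _ _ d1
      (@is_deriveV R (fun u : R => 1 + u * a) t a 1 pn d2).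
    rewrite (_ : (_ * _) = (fun u => u * b / (1 + u * a))) in d4; last first.
      by apply/funext => u; rewrite mulrfctE.
    apply: (is_derive_eq d4).
    rewrite /GRing.scale /=.
    by field.
  apply: (is_derive_eq (@is_derive1_comp R atan (fun u : R => u * b / (1 + u * a)) t _ _
    (is_derive1_atan _) h1)).
  have pn : 1 + t * a != 0 by rewrite gt_eqF.
  have h : (1 + t * a) ^+ 2 + (t * b) ^+ 2 != 0.
    by rewrite gt_eqF // ltr_pwDl ?sqr_ge0 // exprn_gt0.
  field; rewrite -/a -/b pn /= andbT.
  by move: h; congr (_ != 0); ring.
have [||c c01] := @MVT_segment R f df 0 1 ler01.
- by move=> t /[!in_itv]/= /andP[/ltW h0 /ltW h1]; apply: fd; rewrite h0.
- apply: derivable_within_continuous => t /[!in_itv]/= h.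
  by have := fd _ h => -[].
have -> : f 1 - f 0 = arg1p z - Im (log1p_sum N z).
  rewrite /f !mul0r atan0 /arg1p !mul1r /g /log1p_sum Im_sum.
  rewrite [X in _ - (0 - X)]big1; last by move=> i _; rewrite expr0n mulr0.
  by rewrite !subr0; congr (_ - _); apply: eq_bigr => i _; rewrite expr1n mulr1.
rewrite subr0 mulr1 => ->; rewrite in_itv /= in c01.
rewrite /df; apply: (le_trans (Im_le_cabs _)).
rewrite !cabsM cabsX cabsM cabsN Normc.normcV cabs_real.
have /andP[c0 c1] := c01.
rewrite ger0_norm //.
have h1 : 1 - r <= cabs (1 + c%:C * z).
  apply: le_trans (le_trans (ler_norm _) (Re_le_cabs _)).
  rewrite ReD ReM /= mul0r subr0.
  have := le_trans (Re_le_cabs z) zr; rewrite ler_norml => /andP[h _]; nra.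
apply: ler_pM => //.
- by rewrite mulr_ge0 ?cabs_ge0 // exprn_ge0 // mulr_ge0 // cabs_ge0.
- by rewrite invr_ge0 cabs_ge0.
- rewrite -[leRHS]mul1r; apply: ler_pM; rewrite ?cabs_ge0 //.
  + by rewrite exprn_ge0 // mulr_ge0 // cabs_ge0.
  + by apply: le_trans zr (ltW r1).
  + rewrite lerXn2r ?nnegrE ?mulr_ge0 ?cabs_ge0 //.
    by rewrite -[leRHS]mul1r ler_pM ?cabs_ge0.
- by rewrite lef_pV2 ?posrE ?subr_gt0 //; apply: lt_le_trans h1; rewrite subr_gt0.
Qed.

(** As 1 + z has positive real part, the arctangent is its argument, with no correction by pi. *)
Lemma arg1pP z : cabs z < 1 ->
  1 + z = (cabs (1 + z))%:C * (cos (arg1p z) +i* sin (arg1p z)).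
Proof.
move=> z1; have p := one_plus_re_gt0 z1.
have c := cos_atan (Im z / (1 + Re z)).
have cg : 0 < cos (arg1p z) by rewrite cos_gt0_pihalf // atan_gtNpi2 atan_ltpi2.
have t : sin (arg1p z) = cos (arg1p z) * (Im z / (1 + Re z)).
  have := atanK (Im z / (1 + Re z)); rewrite -/(arg1p z) /tan => <-.
  by rewrite mulrC divfK // gt_eqF.
have c' : cabs (1 + z) * cos (arg1p z) = 1 + Re z.
  rewrite /arg1p c.
  rewrite (_ : 1 + (Im z / (1 + Re z)) ^+ 2 =
    (cabs (1 + z) / (1 + Re z)) ^+ 2); last first.
    rewrite [RHS]exprMn cabs_sqr ReD ImD /=; have pn := gt_eqF p.
    by field; rewrite pn.
  rewrite sqrtr_sqr ger0_norm ?divr_ge0 ?cabs_ge0 ?ltW // invf_div mulrCA divff ?mulr1 //.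
  apply/eqP => /cabs_eq0 /(congr1 Re); rewrite ReD /= => h.
  by move: p; rewrite h ltxx.
apply/eqP; rewrite eq_complex; apply/andP; rewrite ReM ImM /= !mul0r !subr0 !addr0.
rewrite c' t mulrA c' ReD ImD /= add0r; split=> //.
by rewrite mulrC divfK // gt_eqF.
Qed.

End ScalarLog.

(** * Contractions, eigenvalues and convergence of the matrix logarithm *)

Section MatrixLog.
Variable R : realType.
Local Notation C := R[i].
Local Notation cabs := (@Normc.normc R).
Local Notation Re := (@complex.Re R).
Local Notation Im := (@complex.Im R).

Definition ctr m n (M : 'M[C]_(m, n)) : 'M[C]_(n, m) := map_mx (@conjc R) M^T.

Lemma ctrM m n p (A : 'M[C]_(m, n)) (B : 'M[C]_(n, p)) :
  ctr (A *m B) = ctr B *m ctr A.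
Proof. by rewrite /ctr trmx_mul map_mxM. Qed.
Lemma ctrK m n (A : 'M[C]_(m, n)) : ctr (ctr A) = A.
Proof. by apply/matrixP => i j; rewrite !mxE conjcK. Qed.
Lemma ctrD m n (A B : 'M[C]_(m, n)) : ctr (A + B) = ctr A + ctr B.
Proof. by apply/matrixP => i j; rewrite !mxE rmorphD. Qed.
Lemma ctr1 n : ctr (1%:M : 'M[C]_n) = 1%:M.
Proof. by rewrite /ctr trmx1 map_mx1. Qed.

Definition rsq n (v : 'rV[C]_n) : R := \sum_j cabs (v 0 j) ^+ 2.

Lemma rsqE n (v : 'rV[C]_n) : (v *m ctr v) 0 0 = (rsq v)%:C.
Proof.
rewrite mxE /rsq rmorph_sum; apply: eq_bigr => j _; rewrite !mxE.
rewrite cabs_sqr; case: (v 0 j) => a b /=; apply/eqP; rewrite eq_complex /=.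
by apply/andP; split; apply/eqP; ring.
Qed.

Lemma rsq_ge0 n (v : 'rV[C]_n) : 0 <= rsq v.
Proof. by apply: sumr_ge0 => j _; exact: sqr_ge0. Qed.

Lemma rsqZ n (a : C) (v : 'rV[C]_n) : rsq (a *: v) = cabs a ^+ 2 * rsq v.
Proof.
by rewrite /rsq big_distrr /=; apply: eq_bigr => j _; rewrite mxE cabsM exprMn.
Qed.

Lemma rsq_eq0 n (v : 'rV[C]_n) : rsq v = 0 -> v = 0.
Proof.
move=> /eqP; rewrite psumr_eq0; last by move=> j _; exact: sqr_ge0.
move=> /allP h; apply/rowP => j; rewrite mxE; apply: cabs_eq0.
by have := h j (mem_index_enum j); rewrite sqrf_eq0 => /eqP.
Qed.

(** An operator norm bound for the action on rows with the Hermitian norm, stated without the norm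
    itself; it expresses the condition ||Z|| < 1 under which the logarithm converges. *)
Definition bnd n p (r : R) (Z : 'M[C]_(n, p)) : Prop :=
  forall v, rsq (v *m Z) <= r ^+ 2 * rsq v.

Lemma bndM n p q r s (Z : 'M[C]_(n, p)) (W : 'M[C]_(p, q)) :
  bnd r Z -> bnd s W -> bnd (s * r) (Z *m W).
Proof.
move=> hZ hW v; rewrite mulmxA; apply: (le_trans (hW _)).
have -> : (s * r) ^+ 2 * rsq v = s ^+ 2 * (r ^+ 2 * rsq v) by ring.
by rewrite ler_wpM2l ?sqr_ge0.
Qed.

Lemma bndX n r (Z : 'M[C]_n) k : bnd r Z -> bnd (r ^+ k) (Z ^+ k).
Proof.
move=> hZ; elim: k => [|k IH].
  by move=> v; rewrite !expr0 mulmx1 expr1n mul1r.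
by rewrite exprSr exprS; exact: bndM.
Qed.

Lemma bnd_entry n r (Z : 'M[C]_n) i j : 0 <= r -> bnd r Z -> cabs (Z i j) <= r.
Proof.
move=> r0 /(_ (delta_mx 0 i)); rewrite -rowE => h.
rewrite -(@ler_pXn2r _ 2) ?nnegrE ?cabs_ge0 //.
apply: (le_trans (le_trans _ h)).
  rewrite /rsq (bigD1 j) //= mxE lerDl; apply: sumr_ge0 => k _; exact: sqr_ge0.
rewrite /rsq (bigD1 i) //= big1 ?addr0 => [|k ki]; rewrite !mxE eqxx.
  by rewrite eqxx mulr1n Normc.normc1 expr1n mulr1.
by rewrite (negPf ki) mulr0n Normc.normc0 expr0n.
Qed.

Lemma bnd_eigen n r (Z : 'M[C]_n) a : 0 <= r -> bnd r Z -> eigenvalue Z a -> cabs a <= r.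
Proof.
move=> r0 hZ /eigenvalueP[v vZ v0]; have := hZ v; rewrite vZ rsqZ.
have p : 0 < rsq v.
  by rewrite lt_def rsq_ge0 andbT; apply: contra v0 => /eqP /rsq_eq0 ->.
by rewrite ler_pM2r // ler_pXn2r ?nnegrE ?cabs_ge0.
Qed.

Lemma trig_mulE n (A B : 'M[C]_n) : is_trig_mx A -> is_trig_mx B ->
  is_trig_mx (A *m B) /\ forall i, (A *m B) i i = A i i * B i i.
Proof.
move=> /is_trig_mxP hA /is_trig_mxP hB; split.
  apply/is_trig_mxP => i j ij; rewrite mxE big1 // => k _.
  have [ik|ki] := ltnP i k; first by rewrite hA // mul0r.
  by rewrite hB ?mulr0 //; apply: leq_ltn_trans ij.
move=> i; rewrite mxE (bigD1 i) //= big1 ?addr0 // => k ki.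
have [ik|ki'] := ltnP i k; first by rewrite hA // mul0r.
by rewrite hB ?mulr0 // ltn_neqAle ki' andbT val_eqE.
Qed.

(** Schur triangularisation: the diagonal of the triangular form lists the eigenvalues, and the
    diagonal of its k-th power lists their k-th powers. *)
Lemma mx_eigenvalues n (Z : 'M[C]_n) : exists2 e : 'I_n -> C,
  (forall k, \tr (Z ^+ k) = \sum_i e i ^+ k) /\ \det (1%:M + Z) = \prod_i (1 + e i)
  & forall i, eigenvalue Z (e i).
Proof.
case: n Z => [|n] Z.
  exists (fun _ => 0); last by case.
  by split => [k|]; rewrite ?det_mx00 ?big_ord0 // /mxtrace big_ord0.
have [P Pu] := Schur Z (ltn0Sn n).
have Pi : P \in unitmx by exact: unitarymx_unit Pu.
set T := P *m Z *m invmx P => tT0.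
have tT : is_trig_mx T by rewrite /T -conjumx.
have ZE : Z = invmx P *m T *m P by rewrite /T !mulmxA mulVmx // mul1mx mulmxKV.
move: T tT ZE {tT0} => T tT ZE.
have ZX k : Z ^+ k = invmx P *m (T ^+ k) *m P.
  elim: k => [|k IH]; first by rewrite !expr0 mulmx1 mulVmx.
  by rewrite !exprS IH {1}ZE -!mulmxE !mulmxA mulmxK.
have TX k : is_trig_mx (T ^+ k) /\ forall i, (T ^+ k) i i = T i i ^+ k.
  elim: k => [|k [IH1 IH2]].
    rewrite expr0; split; last by move=> i; rewrite mxE eqxx expr0.
    by apply/is_trig_mxP => i j; rewrite mxE => /ltn_eqF; rewrite -val_eqE => ->.
  have [h1 h2] := trig_mulE tT IH1.
  by rewrite exprS; split => // i; rewrite h2 IH2 exprS.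
exists (fun i => T i i).
  split=> [k|].
    rewrite ZX mxtrace_mulC mulmxA mulmxV // mul1mx.
    by apply: eq_bigr => i _; rewrite (TX k).2.
  have -> : 1%:M + Z = invmx P *m (1%:M + T) *m P.
    by rewrite mulmxDr mulmxDl mulmx1 mulVmx // -ZE.
  rewrite !det_mulmx mulrC mulrA -det_mulmx mulmxV // det1 mul1r.
  rewrite det_trig; first by apply: eq_bigr => i _; rewrite !mxE eqxx.
  apply/is_trig_mxP => i j ij; rewrite !mxE (is_trig_mxP tT) // addr0.
  by rewrite -val_eqE ltn_eqF.
move=> i.
have /eigenvalueP[v vT v0] : eigenvalue T (T i i).
  by rewrite eigenvalue_root_char char_poly_trig // (bigD1 i) //= rootM root_XsubC eqxx.
apply/eigenvalueP; exists (v *m P).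
  by rewrite ZE !mulmxA mulmxK // vT scalemxAl.
apply: contra v0 => /eqP vP; apply/eqP.
by rewrite -[v](mulmxK Pi) vP mul0mx.
Qed.

Lemma cvg_geom_series_dominated (u : R^nat) r : 0 <= r < 1 ->
  (forall k, `|u k| <= r ^+ k) -> cvgn (series u).
Proof.
move=> /andP[r0 r1] h; apply: normed_cvg.
apply: (@series_le_cvg _ _ (geometric 1 r)).
- by move=> k; exact: normr_ge0.
- by move=> k; rewrite /geometric /= mul1r exprn_ge0.
- by move=> k; rewrite /geometric /= mul1r.
- by apply: is_cvg_geometric_series; rewrite ger0_norm.
Qed.

Lemma log1p_term_le (z : C) r k : 0 <= r < 1 -> cabs z <= r ^+ k.+1 ->
  cabs (log1p_coef R k * z) <= r ^+ k.
Proof.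
move=> /andP[r0 r1] h; rewrite cabsM log1p_coefE cabs_real normrM normrX normrN1 expr1n mul1r.
rewrite -[leRHS]mul1r; apply: ler_pM; rewrite ?cabs_ge0 ?normr_ge0 //.
  by rewrite ger0_norm ?invr_ge0 // invf_le1 // ler1n.
by apply: (le_trans h); rewrite exprSr ler_piMr ?exprn_ge0 // ltW.
Qed.

Definition mx_log1p_sum n N (Z : 'M[C]_n) : 'M[C]_n :=
  \sum_(k < N) log1p_coef R k *: Z ^+ k.+1.

(** The entries of the terms are dominated by a geometric progression, so their real and imaginary
    parts give convergent series; together these form the limit in the topology of complex
    matrices. *)
Lemma mx_ln1p_cvg n r (Z : 'M[C]_n) i j : 0 <= r < 1 -> bnd r Z ->
  Im (mx_log1p_sum N Z i j) @[N --> \oo] --> Im (mx_ln1p Z i j).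
Proof.
move=> r01 hZ; have /andP[r0 r1] := r01.
pose u i j k := log1p_coef R k * (Z ^+ k.+1) i j.
have uE i' j' N : mx_log1p_sum N Z i' j' = \sum_(k < N) u i' j' k.
  by rewrite /mx_log1p_sum summxE; apply: eq_bigr => k _; rewrite mxE.
have ub i' j' k : cabs (u i' j' k) <= r ^+ k.
  apply: log1p_term_le => //; apply: bnd_entry; first exact: exprn_ge0.
  exact: bndX.
have cRe i' j' : cvgn (series (fun k => Re (u i' j' k))).
  by apply: (cvg_geom_series_dominated r01) => k; apply: le_trans (ub _ _ _); exact: Re_le_cabs.
have cIm i' j' : cvgn (series (fun k => Im (u i' j' k))).
  by apply: (cvg_geom_series_dominated r01) => k; apply: le_trans (ub _ _ _); exact: Im_le_cabs.
pose L : 'M[C^o]_n := \matrix_(i, j)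
  Complex (limn (series (fun k => Re (u i j k)))) (limn (series (fun k => Im (u i j k)))).
have sRe i' j' N : series (fun k => Re (u i' j' k)) N = Re (mx_log1p_sum N Z i' j').
  by rewrite uE Re_sum /series /= big_mkord.
have sIm i' j' N : series (fun k => Im (u i' j' k)) N = Im (mx_log1p_sum N Z i' j').
  by rewrite uE Im_sum /series /= big_mkord.
have -> : mx_ln1p Z = L.
  rewrite /mx_ln1p; apply: (@cvg_lim 'M[R[i]^o]_n); first exact: norm_hausdorff.
  apply/cvg_ballP => eps eps0.
  (* Norms over [C] take values in [C], so [eps] is a complex number; being positive, it is real. *)
  have [e0 epsE] : 0 < Re eps /\ eps = (Re eps)%:C.
    move: eps0; rewrite ltcE => /andP[/eqP h1 h2]; split => //.
    by apply/eqP; rewrite eq_complex eqxx /= h1.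
  have : \forall N \near \oo, forall i' j',
      `|L i' j' - mx_log1p_sum N Z i' j'| < eps.
    apply: filter_forall => i'; apply: filter_forall => j'.
    have e20 : 0 < Re eps / 2 by rewrite divr_gt0.
    have /cvgr_dist_lt /(_ _ e20) h1 := cRe i' j'.
    have /cvgr_dist_lt /(_ _ e20) h2 := cIm i' j'.
    near=> N.
    have g1 : `|limn (series (fun k => Re (u i' j' k))) - series (fun k => Re (u i' j' k)) N|
       < Re eps / 2 by near: N.
    have g2 : `|limn (series (fun k => Im (u i' j' k))) - series (fun k => Im (u i' j' k)) N|
       < Re eps / 2 by near: N.
    rewrite epsE normc_def ltcR.
    apply: (@le_lt_trans _ _ (`|Re (L i' j' - mx_log1p_sum N Z i' j')| +
       `|Im (L i' j' - mx_log1p_sum N Z i' j')|)).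
      rewrite -[leRHS]ger0_norm ?addr_ge0 // -sqrtr_sqr ler_wsqrtr //.
      by rewrite sqrrD !real_normK ?num_real // lerD2r lerDl mulrn_wge0 // mulr_ge0.
    rewrite !ReD !ImD !ReN !ImN mxE /= -sRe -sIm.
    lra.
  apply: filterS => N hN; split => // i' j'.
  rewrite -ball_normE /=.
  have -> : series (fun k : nat =>
         ((-1) ^+ k / k.+1%:R) *: Z ^+ k.+1 : 'M[R[i]^o]_n) N = mx_log1p_sum N Z.
    by rewrite /series /= big_mkord.
  exact: hN.
rewrite mxE /=.
rewrite (_ : (fun N => _) = series (fun k => Im (u i j k))) //.
by apply/funext => N; rewrite sIm.
Unshelve. all: by end_near.
Qed.

End MatrixLog.

(** * The branch of the argument of det (1 + Z) given by the logarithm *)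

Section Lnarg.
Variable R : realType.
Local Notation C := R[i].
Local Notation cabs := (@Normc.normc R).
Local Notation Re := (@complex.Re R).
Local Notation Im := (@complex.Im R).

Definition cis (t : R) : C := cos t +i* sin t.

Lemma cisD s t : cis (s + t) = cis s * cis t.
Proof.
by apply/eqP; rewrite eq_complex /= cosD sinD; apply/andP; split; apply/eqP; ring.
Qed.

Lemma cis_neq0 t : cis t != 0.
Proof.
apply/eqP => h; have := cos2Dsin2 t.
move/(congr1 Re) : (h) => /= ->; move/(congr1 Im) : h => /= ->.
by rewrite expr0n /= addr0 => /eqP; rewrite eq_sym oner_eq0.
Qed.

Lemma cis0 : cis 0 = 1.
Proof. by rewrite /cis cos0 sin0. Qed.

Lemma cis_inj_scale (r1 r2 : R) s t : 0 < r1 -> 0 < r2 ->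
  r1%:C * cis s = r2%:C * cis t -> cis s = cis t.
Proof.
move=> h1 h2 h.
have n1 u : cabs (cis u) = 1.
  by rewrite cabsE /= cos2Dsin2 sqrtr1.
have : r1 = r2.
  by move/(congr1 cabs): h; rewrite !cabsM !n1 !mulr1 !cabs_real !gtr0_norm.
move=> e; apply: (mulfI (_ : r1%:C != 0)); last by rewrite h e.
by rewrite fmorph_eq0 gt_eqF.
Qed.

Lemma cis_eq1_small t : cis t = 1 -> `|t| < 2 * pi -> t = 0.
Proof.
wlog t0 : t / 0 <= t.
  move=> h; have [|/ltW t0 e] := leP 0 t; first exact: h.
  rewrite -normrN => ht; apply/eqP; rewrite -oppr_eq0; apply/eqP; apply: h => //.
    by rewrite oppr_ge0.
  apply: (mulIf (cis_neq0 t)); rewrite -cisD addNr cis0 e mulr1 //.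
move=> e; rewrite ger0_norm // => h.
have p0 := @pi_gt0 R.
have [tp|tp] := leP t pi.
  apply: cos_inj; rewrite ?in_itv /= ?t0 ?tp ?lexx ?ltW //.
  by move/(congr1 Re) : e => /= ->; rewrite cos0.
(* Beyond pi, the reflected angle 2 pi - t lies in [0, pi] and has cosine 1, which would force t = 2
   pi. *)
exfalso; have : pi - (t - pi) = 0 :> R; last by lra.
have h1 : pi - (t - pi) \in `[0, pi] by rewrite in_itv /=; apply/andP; split; lra.
have h2 : (0 : R) \in `[0, pi] by rewrite in_itv /= lexx ltW.
apply: (cos_inj h1 h2).
have -> : pi - (t - pi) = - t + pi *+ 2 by ring.
rewrite cosD2pi cosN cos0.
by move/(congr1 Re) : e => /=.
Qed.

Lemma le_geom_eq0 (x K r : R) : 0 <= r < 1 -> (forall N, `|x| <= K * r ^+ N) -> x = 0.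
Proof.
move=> /andP[r0 r1] h; apply/eqP; rewrite -normr_eq0; apply/eqP/le_anti.
rewrite normr_ge0 andbT.
have c : (fun N => K * r ^+ N) @ \oo --> (K * 0).
  by apply: cvgMr; apply: cvg_expr; rewrite ger0_norm.
rewrite mulr0 in c.
apply: (cvgr_to_ge c).
exact: nearW.
Qed.

Definition lnarg n (Z : 'M[C]_n) : R := Im (\tr (mx_ln1p Z)).

Lemma Im_tr_log1p_sum n N (Z : 'M[C]_n) (e : 'I_n -> C) :
  (forall k, \tr (Z ^+ k) = \sum_i e i ^+ k) ->
  Im (\tr (mx_log1p_sum N Z)) = \sum_i Im (log1p_sum N (e i)).
Proof.
move=> he; rewrite -Im_sum /log1p_sum exchange_big /=; congr Im.
rewrite /mx_log1p_sum linear_sum; apply: eq_bigr => k _.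
by rewrite linearZ /= he big_distrr.
Qed.

Lemma lnarg_cvg n r (Z : 'M[C]_n) : 0 <= r < 1 -> bnd r Z ->
  Im (\tr (mx_log1p_sum N Z)) @[N --> \oo] --> lnarg Z.
Proof.
move=> r01 hZ; rewrite /lnarg /mxtrace Im_sum.
under eq_fun do rewrite Im_sum.
apply: cvg_big => [|i _]; first exact: add_continuous.
exact: mx_ln1p_cvg r01 hZ.
Qed.

(** The truncated traces are sums over the eigenvalues, so a single sequence converges both to the
    trace of the logarithm and to the sum of the arguments. *)
Lemma lnarg_sum_eigen n r (Z : 'M[C]_n) (e : 'I_n -> C) : 0 <= r < 1 -> bnd r Z ->
  (forall k, \tr (Z ^+ k) = \sum_i e i ^+ k) -> (forall i, cabs (e i) <= r) ->
  lnarg Z = \sum_i arg1p (e i).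
Proof.
move=> r01 hZ tre le; have /andP[r0 r1] := r01.
have := lnarg_cvg r01 hZ.
rewrite (_ : (fun N => _) = (fun N => \sum_i Im (log1p_sum N (e i)))); last first.
  by apply/funext => N; exact: Im_tr_log1p_sum.
move=> h; apply: (cvg_unique _ h) => //.
apply: cvg_big => [|i _]; first exact: add_continuous.
apply/cvgrPdist_le => eps eps0.
have c : (fun N => r ^+ N / (1 - r)) @ \oo --> (0 / (1 - r)).
  by apply: cvgMl; apply: cvg_expr; rewrite ger0_norm.
rewrite mul0r in c.
have /cvgrPdist_le /(_ _ eps0) := c; apply: filterS => N h0.
apply: (le_trans (arg1p_log_sum N (le i) r1)).
by apply: le_trans h0; rewrite sub0r normrN ler_norm.
Qed.

Lemma lnarg_eigenP n r (Z : 'M[C]_n) : 0 <= r < 1 -> bnd r Z -> exists e : 'I_n -> C,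
  [/\ forall k, \tr (Z ^+ k) = \sum_i e i ^+ k, \det (1%:M + Z) = \prod_i (1 + e i),
    forall i, cabs (e i) <= r & lnarg Z = \sum_i arg1p (e i)].
Proof.
move=> r01 hZ; have [e [h1 h2] h3] := mx_eigenvalues Z.
have le i : cabs (e i) <= r by apply: bnd_eigen (h3 i) => //; case/andP: r01.
by exists e; split => //; apply: lnarg_sum_eigen le.
Qed.

(** The error depends on [Z] only through [r]; this uniformity is what makes [lnarg] continuous. *)
Lemma lnarg_approx n r (Z : 'M[C]_n) N : 0 <= r < 1 -> bnd r Z ->
  `|lnarg Z - Im (\tr (mx_log1p_sum N Z))| <= n%:R * (r ^+ N / (1 - r)).
Proof.
move=> r01 hZ; have [e [h1 _ h3 ->]] := lnarg_eigenP r01 hZ.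
rewrite (Im_tr_log1p_sum _ h1) -sumrB; apply: (le_trans (ler_norm_sum _ _ _)).
rewrite -[n in leRHS]card_ord mulr_natl -sumr_const; apply: ler_sum => i _.
by apply: arg1p_log_sum => //; case/andP: r01.
Qed.

(** The arguments of the eigenvalues of 1 + Z add up to [lnarg Z]. So [lnarg] is determined modulo 2
    pi by a determinant, which is multiplicative. *)
Lemma lnarg_det n r (Z : 'M[C]_n) : 0 <= r < 1 -> bnd r Z ->
  exists2 p : R, 0 < p & \det (1%:M + Z) = p%:C * cis (lnarg Z).
Proof.
move=> r01 hZ; have [e [_ -> h3 ->]] := lnarg_eigenP r01 hZ.
have h i : cabs (e i) < 1 by apply: le_lt_trans (h3 i) _; case/andP: r01.
exists (\prod_i cabs (1 + e i)).
  apply: prodr_gt0 => i _; rewrite lt_def cabs_ge0 andbT; apply/eqP => /cabs_eq0 /(congr1 Re).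
  by rewrite ReD /= => e0; have := one_plus_re_gt0 (h i); rewrite e0 ltxx.
rewrite rmorph_prod (big_morph cis cisD cis0) -big_split /=.
by apply: eq_bigr => i _; rewrite -arg1pP.
Qed.

(** Each eigenvalue contributes an arctangent. The bound is free of [r], which is why c is bounded
    on the whole group. *)
Lemma lnarg_le n r (Z : 'M[C]_n) : 0 <= r < 1 -> bnd r Z ->
  `|lnarg Z| <= n%:R * (pi / 2).
Proof.
move=> r01 hZ; have [e [_ _ _ ->]] := lnarg_eigenP r01 hZ.
apply: (le_trans (ler_norm_sum _ _ _)).
rewrite -[n in leRHS]card_ord mulr_natl -sumr_const; apply: ler_sum => i _.
by rewrite ler_norml ltW ?atan_gtNpi2 // ltW // atan_ltpi2.
Qed.

(** The series starts with the first power, so the traces of the positive powers determine [lnarg]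
    and no list of eigenvalues has to be exhibited. *)
Lemma lnarg_rank1 n r (Z : 'M[C]_n) (z : C) : 0 <= r < 1 -> bnd r Z -> cabs z <= r ->
  (forall k, \tr (Z ^+ k.+1) = z ^+ k.+1) -> lnarg Z = arg1p z.
Proof.
move=> r01 hZ hz htr; have /andP[r0 r1] := r01.
apply/eqP; rewrite -subr_eq0; apply/eqP.
(* The truncation errors of the matrix series (factor n) and of the scalar series (factor 1) add up
   to this constant. *)
apply: (@le_geom_eq0 _ ((n%:R + 1) / (1 - r)) r r01) => N.
have h1 := lnarg_approx N r01 hZ.
have e : Im (\tr (mx_log1p_sum N Z)) = Im (log1p_sum N z).
  rewrite /mx_log1p_sum /log1p_sum (linear_sum (@mxtrace C n)); congr Im.
  by apply: eq_bigr => k _; rewrite linearZ /= htr.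
have h2 := arg1p_log_sum N hz r1.
rewrite e in h1.
apply: (le_trans (ler_distD (Im (log1p_sum N z)) _ _)).
rewrite [X in _ + X]distrC.
apply: (le_trans (lerD h1 h2)).
by rewrite le_eqVlt; apply/orP; left; apply/eqP; ring.
Qed.

Lemma lnarg0 n : lnarg (0 : 'M[C]_n) = 0.
Proof.
rewrite (@lnarg_rank1 _ 0 _ 0) ?lexx ?ltr01 //.
- by rewrite /arg1p /= mul0r atan0.
- by move=> v; rewrite mulmx0 expr0n mul0r /rsq big1 // => j _; rewrite mxE Normc.normc0 expr0n.
- by rewrite Normc.normc0.
- by move=> k; rewrite !exprS !mul0r mxtrace0.
Qed.

End Lnarg.

(** * Continuity of [lnarg] *)

Section ComplexContinuity.
Variables (R : realType) (T : topologicalType).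
Local Notation C := R[i].
Local Notation Re := (@complex.Re R).
Local Notation Im := (@complex.Im R).
Implicit Types (x : T).

(** Stated through real and imaginary parts, so that all limits are limits of real functions. *)
Definition ccont (f : T -> C) x :=
  Re (f t) @[t --> x] --> Re (f x) /\ Im (f t) @[t --> x] --> Im (f x).

Definition mcont m n (M : T -> 'M[C]_(m, n)) x :=
  forall i j, ccont (fun t => M t i j) x.

Lemma ccont_eq f g x : f =1 g -> ccont f x -> ccont g x.
Proof. by move=> /funext ->. Qed.

Lemma ccont_cst c x : ccont (fun _ => c) x.
Proof. by split; exact: cvg_cst. Qed.

Lemma ccontD f g x : ccont f x -> ccont g x -> ccont (fun t => f t + g t) x.
Proof.
move=> [f1 f2] [g1 g2]; split.
  by under eq_fun do rewrite ReD; rewrite ReD; exact: cvgD.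
by under eq_fun do rewrite ImD; rewrite ImD; exact: cvgD.
Qed.

Lemma ccontM f g x : ccont f x -> ccont g x -> ccont (fun t => f t * g t) x.
Proof.
move=> [f1 f2] [g1 g2]; split.
  by under eq_fun do rewrite ReM; rewrite ReM; apply: cvgB; exact: cvgM.
by under eq_fun do rewrite ImM; rewrite ImM; apply: cvgD; exact: cvgM.
Qed.

Lemma ccont_real (f : T -> R) x : f t @[t --> x] --> f x -> ccont (fun t => (f t)%:C) x.
Proof. by move=> h; split => //=; exact: cvg_cst. Qed.

Lemma ccont_sum I (s : seq I) (P : pred I) (F : I -> T -> C) x :
  (forall i, P i -> ccont (F i) x) -> ccont (fun t => \sum_(i <- s | P i) F i t) x.
Proof.
move=> h; elim: s => [|i s IH].
  by apply: (@ccont_eq (fun _ => 0)) => [t|]; [rewrite big_nil|exact: ccont_cst].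
apply: (@ccont_eq (fun t => if P i then F i t + \sum_(j <- s | P j) F j t
  else \sum_(j <- s | P j) F j t)) => [t|]; first by rewrite big_cons.
by case Pi: (P i) => //; apply: ccontD => //; exact: h.
Qed.

Lemma ccont_prod I (s : seq I) (P : pred I) (F : I -> T -> C) x :
  (forall i, P i -> ccont (F i) x) -> ccont (fun t => \prod_(i <- s | P i) F i t) x.
Proof.
move=> h; elim: s => [|i s IH].
  by apply: (@ccont_eq (fun _ => 1)) => [t|]; [rewrite big_nil|exact: ccont_cst].
apply: (@ccont_eq (fun t => if P i then F i t * \prod_(j <- s | P j) F j t
  else \prod_(j <- s | P j) F j t)) => [t|]; first by rewrite big_cons.
by case Pi: (P i) => //; apply: ccontM => //; exact: h.
Qed.

Lemma ccontV f x : f x != 0 -> ccont f x -> ccont (fun t => (f t)^-1) x.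
Proof.
move=> fx [f1 f2].
have n0 : Re (f x) ^+ 2 + Im (f x) ^+ 2 != 0.
  rewrite -cabs_sqr expf_eq0 /=; apply: contra fx => /eqP h; apply/eqP; exact: cabs_eq0.
have cv : (Re (f t) ^+ 2 + Im (f t) ^+ 2)^-1 @[t --> x] --> (Re (f x) ^+ 2 + Im (f x) ^+ 2)^-1.
  apply: cvgV => //; apply: cvgD; under eq_fun do rewrite expr2; rewrite expr2; exact: cvgM.
have VE z : z^-1 = Complex (Re z * (Re z ^+ 2 + Im z ^+ 2)^-1)
    (- (Im z * (Re z ^+ 2 + Im z ^+ 2)^-1)) :> C.
  by case: z => a b.
split.
  by under eq_fun do rewrite VE /=; rewrite VE /=; exact: cvgM.
by under eq_fun do rewrite VE /=; rewrite VE /=; apply: cvgN; exact: cvgM.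
Qed.

Lemma mcont_cst m n (M : 'M[C]_(m, n)) x : mcont (fun _ => M) x.
Proof. by move=> i j; exact: ccont_cst. Qed.

Lemma mcontD m n (M N : T -> 'M[C]_(m, n)) x :
  mcont M x -> mcont N x -> mcont (fun t => M t + N t) x.
Proof.
move=> h1 h2 i j; apply: (@ccont_eq (fun t => M t i j + N t i j)) => [t|].
  by rewrite mxE.
exact: ccontD.
Qed.

Lemma mcontZ m n f (M : T -> 'M[C]_(m, n)) x :
  ccont f x -> mcont M x -> mcont (fun t => f t *: M t) x.
Proof.
move=> h1 h2 i j; apply: (@ccont_eq (fun t => f t * M t i j)) => [t|].
  by rewrite mxE.
exact: ccontM.
Qed.

Lemma mcontM m n p (M : T -> 'M[C]_(m, n)) (N : T -> 'M[C]_(n, p)) x :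
  mcont M x -> mcont N x -> mcont (fun t => M t *m N t) x.
Proof.
move=> h1 h2 i j; apply: (@ccont_eq (fun t => \sum_k M t i k * N t k j)) => [t|].
  by rewrite mxE.
by apply: ccont_sum => k _; exact: ccontM.
Qed.

Lemma mcontX n (M : T -> 'M[C]_n) k x : mcont M x -> mcont (fun t => M t ^+ k) x.
Proof.
move=> h; elim: k => [|k IH].
  by rewrite (_ : (fun t => _) = (fun=> 1%:M)); [exact: mcont_cst|exact/funext].
rewrite (_ : (fun t => _) = (fun t => M t *m M t ^+ k)); first exact: mcontM.
by apply/funext => t; rewrite exprS.
Qed.

Lemma ccont_det n (M : T -> 'M[C]_n) x : mcont M x -> ccont (fun t => \det (M t)) x.
Proof.
move=> h; apply: ccont_sum => s _; apply: ccontM; first exact: ccont_cst.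
by apply: ccont_prod => i _; exact: h.
Qed.

Lemma ccont_near f g x : (\forall t \near x, f t = g t) -> ccont f x -> ccont g x.
Proof.
move=> h [f1 f2]; have e : f x = g x by apply: (nbhs_singleton h).
split; rewrite -e.
  by apply: cvg_trans f1; apply: near_eq_cvg; apply: filterS h => t ->.
by apply: cvg_trans f2; apply: near_eq_cvg; apply: filterS h => t ->.
Qed.

Lemma ccont_neq0 f x : ccont f x -> f x != 0 -> \forall t \near x, f t != 0.
Proof.
move=> [f1 f2] fx.
have {fx} : Re (f x) != 0 \/ Im (f x) != 0.
  move: fx; rewrite eq_complex negb_and => /orP[]; [left|right] => //.
have n0 (u : T -> R) : u t @[t --> x] --> u x -> u x != 0 -> \forall t \near x, u t != 0.
  by move=> hu ux; apply: cvgr_neq0 hu _.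
by move=> [] h; [have := n0 _ f1 h|have := n0 _ f2 h];
  apply: filterS => t; apply: contra => /eqP ->.
Qed.

(** The inverse is given by the adjugate formula where the determinant does not vanish, hence on a
    neighbourhood of [x]. *)
Lemma mcont_inv n (M : T -> 'M[C]_n) x : M x \in unitmx -> mcont M x ->
  mcont (fun t => invmx (M t)) x.
Proof.
move=> u h; have cd := ccont_det h.
have d0 : \det (M x) != 0 by rewrite -unitfE -unitmxE.
have nd := ccont_neq0 cd d0.
have cadj : mcont (fun t => (\det (M t))^-1 *: \adj (M t)) x.
  apply: mcontZ; first exact: ccontV.
  move=> i j; apply: (@ccont_eq (fun t => cofactor (M t) j i)) => [t|]; first by rewrite mxE.
  apply: ccontM; first exact: ccont_cst.
  apply: ccont_det => k l; apply: ccont_eq (h (lift j k) (lift i l)) => t.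
  by rewrite !mxE.
move=> i j; apply: ccont_near (cadj i j).
by apply: filterS nd => t ht; rewrite /invmx unitmxE unitfE ht.
Qed.

Let close3 (a b c d e : R) :
  `|a - b| <= e / 3 -> `|d - c| <= e / 3 -> `|b - c| <= e / 3 -> `|a - d| <= e.
Proof. by rewrite !ler_norml => /andP[? ?] /andP[? ?] /andP[? ?]; apply/andP; split; lra. Qed.

(** With one [r] for a whole neighbourhood, [lnarg_approx] makes [lnarg] a uniform limit of
    imaginary parts of polynomials in the entries. *)
Lemma lnarg_continuous n r (Z : T -> 'M[C]_n) x : 0 <= r < 1 ->
  (\forall t \near x, bnd r (Z t)) -> mcont Z x ->
  {for x, continuous (fun t => lnarg (Z t))}.
Proof.
move=> r01 hb hc; have /andP[r0 r1] := r01.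
apply/cvgrPdist_le => eps eps0.
have c : (fun N => n%:R * (r ^+ N / (1 - r))) @ \oo --> (n%:R * (0 / (1 - r))).
  by apply: cvgMr; apply: cvgMl; apply: cvg_expr; rewrite ger0_norm.
rewrite mul0r mulr0 in c.
have e3 : 0 < eps / 3 by rewrite divr_gt0.
have /cvgrPdist_le /(_ _ e3) [N _ /(_ N (leqnn N))] := c.
rewrite sub0r normrN ger0_norm; last first.
  by rewrite mulr_ge0 // divr_ge0 ?exprn_ge0 // subr_ge0 ltW.
move=> hN.
have cN : {for x, continuous (fun t => Im (\tr (mx_log1p_sum N (Z t))))}.
  rewrite /mxtrace /mx_log1p_sum.
  have [] : ccont (fun t => \sum_i (\sum_(k < N) log1p_coef R k *: Z t ^+ k.+1) i i) x => //.
  apply: ccont_sum => i _.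
  apply: (@ccont_eq (fun t => \sum_(k < N) log1p_coef R k * (Z t ^+ k.+1) i i)) => [t|].
    by rewrite summxE; apply: eq_bigr => k _; rewrite mxE.
  apply: ccont_sum => k _; apply: ccontM; first exact: ccont_cst.
  exact: mcontX.
have /cvgrPdist_le /(_ _ e3) h := cN.
near=> t.
have b0 : bnd r (Z x) by exact: nbhs_singleton hb.
have bt : bnd r (Z t) by near: t.
have k1 := le_trans (lnarg_approx N r01 b0) hN.
have k2 := le_trans (lnarg_approx N r01 bt) hN.
have k3 : `|Im (\tr (mx_log1p_sum N (Z x))) - Im (\tr (mx_log1p_sum N (Z t)))| <= eps / 3.
  by near: t.
exact: close3 k1 k2 k3.
Unshelve. all: by end_near.
Qed.

End ComplexContinuity.

(** * The Berezin cocycle *)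

Section PseudoUnitary.
Variables (R : realType) (n : nat).
Local Notation C := R[i].
Local Notation cabs := (@Normc.normc R).
Local Notation Re := (@complex.Re R).
Local Notation Im := (@complex.Im R).
Implicit Types A B Z W X : 'M[C]_n.

Lemma rsq_mulE (v : 'rV[C]_n) m (X : 'M[C]_(n, m)) :
  (rsq (v *m X))%:C = (v *m (X *m ctr X) *m ctr v) 0 0.
Proof. by rewrite -rsqE ctrM !mulmxA. Qed.

Lemma rsq0 m : rsq (0 : 'rV[C]_m) = 0.
Proof. by rewrite /rsq big1 // => j _; rewrite mxE Normc.normc0 expr0n. Qed.

(* [A Cc; B D] are the blocks of an element of U(n,n). *)
Record pu (A B Cc D : 'M[C]_n) : Prop := Pu {
  puA : A *m ctr A = 1%:M + B *m ctr B;
  puD : D *m ctr D = 1%:M + Cc *m ctr Cc;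
  puAC : A *m ctr Cc = B *m ctr D;
  puAB : ctr A *m B = ctr Cc *m D;
  puBD : ctr D *m D = 1%:M + ctr B *m B }.

Lemma rsq_expand m p q (X : 'M[C]_(n, m)) (Y : 'M[C]_(n, p)) (Z : 'M[C]_(n, q)) (v : 'rV[C]_n) :
  X *m ctr X = Y *m ctr Y + Z *m ctr Z ->
  rsq (v *m X) = rsq (v *m Y) + rsq (v *m Z).
Proof.
move=> e; apply: complexI; rewrite rmorphD rsq_mulE e.
by rewrite mulmxDr mulmxDl [LHS]mxE -!rsq_mulE.
Qed.

Lemma rsq_expand4 m p q k (X : 'M[C]_(n, m)) (U : 'M[C]_(n, k)) (Y : 'M[C]_(n, p))
    (Z : 'M[C]_(n, q)) (v : 'rV[C]_n) :
  X *m ctr X + U *m ctr U = Y *m ctr Y + Z *m ctr Z ->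
  rsq (v *m X) + rsq (v *m U) = rsq (v *m Y) + rsq (v *m Z).
Proof.
have mxD (M N : 'M[C]_1) : (M + N) 0 0 = M 0 0 + N 0 0 by rewrite mxE.
have inj (a b c d : R) : a%:C + b%:C = c%:C + d%:C -> a + b = c + d by move/(congr1 Re).
move=> e; apply: inj.
rewrite (rsq_mulE v X) (rsq_mulE v U) (rsq_mulE v Y) (rsq_mulE v Z).
by rewrite -!mxD -!mulmxDl -!mulmxDr e.
Qed.

Lemma rsq_expand1 p q (X : 'M[C]_(n, p)) (Y : 'M[C]_(n, q)) (v : 'rV[C]_n) :
  X *m ctr X = 1%:M + Y *m ctr Y -> rsq (v *m X) = rsq v + rsq (v *m Y).
Proof.
move=> e; rewrite -{2}[v]mulmx1; apply: rsq_expand.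
by rewrite ctr1 mulmx1.
Qed.

(** If vA = 0, the relation gives 0 = |v|^2 + |vB|^2. *)
Lemma unitmx_of_expand A B : A *m ctr A = 1%:M + B *m ctr B -> A \in unitmx.
Proof.
move=> e; rewrite -row_free_unit -kermx_eq0; apply/rowV0P => v /sub_kermxP vA.
apply: rsq_eq0; have := rsq_expand1 v e; rewrite vA rsq0.
by have := rsq_ge0 v; have := rsq_ge0 (v *m B); lra.
Qed.

(** The square of the Frobenius norm: a bound for the operator norm that is visibly continuous in
    the entries, as [berezin_continuous] needs. *)
Definition frob X : R := \sum_i \sum_j cabs (X i j) ^+ 2.

Lemma frob_ge0 X : 0 <= frob X.
Proof. by apply: sumr_ge0 => i _; apply: sumr_ge0 => j _; exact: sqr_ge0. Qed.

Lemma rsq_mul_le (v : 'rV[C]_n) X : rsq (v *m X) <= n%:R * frob X * rsq v.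
Proof.
(* Cauchy-Schwarz against the constant vector, from 2 a_i a_j <= a_i^2 + a_j^2. *)
have CS (a : 'I_n -> R) : (\sum_k a k) ^+ 2 <= n%:R * \sum_k a k ^+ 2.
  rewrite expr2 big_distrlr /=.
  apply: (@le_trans _ _ (\sum_i \sum_j (a i ^+ 2 + a j ^+ 2) / 2)).
    by apply: ler_sum => i _; apply: ler_sum => j _; have := sqr_ge0 (a i - a j); rewrite sqrrB; lra.
  rewrite le_eqVlt; apply/orP; left; apply/eqP.
  transitivity (\sum_i (n%:R * a i ^+ 2 + \sum_k a k ^+ 2) / 2).
    by apply: eq_bigr => i _; rewrite -mulr_suml big_split /= sumr_const card_ord mulr_natl.
  rewrite -mulr_suml big_split /= -mulr_sumr sumr_const card_ord -mulr_natl.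
  by field.
apply: (@le_trans _ _ (\sum_j n%:R * \sum_k (cabs (v 0 k) ^+ 2 * cabs (X k j) ^+ 2))).
  apply: ler_sum => j _; rewrite mxE.
  apply: (@le_trans _ _ ((\sum_k cabs (v 0 k) * cabs (X k j)) ^+ 2)).
    rewrite ler_pXn2r ?nnegrE ?cabs_ge0 //; last first.
      by apply: sumr_ge0 => k _; rewrite mulr_ge0 ?cabs_ge0.
    by apply: (le_trans (cabs_sum _ _ _)); apply: ler_sum => k _; rewrite cabsM.
  by apply: (le_trans (CS _)); rewrite ler_wpM2l //; apply: ler_sum => k _; rewrite exprMn.
rewrite -big_distrr /= -mulrA ler_wpM2l // exchange_big /= /rsq big_distrr /=.
apply: ler_sum => k _; rewrite -big_distrr /= mulrC ler_wpM2r ?sqr_ge0 //.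
rewrite /frob [leRHS](bigD1 k) //= lerDl; apply: sumr_ge0 => i _; apply: sumr_ge0 => j _.
exact: sqr_ge0.
Qed.

Lemma pu_unitA A B Cc D : pu A B Cc D -> A \in unitmx.
Proof. by move=> h; exact: unitmx_of_expand (puA h). Qed.

Lemma pu_unitD A B Cc D : pu A B Cc D -> D \in unitmx.
Proof. by move=> h; exact: unitmx_of_expand (puD h). Qed.

(** For u = v A^-1 the relation for A gives |v|^2 = |u|^2 + |uB|^2. The bound 1 is enough here,
    since strictness of the contraction is supplied by the other factor, in [pu_bndW]. *)
Lemma pu_bndZ A B Cc D : pu A B Cc D -> bnd 1 (invmx A *m B).
Proof.
move=> h v; have uA := pu_unitA h; rewrite expr1n mul1r mulmxA.
have := rsq_expand1 (v *m invmx A) (puA h); rewrite mulmxKV // => ->.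
by rewrite lerDr rsq_ge0.
Qed.

(* Since [W = (B D^-1)^*], the relation [D^* D = 1 + B^* B] gives
   [1 - W W^* = D^-* D^-1]. *)
Lemma pu_bndW A B Cc D M : pu A B Cc D -> n%:R * frob (ctr D) <= M -> 1 <= M ->
  bnd (Num.sqrt (1 - M^-1)) (Cc *m invmx A).
Proof.
move=> h hM M1 v.
have uA := pu_unitA h; have uD := pu_unitD h.
have uD' : ctr D \in unitmx by rewrite /ctr map_unitmx unitmx_tr.
have uA' : ctr A \in unitmx by rewrite /ctr map_unitmx unitmx_tr.
have M0 : 0 < M by lra.
have iM : M^-1 <= 1 by rewrite invf_le1.
rewrite sqr_sqrtr ?subr_ge0 //.
have eW : ctr (Cc *m invmx A) = B *m invmx D.
  have -> : B = invmx (ctr A) *m (ctr Cc *m D) by rewrite -(puAB h) mulKmx.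
  rewrite ctrM !mulmxA mulmxK //; congr (_ *m _).
  by rewrite /ctr -map_invmx trmx_inv.
have eWW : (Cc *m invmx A) *m ctr (Cc *m invmx A) + invmx (ctr D) *m ctr (invmx (ctr D)) = 1%:M.
  rewrite -[X in X *m _]ctrK eW ctrM.
  have eD : ctr (invmx D) = invmx (ctr D) by rewrite /ctr -map_invmx trmx_inv.
  have eD' : ctr (invmx (ctr D)) = invmx D by rewrite -eD ctrK.
  rewrite eD eD' -mulmxA (mulmxA (ctr B)) -mulmxDr -{2}[invmx D]mul1mx -mulmxDl addrC -(puBD h).
  by rewrite mulmxK // mulVmx.
have e : rsq v = rsq (v *m (Cc *m invmx A)) + rsq (v *m invmx (ctr D)).
  by rewrite -{1}[v]mulmx1; apply: rsq_expand; rewrite ctr1 mulmx1 eWW.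
have := rsq_mul_le (v *m invmx (ctr D)) (ctr D); rewrite mulmxKV // => k.
have k2 : rsq v <= M * rsq (v *m invmx (ctr D)).
  by apply: (le_trans k); rewrite ler_wpM2r ?rsq_ge0.
rewrite mulrBl mul1r lerBrDl {2}e addrC lerD2l.
by rewrite mulrC ler_pdivrMr // mulrC.
Qed.

Lemma pu_bndW_ex A B Cc D : pu A B Cc D ->
  exists2 r, 0 <= r < 1 & bnd r (Cc *m invmx A).
Proof.
move=> h; have := @pu_bndW _ _ _ _ (n%:R * frob (ctr D) + 1) h.
have f0 := frob_ge0 (ctr D).
have f1 : 0 <= n%:R * frob (ctr D) by rewrite mulr_ge0.
move=> k; exists (Num.sqrt (1 - (n%:R * frob (ctr D) + 1)^-1)); last by apply: k; lra.
rewrite sqrtr_ge0 /= -[ltRHS]sqrtr1 ltr_sqrt // ltrBlDl ltrDr invr_gt0; lra.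
Qed.

Lemma bndM1 r Z W : bnd 1 Z -> bnd r W -> bnd r (Z *m W).
Proof. by move=> h1 h2; rewrite -[r]mulr1; exact: bndM. Qed.

Lemma unitmx_1ZW r Z W : 0 <= r < 1 -> bnd 1 Z -> bnd r W -> 1%:M + Z *m W \in unitmx.
Proof.
move=> r01 h1 h2; have [p p0] := lnarg_det r01 (bndM1 h1 h2).
rewrite unitmxE unitfE => ->; rewrite mulf_neq0 ?cis_neq0 //.
by rewrite fmorph_eq0 gt_eqF.
Qed.

(* The row action of U(n,n) on the closed unit ball of matrices. *)
Lemma pu_actZ A B Cc D Z : pu A B Cc D -> bnd 1 Z -> A + Z *m Cc \in unitmx ->
  bnd 1 (invmx (A + Z *m Cc) *m (B + Z *m D)).
Proof.
move=> h hZ u v; rewrite expr1n mul1r mulmxA.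
set w := v *m invmx _; have -> : v = w *m (A + Z *m Cc) by rewrite mulmxKV.
have e : (A + Z *m Cc) *m ctr (A + Z *m Cc) + Z *m ctr Z =
    1%:M *m ctr 1%:M + (B + Z *m D) *m ctr (B + Z *m D).
  have puCA : Cc *m ctr A = D *m ctr B.
    by have /(congr1 (@ctr R _ _)) := puAC h; rewrite !ctrM !ctrK.
  rewrite !ctrD !ctrM ctr1 mulmx1 !mulmxDr !mulmxDl !mulmxA (puA h).
  rewrite -[Z *m Cc *m ctr A]mulmxA puCA (puAC h) !mulmxA.
  rewrite -[Z *m D *m ctr D]mulmxA (puD h) mulmxDr mulmxDl mulmx1 !mulmxA.
  move: (B *m ctr B) (Z *m D *m ctr B) (B *m ctr D *m ctr Z) (Z *m Cc *m ctr Cc *m ctr Z) (Z *m ctr Z) 1%:M.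
  by move=> x1 x2 x3 x4 x5 x6; apply/matrixP => i j; rewrite !mxE; ring.
have := rsq_expand4 w e; rewrite mulmx1.
by have := hZ w; rewrite expr1n mul1r; lra.
Qed.

(** A^-1 B is the image of 0 under the row action Z |-> (A + ZC)^-1 (B + ZD). The identity says that
    a product sends 0 to the image under the second factor of the image of 0 under the first. *)
Lemma pu_blocks_mul A1 B1 C1 D1 A2 B2 C2 D2 A12 B12 C12 D12 :
  pu A1 B1 C1 D1 -> pu A12 B12 C12 D12 ->
  A12 = A1 *m A2 + B1 *m C2 -> B12 = A1 *m B2 + B1 *m D2 ->
  invmx A12 *m B12 = invmx (A2 + invmx A1 *m B1 *m C2) *m (B2 + invmx A1 *m B1 *m D2).
Proof.
move=> h1 h12 e1 e2; have u1 := pu_unitA h1; have u12 := pu_unitA h12.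
have eA : A12 = A1 *m (A2 + invmx A1 *m B1 *m C2).
  by rewrite e1 mulmxDr !mulmxA mulmxV // mul1mx.
have eB : B12 = A1 *m (B2 + invmx A1 *m B1 *m D2).
  by rewrite e2 mulmxDr !mulmxA mulmxV // mul1mx.
move: eA eB; move: (A2 + _) (B2 + _) => X Y eA eB.
have u : X \in unitmx by move: u12; rewrite eA unitmx_mul u1.
apply: (can_inj (mulKmx u12)); rewrite mulKVmx // {1}eA eB -mulmxA.
by rewrite mulKVmx.
Qed.

Lemma cis_cocycle (p1 p2 p3 p4 l1 l2 l3 l4 : R) :
  0 < p1 -> 0 < p2 -> 0 < p3 -> 0 < p4 ->
  p1%:C * cis l1 * (p2%:C * cis l2) = p3%:C * cis l3 * (p4%:C * cis l4) ->
  cis (l1 + l2 - l3 - l4) = 1.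
Proof.
move=> p10 p20 p30 p40 e.
have h : cis (l1 + l2) = cis (l3 + l4).
  apply: (@cis_inj_scale _ (p1 * p2) (p3 * p4)); rewrite ?mulr_gt0 //.
  by rewrite !cisD !rmorphM /= mulrACA e mulrACA.
apply: (mulIf (cis_neq0 (l3 + l4))).
by rewrite mul1r -cisD -h; congr cis; ring.
Qed.

(** [E] takes values in 2 pi Z, so it vanishes wherever |E| < 1. If it did not vanish at the end
    point, |E| would pass through 1/2. *)
Lemma cis_path_eq0 (E : R -> R) : continuous E -> (forall t, cis (E t) = 1) ->
  E 0 = 0 -> E (pi / 2) = 0.
Proof.
move=> cE cisE E0.
have Esmall t : `|E t| < 1 -> E t = 0.
  move=> h; apply: cis_eq1_small => //; apply: (lt_trans h).
  by have := @pi_ge2 R; lra.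
apply/eqP; apply: contraT => Ene.
have Eb : 1 <= `|E (pi / 2)|.
  by rewrite leNgt; apply: contra Ene => /Esmall ->.
have p0 : (0 : R) <= pi / 2 by rewrite divr_ge0 ?pi_ge0.
have cN : {within `[0, pi / 2], continuous (fun t => `|E t|)}.
  by apply: continuous_subspaceT => t; apply: cvg_norm; exact: cE.
have [|c _ cE2] := IVT p0 cN (v := 1/2).
  rewrite E0 normr0; rewrite ge_min le_max; apply/andP; split; apply/orP; [left|right]; lra.
have : E c = 0 by apply: Esmall; rewrite cE2; lra.
by move=> e; move: cE2; rewrite e normr0; lra.
Qed.

Let sum_eq_of_sub0 (a b c d : R) : a + b - c - d = 0 -> a + b = c + d.
Proof. by move=> h; lra. Qed.

Lemma unitmx_det_neq0 (M : 'M[C]_n) : M \in unitmx -> \det M != 0.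
Proof. by rewrite unitmxE unitfE. Qed.

Lemma addmx_factor A Cc Z : A \in unitmx ->
  A + Z *m Cc = (1%:M + Z *m (Cc *m invmx A)) *m A.
Proof. by move=> u; rewrite mulmxDl mul1mx -!mulmxA mulVmx // mulmx1. Qed.

Let det_cocycle_aux (d1 d2 d3 d4 a2 a3 : C) :
  d3 * (a2 * d4 * a3) = d1 * a2 * d2 * a3 -> d1 * d2 * a2 * a3 = d3 * d4 * a2 * a3.
Proof. by move=> e; transitivity (d1 * a2 * d2 * a3); [ring|rewrite -e; ring]. Qed.

(** det (A + ZC) is an automorphy factor: its value for a product at Z is its value for the first
    factor at Z times its value for the second at the transported point. Since A + ZC = (1 + Z C
    A^-1) A, dividing by the determinants of the blocks A gives the identity. *)
Lemma det_cocycle A2 B2 C2 D2 A3 C3 A23 C23 Z :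
  A2 \in unitmx -> A3 \in unitmx -> A2 + Z *m C2 \in unitmx -> A23 \in unitmx ->
  A23 = A2 *m A3 + B2 *m C3 -> C23 = C2 *m A3 + D2 *m C3 ->
  \det (1%:M + Z *m (C2 *m invmx A2)) *
    \det (1%:M + invmx (A2 + Z *m C2) *m (B2 + Z *m D2) *m (C3 *m invmx A3))
  = \det (1%:M + Z *m (C23 *m invmx A23)) *
    \det (1%:M + invmx A2 *m B2 *m (C3 *m invmx A3)).
Proof.
move=> u2 u3 uZ u23 e1 e2.
set M := A2 + Z *m C2.
have uM : M \in unitmx by [].
have m1 := congr1 determinant (addmx_factor C2 Z u2); rewrite det_mulmx -/M in m1.
have m3 := congr1 determinant (addmx_factor C23 Z u23); rewrite det_mulmx in m3.
have m2 : \det (A23 + Z *m C23) =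
    \det M * \det (1%:M + invmx M *m (B2 + Z *m D2) *m (C3 *m invmx A3)) * \det A3.
  rewrite -!det_mulmx; congr (\det _).
  rewrite -mulmxA -addmx_factor // mulmxDr !mulmxA mulmxV // mul1mx.
  rewrite e1 e2 /M !mulmxDl mulmxDr !mulmxA.
  by apply/matrixP => i j; rewrite !mxE; ring.
have m4 : \det A23 = \det A2 * \det (1%:M + invmx A2 *m B2 *m (C3 *m invmx A3)) * \det A3.
  rewrite -!det_mulmx; congr (\det _).
  by rewrite -mulmxA -addmx_factor // mulmxDr !mulmxA mulmxV // mul1mx.
apply: (mulIf (unitmx_det_neq0 u2)); apply: (mulIf (unitmx_det_neq0 u3)).
rewrite m1 m3 m4 in m2.
exact: det_cocycle_aux m2.
Qed.

(* The phase of [det (1 + Z W)] is multiplicative up to the coboundary, so the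
   alternating sum below lies in 2 pi Z. Scaling Z down to 0 within the unit
   ball shows that it vanishes. *)
Lemma lnarg_cocycle A2 B2 C2 D2 A3 B3 C3 D3 A23 B23 C23 D23 Z1 :
  pu A2 B2 C2 D2 -> pu A3 B3 C3 D3 -> pu A23 B23 C23 D23 ->
  A23 = A2 *m A3 + B2 *m C3 -> C23 = C2 *m A3 + D2 *m C3 -> bnd 1 Z1 ->
  lnarg (Z1 *m (C2 *m invmx A2)) +
    lnarg (invmx (A2 + Z1 *m C2) *m (B2 + Z1 *m D2) *m (C3 *m invmx A3)) =
  lnarg (Z1 *m (C23 *m invmx A23)) + lnarg (invmx A2 *m B2 *m (C3 *m invmx A3)).
Proof.
move=> h2 h3 h23 eA eC hZ1.
have u2 := pu_unitA h2; have u3 := pu_unitA h3; have u23 := pu_unitA h23.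
have [r2 r2l bW2] := pu_bndW_ex h2.
have [r3 r3l bW3] := pu_bndW_ex h3.
have [r23 r23l bW23] := pu_bndW_ex h23.
(* The sine has modulus at most 1 everywhere, so the path stays in the unit ball for all real t; it
   joins 0 to [Z1] on [0, pi/2]. *)
pose Z t := (sin t)%:C *: Z1.
have bZ t : bnd 1 (Z t).
  move=> v; rewrite /Z -scalemxAr rsqZ expr1n mul1r.
  have := hZ1 v; rewrite expr1n mul1r; apply: le_trans.
  rewrite cabs_real real_normK ?num_real //; apply: ler_piMl; first exact: rsq_ge0.
  by rewrite -(cos2Dsin2 t) lerDr sqr_ge0.
have uZ t : A2 + Z t *m C2 \in unitmx.
  by rewrite addmx_factor // unitmx_mul u2 andbT; exact: unitmx_1ZW r2l _ bW2.
pose Z12 t := invmx (A2 + Z t *m C2) *m (B2 + Z t *m D2).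
have bZ12 t : bnd 1 (Z12 t) by exact: pu_actZ.
pose E t := lnarg (Z t *m (C2 *m invmx A2)) + lnarg (Z12 t *m (C3 *m invmx A3))
  - lnarg (Z t *m (C23 *m invmx A23)) - lnarg (invmx A2 *m B2 *m (C3 *m invmx A3)).
have E1 : Z (pi / 2) = Z1 by rewrite /Z sin_pihalf scale1r.
have E0 : E 0 = 0.
  by rewrite /E /Z12 /Z sin0 scale0r !mul0mx !addr0 lnarg0 add0r subr0 subrr.
have cisE t : cis (E t) = 1.
  have [p1 p10 e1] := lnarg_det r2l (bndM1 (bZ t) bW2).
  have [p2 p20 e2] := lnarg_det r3l (bndM1 (bZ12 t) bW3).
  have [p3 p30 e3] := lnarg_det r23l (bndM1 (bZ t) bW23).
  have [p4 p40 e4] := lnarg_det r3l (bndM1 (pu_bndZ h2) bW3).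
  have ee := etrans (esym (congr2 *%R e1 e2))
    (etrans (det_cocycle u2 u3 (uZ t) u23 eA eC) (congr2 *%R e3 e4)).
  exact: cis_cocycle ee.
have cZ t : mcont Z t.
  apply: mcontZ; last exact: mcont_cst.
  by apply: ccont_real; exact: continuous_sin.
have cl r (Y : R -> 'M[C]_n) t : 0 <= r < 1 -> (forall s, bnd r (Y s)) -> mcont Y t ->
    lnarg (Y s) @[s --> t] --> lnarg (Y t).
  by move=> r01 hY; apply: (lnarg_continuous r01); exact: (filterE _ hY).
have cE : continuous E.
  move=> t; rewrite /E.
  apply: cvgB; last exact: cvg_cst.
  apply: cvgB; last first.
    apply: (cl _ _ t r23l (fun s => bndM1 (bZ s) bW23)).
    by apply: mcontM; [exact: cZ|exact: mcont_cst].
  apply: cvgD.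
    apply: (cl _ _ t r2l (fun s => bndM1 (bZ s) bW2)).
    by apply: mcontM; [exact: cZ|exact: mcont_cst].
  apply: (cl _ _ t r3l (fun s => bndM1 (bZ12 s) bW3)).
  apply: mcontM; last exact: mcont_cst.
  apply: mcontM; first apply: mcont_inv => //.
    by apply: mcontD; [exact: mcont_cst|apply: mcontM; [exact: cZ|exact: mcont_cst]].
  by apply: mcontD; [exact: mcont_cst|apply: mcontM; [exact: cZ|exact: mcont_cst]].
have := cis_path_eq0 cE cisE E0; rewrite /E /Z12 E1.
exact: sum_eq_of_sub0.
Qed.

End PseudoUnitary.

(** * Sp(2n, R) inside U(n, n) and the cocycle identity *)

Section BerezinCocycle.
Variables (R : realType) (n : nat).
Local Notation C := R[i].
Local Notation cabs := (@Normc.normc R).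
Local Notation Re := (@complex.Re R).
Local Notation Im := (@complex.Im R).
Local Notation RC := (real_complex R).
Local Notation J := (cayley_mx R n).
Local Notation I := ('i%C : C).

Lemma in_Sp1 : in_Sp (1%:M : 'M[R]_(n + n)).
Proof. by rewrite /in_Sp trmx1 mul1mx mulmx1. Qed.

Lemma in_SpM (g h : 'M[R]_(n + n)) : in_Sp g -> in_Sp h -> in_Sp (g *m h).
Proof.
rewrite /in_Sp trmx_mul => hg hh.
by rewrite -[RHS]hh -[X in _ *m X *m h]hg !mulmxA.
Qed.

Lemma std_symp_mul : std_symp R n *m std_symp R n = - 1%:M.
Proof.
rewrite /std_symp mulmx_block !mulmx0 !mul0mx !mulmx1 !mul1mx !add0r !addr0.
by rewrite [in RHS](@scalar_mx_block _ n n) opp_block_mx oppr0.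
Qed.

Lemma in_Sp_unit (g : 'M[R]_(n + n)) : in_Sp g -> g \in unitmx.
Proof.
rewrite /in_Sp => h; have : (- std_symp R n *m g^T *m std_symp R n) *m g = 1%:M.
  by rewrite -!mulmxA (mulmxA g^T) h mulNmx std_symp_mul opprK.
by move/mulmx1_unit => -[].
Qed.

Lemma in_SpV (g : 'M[R]_(n + n)) : in_Sp g -> in_Sp (invmx g).
Proof.
move=> h; have u := in_Sp_unit h.
rewrite /in_Sp -{1}h trmx_inv !mulmxA mulVmx ?unitmx_tr // mul1mx.
by rewrite mulmxK.
Qed.

Lemma in_Sp_det (g : 'M[R]_(n + n)) : in_Sp g -> `|\det g| = 1.
Proof.
move=> h; have /(congr1 determinant) := h; rewrite !det_mulmx det_tr => e.
have uK : \det (std_symp R n) != 0.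
  have /(congr1 determinant) := std_symp_mul; rewrite det_mulmx => e2.
  apply/eqP => d0; move: e2; rewrite d0 mul0r => /esym/eqP.
  by rewrite -scaleN1r detZ det1 mulr1 expf_eq0 oppr_eq0 oner_eq0 andbF.
have : \det g ^+ 2 = 1.
  by apply: (mulIf uK); rewrite mul1r -[RHS]e expr2; ring.
by move/eqP; rewrite sqrf_eq1 => /orP[] /eqP ->; rewrite ?normrN normr1.
Qed.

Let s : C := (Num.sqrt 2)^-1%:C.

Lemma sqrt2V_sqr : s * s = 2^-1.
Proof.
rewrite /s -rmorphM -invfM -expr2 sqr_sqrtr ?ler0n //.
by rewrite fmorphV rmorph_nat.
Qed.

Lemma ctrZ m p (a : R) (M : 'M[C]_(m, p)) : ctr (a%:C *: M) = a%:C *: ctr M.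
Proof.
apply/matrixP => i j; rewrite /ctr !mxE; case: (M j i) => u v.
by apply/eqP; rewrite eq_complex /=; apply/andP; split; apply/eqP; ring.
Qed.

Lemma ctr_scalar m (a : C) : ctr (a%:M : 'M[C]_m) = (conjc a)%:M.
Proof. by rewrite /ctr tr_scalar_mx map_scalar_mx. Qed.

Lemma ctr_block m1 m2 n1 n2 (M1 : 'M[C]_(m1, n1)) (M2 : 'M[C]_(m1, n2)) (M3 : 'M[C]_(m2, n1))
    (M4 : 'M[C]_(m2, n2)) :
  ctr (block_mx M1 M2 M3 M4) = block_mx (ctr M1) (ctr M3) (ctr M2) (ctr M4).
Proof. by rewrite /ctr tr_block_mx map_block_mx. Qed.

Lemma ctr_cayley : ctr J = s *: block_mx 1%:M (- I)%:M (- I)%:M 1%:M.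
Proof.
rewrite /cayley_mx ctrZ ctr_block !ctr1 !ctr_scalar; congr (_ *: block_mx _ _%:M _%:M _);
  by apply/eqP; rewrite eq_complex /= oppr0 !eqxx.
Qed.

Lemma cayley_ctr : J *m ctr J = 1%:M.
Proof.
rewrite ctr_cayley /cayley_mx -scalemxAl -scalemxAr scalerA sqrt2V_sqr mulmx_block.
rewrite !mulmx1 !mul1mx -!scalar_mxM -!raddfD /=.
have -> : 1 + I * - I = 2 by rewrite mulrN -expr2 sqr_i opprK.
have -> : I * - I + 1 = 2 by rewrite mulrN -expr2 sqr_i opprK.
rewrite addNr subrr [0%:M]raddf0 -scalar_mx_block.
by rewrite scale_scalar_mx mulVf ?pnatr_eq0.
Qed.

Lemma cayley_unit : J \in unitmx.
Proof. by have := cayley_ctr => /mulmx1_unit []. Qed.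

Lemma invmx_cayley : invmx J = ctr J.
Proof. by rewrite -[RHS](mulKmx cayley_unit) cayley_ctr mulmx1. Qed.

Lemma ctr_cayley_mul : ctr J *m J = 1%:M.
Proof. by rewrite -invmx_cayley mulVmx // cayley_unit. Qed.

(** The conjugate of g by the Cayley matrix, written with the adjoint because that matrix is
    unitary. *)
Definition hmx (g : 'M[R]_(n + n)) : 'M[C]_(n + n) := ctr J *m map_mx RC g *m J.

Let conj_mulmx m (P Q X Y : 'M[C]_m) : Q *m P = 1%:M ->
  P *m (X *m Y) *m Q = (P *m X *m Q) *m (P *m Y *m Q).
Proof. by move=> e; rewrite !mulmxA -(mulmxA (P *m X) Q P) e mulmx1. Qed.

Lemma hmxM g h : hmx (g *m h) = hmx g *m hmx h.
Proof. by rewrite /hmx map_mxM; apply: conj_mulmx; exact: cayley_ctr. Qed.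

(** The Hermitian form of signature (n, n); up to the factor i it is the symplectic form in the
    Cayley basis ([symp_cayley]). *)
Definition Dsig : 'M[C]_(n + n) := block_mx 1%:M 0 0 (- 1%:M).

Lemma symp_cayley : map_mx RC (std_symp R n) *m J = J *m (I *: Dsig).
Proof.
have II : I * I = -1 by rewrite -expr2 sqr_i.
rewrite /std_symp map_block_mx !map_mx0 map_mxN map_mx1 /cayley_mx -scalemxAl -scalemxAr.
congr (_ *: _).
rewrite /Dsig scale_block_mx scaler0 scalerN scale_scalar_mx mulr1 !mulmx_block.
rewrite !mul0mx !mul1mx !mulmx0 !mulmx1 !mulNmx !mulmxN !mul1mx !add0r !addr0 -scalar_mxM II.
by rewrite raddfN /= opprK.
Qed.

(** For a real matrix the adjoint is the transpose, so preserving the symplectic form becomes, after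
    conjugation by the Cayley matrix, preserving [Dsig]. *)
Lemma hmx_pseudo_unitary g : in_Sp g -> ctr (hmx g) *m Dsig *m hmx g = Dsig.
Proof.
move=> hg; have cg : ctr (map_mx RC g) = map_mx RC g^T.
  by apply/matrixP => i j; rewrite /ctr !mxE conjc_real.
have eD : I *: Dsig = ctr J *m map_mx RC (std_symp R n) *m J.
  by rewrite -mulmxA symp_cayley mulmxA ctr_cayley_mul mul1mx.
have I0 : I != 0 by apply/eqP => /(congr1 Im) /= /eqP; rewrite oner_eq0.
apply: (scalerI I0); rewrite scalemxAl scalemxAr eD.
have -> : hmx g = ctr J *m map_mx RC g *m J by [].
rewrite !ctrM ctrK cg -[in RHS]hg !map_mxM mulmxA.
move: cayley_ctr; move: (J) (ctr J) (map_mx RC g) (map_mx RC g^T) (map_mx RC (std_symp R n)).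
by move=> P Q X Y Z e; rewrite -!conj_mulmx.
Qed.

Lemma DsigK : Dsig *m Dsig = 1%:M.
Proof.
rewrite /Dsig mulmx_block !mulmx0 !mul0mx !mulmx1 !addr0 !add0r mulmxN mulmx1 opprK.
by rewrite -scalar_mx_block.
Qed.

Lemma hmx_pseudo_unitary_r g : in_Sp g -> hmx g *m Dsig *m ctr (hmx g) = Dsig.
Proof.
move=> /hmx_pseudo_unitary; move: (hmx g) => h e.
have : (Dsig *m ctr h *m Dsig) *m h = 1%:M by rewrite -!mulmxA (mulmxA (ctr h)) e DsigK.
move/mulmx1C => e2.
by rewrite -[LHS]mulmx1 -DsigK -{1}[Dsig in RHS]mul1mx -e2 !mulmxA.
Qed.

Lemma block_pu (A B Cc D : 'M[C]_n) (h := block_mx A B Cc D) :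
  ctr h *m Dsig *m h = Dsig -> h *m Dsig *m ctr h = Dsig -> pu A B Cc D.
Proof.
rewrite /h /Dsig ctr_block !mulmx_block !mulmx0 !mulmx1 !mulmxN !mulmx1 !addr0 !add0r !mulNmx.
move=> /eq_block_mx[e1 e2 e3 e4] /eq_block_mx[f1 f2 f3 f4]; split.
- by rewrite -f1 subrK.
- by rewrite -[1%:M]opprK -f4 opprB subrK.
- by apply/eqP; rewrite -subr_eq0 f2.
- by apply/eqP; rewrite -subr_eq0 e2.
- by rewrite -[1%:M]opprK -e4 opprB subrK.
Qed.

Definition blA g := ulsubmx (hmx g).
Definition blB g := ursubmx (hmx g).
Definition blC g := dlsubmx (hmx g).
Definition blD g := drsubmx (hmx g).

Lemma hmx_pu g : in_Sp g -> pu (blA g) (blB g) (blC g) (blD g).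
Proof.
move=> hg; apply: block_pu; rewrite /blA /blB /blC /blD submxK.
  exact: hmx_pseudo_unitary.
exact: hmx_pseudo_unitary_r.
Qed.

Let submx_mul (M N : 'M[C]_(n + n)) :
  [/\ ulsubmx (M *m N) = ulsubmx M *m ulsubmx N + ursubmx M *m dlsubmx N,
    ursubmx (M *m N) = ulsubmx M *m ursubmx N + ursubmx M *m drsubmx N,
    dlsubmx (M *m N) = dlsubmx M *m ulsubmx N + drsubmx M *m dlsubmx N &
    drsubmx (M *m N) = dlsubmx M *m ursubmx N + drsubmx M *m drsubmx N].
Proof.
rewrite -{1 4 7 10}[M]submxK -{1 4 7 10}[N]submxK mulmx_block.
by rewrite block_mxKul block_mxKur block_mxKdl block_mxKdr.
Qed.

Lemma hmx_blocksM g h :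
  [/\ blA (g *m h) = blA g *m blA h + blB g *m blC h,
    blB (g *m h) = blA g *m blB h + blB g *m blD h,
    blC (g *m h) = blC g *m blA h + blD g *m blC h &
    blD (g *m h) = blC g *m blB h + blD g *m blD h].
Proof.
by rewrite /blA /blB /blC /blD hmxM; exact: submx_mul.
Qed.

Lemma PhiE g : Phi g = blA g.
Proof. by rewrite /Phi invmx_cayley. Qed.

Let bracket_expand (A1 B1 C2 A2 : 'M[C]_n) : A1 \in unitmx -> A2 \in unitmx ->
  invmx A1 *m (A1 *m A2 + B1 *m C2) *m invmx A2 - 1%:M
  = invmx A1 *m B1 *m (C2 *m invmx A2).
Proof.
move=> u1 u2; rewrite mulmxDr mulmxDl mulKmx // mulmxV // addrC addKr.
by rewrite !mulmxA.
Qed.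

(** With Phi(g1 g2) = A1 A2 + B1 C2 the bracket is 1 + (A1^-1 B1)(C2 A2^-1), so each of the two
    group elements enters through one factor only. *)
Lemma berezinE (g1 g2 : 'M[R]_(n + n)) : in_Sp g1 -> in_Sp g2 ->
  berezin g1 g2 = lnarg (invmx (blA g1) *m blB g1 *m (blC g2 *m invmx (blA g2))).
Proof.
move=> h1 h2; rewrite /berezin /lnarg !PhiE; have [-> _ _ _] := hmx_blocksM g1 g2.
have u1 := pu_unitA (hmx_pu h1); have u2 := pu_unitA (hmx_pu h2).
congr (Im (\tr (mx_ln1p _))).
exact: bracket_expand.
Qed.

(** The point A^-1 B attached to g1 g2 is the one attached to g1 moved by g2 ([pu_blocks_mul]); then
    [lnarg_cocycle] applies with [Z1] the point of g1. *)
Lemma berezin_cocycle (g1 g2 g3 : 'M[R]_(n + n)) : in_Sp g1 -> in_Sp g2 -> in_Sp g3 ->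
  berezin g1 g2 + berezin (g1 *m g2) g3 = berezin g1 (g2 *m g3) + berezin g2 g3.
Proof.
move=> h1 h2 h3; have h12 := in_SpM h1 h2; have h23 := in_SpM h2 h3.
rewrite (berezinE h1 h2) (berezinE h12 h3) (berezinE h1 h23) (berezinE h2 h3).
have k1 := hmx_pu h1; have k2 := hmx_pu h2; have k3 := hmx_pu h3.
have k23 := hmx_pu h23; have k12 := hmx_pu h12.
have [eA eB eC eD] := hmx_blocksM g1 g2.
have [fA fB fC fD] := hmx_blocksM g2 g3.
exact: (etrans (congr1 (fun X => lnarg _ + lnarg (X *m _)) (pu_blocks_mul k1 k12 eA eB))
  (lnarg_cocycle k2 k3 k23 fA fC (pu_bndZ k1))).
Qed.

Lemma berezin_le (g1 g2 : 'M[R]_(n + n)) : in_Sp g1 -> in_Sp g2 -> `|berezin g1 g2| <= n%:R * (pi / 2).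
Proof.
move=> h1 h2; rewrite (berezinE h1 h2); have [r r01 hr] := pu_bndW_ex (hmx_pu h2).
exact: (lnarg_le r01 (bndM1 (pu_bndZ (hmx_pu h1)) hr)).
Qed.

Lemma berezin_continuous (T : topologicalType) (g1 g2 : T -> 'M[R]_(n + n)) x :
  (forall i j, g1 t i j @[t --> x] --> g1 x i j) ->
  (forall i j, g2 t i j @[t --> x] --> g2 x i j) ->
  (\forall t \near x, in_Sp (g1 t) /\ in_Sp (g2 t)) ->
  berezin (g1 t) (g2 t) @[t --> x] --> berezin (g1 x) (g2 x).
Proof.
move=> c1 c2 hSp; have [s1 s2] := nbhs_singleton hSp.
have ch (g : T -> 'M[R]_(n + n)) : (forall i j, g t i j @[t --> x] --> g x i j) ->
    mcont (fun t => hmx (g t)) x.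
  move=> cg; apply: mcontM; last exact: mcont_cst.
  apply: mcontM; first exact: mcont_cst.
  move=> i j; apply: (ccont_eq (f := fun t => (g t i j)%:C)) => [t|]; first by rewrite mxE.
  exact: ccont_real.
have csub (f1 f2 : 'I_n -> 'I_(n + n)) (M : T -> 'M[C]_(n + n)) :
    mcont M x -> mcont (fun t => mxsub f1 f2 (M t)) x.
  by move=> h i j; apply: (ccont_eq (f := fun t => M t (f1 i) (f2 j))) => [t|//]; rewrite mxE.
have cA (g : T -> 'M[R]_(n + n)) : (forall i j, g t i j @[t --> x] --> g x i j) ->
    [/\ mcont (fun t => blA (g t)) x, mcont (fun t => blB (g t)) x,
      mcont (fun t => blC (g t)) x & mcont (fun t => blD (g t)) x].
  move=> /ch h; split=> i j.
  - by apply: (ccont_eq _ (csub (lshift n) (lshift n) _ h i j)) => t; rewrite !mxE.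
  - by apply: (ccont_eq _ (csub (lshift n) (@rshift n n) _ h i j)) => t; rewrite !mxE.
  - by apply: (ccont_eq _ (csub (@rshift n n) (lshift n) _ h i j)) => t; rewrite !mxE.
  - by apply: (ccont_eq _ (csub (@rshift n n) (@rshift n n) _ h i j)) => t; rewrite !mxE.
have [cA1 cB1 _ _] := cA _ c1; have [cA2 _ cC2 cD2] := cA _ c2.
have cF : n%:R * frob (ctr (blD (g2 t))) @[t --> x] --> n%:R * frob (ctr (blD (g2 x))).
  apply: cvgMr; apply: cvg_big => [|i _]; first exact: add_continuous.
  apply: cvg_big => [|j _]; first exact: add_continuous.
  have e t : cabs (ctr (blD (g2 t)) i j) ^+ 2 = Re (blD (g2 t) j i) * Re (blD (g2 t) j i)
      + Im (blD (g2 t) j i) * Im (blD (g2 t) j i).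
    rewrite cabs_sqr /ctr; move: (blD _) => D; rewrite !mxE; case: (D j i) => a b /=.
    by ring.
  under eq_fun do rewrite e; rewrite e; have [d1 d2] := cD2 j i.
  by apply: cvgD; exact: cvgM.
have f0 : 0 <= n%:R * frob (ctr (blD (g2 x))) by rewrite mulr_ge0 ?frob_ge0.
(* One contraction bound must serve for all t near x. The summand 1 leaves room for the Frobenius
   norm to vary and makes [M0] at least 1. *)
pose M0 := n%:R * frob (ctr (blD (g2 x))) + 1.
have M1 : 1 <= M0 by rewrite lerDr.
have r01 : 0 <= Num.sqrt (1 - M0^-1) < 1.
  rewrite sqrtr_ge0 /= -[ltRHS]sqrtr1 ltr_sqrt // ltrBlDl ltrDr invr_gt0.
  exact: lt_le_trans M1.
have e : \forall t \near x, lnarg (invmx (blA (g1 t)) *m blB (g1 t) *m (blC (g2 t) *m invmx (blA (g2 t))))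
    = berezin (g1 t) (g2 t).
  by apply: filterS hSp => t [k1 k2]; rewrite (berezinE k1 k2).
rewrite (berezinE s1 s2); apply: cvg_trans; first exact: (near_eq_cvg e).
apply: (lnarg_continuous r01).
  have fM : \forall t \near x, n%:R * frob (ctr (blD (g2 t))) < M0.
    by apply: (cvgr_lt _ cF); rewrite ltrDl.
  apply: filterS2 fM hSp => t fM [k1 k2].
  exact: (bndM1 (pu_bndZ (hmx_pu k1)) (pu_bndW (hmx_pu k2) (ltW fM) M1)).
apply: mcontM.
  by apply: mcontM => //; apply: mcont_inv => //; exact: pu_unitA (hmx_pu s1).
by apply: mcontM => //; apply: mcont_inv => //; exact: pu_unitA (hmx_pu s2).
Qed.

End BerezinCocycle.

(** * Restriction to Sp(2n, Z) *)

Section SpZ.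
Variables (R : realType) (n : nat).
Local Notation C := R[i].
Local Notation cabs := (@Normc.normc R).
Local Notation Re := (@complex.Re R).
Local Notation Im := (@complex.Im R).
Local Notation RC := (real_complex R).
Local Notation I := ('i%C : C).
Local Notation mc := (map_mx RC).

Let cblock (A B D E : 'M[C]_n) :
  block_mx 1%:M (- I)%:M (- I)%:M 1%:M *m block_mx A B D E *m block_mx 1%:M I%:M I%:M 1%:M =
  block_mx (A + E + I *: (B - D)) (B + D + I *: (A - E))
           (B + D - I *: (A - E)) (A + E - I *: (B - D)).
Proof.
have II : I * I = -1 by rewrite -expr2 sqr_i.
rewrite !mulmx_block !mul1mx !mulmx1 !mul_scalar_mx !mul_mx_scalar !scalerDr !scalerA !mulrN !II.
rewrite opprK !scale1r.
by congr block_mx; apply/matrixP => i j; rewrite !mxE;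
  move: (A i j) (B i j) (D i j) (E i j) (I) => x y z w u; ring.
Qed.

Lemma hmx_block (a b c d : 'M[R]_n) : hmx (block_mx a b c d) =
  2^-1 *: block_mx (mc a + mc d + I *: (mc b - mc c)) (mc b + mc c + I *: (mc a - mc d))
           (mc b + mc c - I *: (mc a - mc d)) (mc a + mc d - I *: (mc b - mc c)).
Proof.
rewrite /hmx ctr_cayley /cayley_mx map_block_mx -!scalemxAl -scalemxAr scalerA sqrt2V_sqr.
by rewrite cblock.
Qed.

Section Index.
Variable e : 'I_n.

Definition pmx (K : pzRingType) : 'M[K]_n := delta_mx e e.

Lemma pmx_idem (K : pzRingType) : pmx K *m pmx K = pmx K.
Proof. by rewrite /pmx mul_delta_mx. Qed.

(** Identity plus a multiple of an idempotent, so that products of such blocks reduce to products of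
    scalars. *)
Definition onep (K : pzRingType) (a : K) : 'M[K]_n := 1%:M + (a - 1) *: pmx K.

Lemma onepM (K : comPzRingType) (a b : K) : onep a *m onep b = onep (a * b).
Proof.
rewrite /onep mulmxDl !mulmxDr !mul1mx mulmx1 -scalemxAl -scalemxAr pmx_idem scalerA -addrA -!scalerDl.
by congr (_ + _ *: _); ring.
Qed.

Lemma onep1 (K : pzRingType) : onep (1 : K) = 1%:M.
Proof. by rewrite /onep subrr scale0r addr0. Qed.

Lemma onep_p (K : comPzRingType) (a b : K) : onep a *m (b *: pmx K) = (a * b) *: pmx K.
Proof.
rewrite /onep mulmxDl mul1mx -scalemxAl -scalemxAr pmx_idem scalerA -scalerDl.
by congr (_ *: _); ring.
Qed.

Lemma p_onep (K : comPzRingType) (a b : K) : (b *: pmx K) *m onep a = (b * a) *: pmx K.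
Proof.
rewrite /onep mulmxDr mulmx1 -scalemxAl -scalemxAr pmx_idem !scalerA -scalerDl.
by congr (_ *: _); ring.
Qed.

Lemma onep_unit (K : fieldType) (a : K) : a != 0 -> onep a \in unitmx /\ invmx (onep a) = onep a^-1.
Proof.
move=> a0; have u : onep a *m onep a^-1 = 1%:M by rewrite onepM divff // onep1.
have [ua _] := mulmx1_unit u; split => //.
by rewrite -[LHS]mulmx1 -u mulKmx.
Qed.

(* The subgroup SL(2) acting on the plane of the coordinates [e] and [n + e]. *)
Definition sl2 (a b c d : R) : 'M[R]_(n + n) :=
  block_mx (onep a) (b *: pmx R) (c *: pmx R) (onep d).

Lemma sl2M a b c d a' b' c' d' : sl2 a b c d *m sl2 a' b' c' d' =
  sl2 (a * a' + b * c') (a * b' + b * d') (c * a' + d * c') (c * b' + d * d').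
Proof.
rewrite /sl2 mulmx_block !onepM !onep_p !p_onep -!scalemxAl -!scalemxAr pmx_idem !scalerA.
rewrite -!scalerDl /onep -!addrA -!scalerDl [in X in block_mx _ _ _ X]addrC -!addrA -!scalerDl.
by congr block_mx; congr (_ + _ *: _); ring.
Qed.

Lemma sl2_1 : sl2 1 0 0 1 = 1%:M.
Proof. by rewrite /sl2 !onep1 !scale0r -scalar_mx_block. Qed.

Lemma tr_sl2 a b c d : (sl2 a b c d)^T = sl2 a c b d.
Proof.
have tp : (pmx R)^T = pmx R by rewrite /pmx trmx_delta.
by rewrite /sl2 tr_block_mx /onep !linearD !linearZ /= !trmx1 !tp.
Qed.

Lemma in_Sp_sl2 a b c d : a * d - b * c = 1 -> in_Sp (sl2 a b c d).
Proof.
move=> h; rewrite /in_Sp.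
have -> : (sl2 a b c d)^T *m std_symp R n = std_symp R n *m sl2 d (- b) (- c) a.
  rewrite tr_sl2 /std_symp /sl2 !mulmx_block !mulmx0 !mul0mx !mulmx1 !mul1mx !mulmxN !mulNmx.
  by rewrite !mulmx1 !mul1mx !add0r !addr0 !scaleNr opprK.
rewrite -mulmxA sl2M (_ : d * a + _ = 1); last by rewrite -h; ring.
rewrite (_ : d * b + _ = 0); last by ring.
rewrite (_ : - c * a + _ = 0); last by ring.
rewrite (_ : - c * b + _ = 1); last by rewrite -h; ring.
by rewrite sl2_1 mulmx1.
Qed.

Lemma map_onep a : mc (onep a) = onep a%:C.
Proof. by rewrite /onep map_mxD map_mx1 map_mxZ map_delta_mx rmorphB rmorph1. Qed.

Lemma hmx_sl2 a b c d :
  [/\ blA (sl2 a b c d) = onep (((a + d) / 2) +i* ((b - c) / 2)),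
      blB (sl2 a b c d) = (((b + c) / 2) +i* ((a - d) / 2)) *: pmx C &
      blC (sl2 a b c d) = (((b + c) / 2) -i* ((a - d) / 2)) *: pmx C].
Proof.
have half : 2^-1 = (2^-1 : R)%:C by rewrite fmorphV rmorph_nat.
rewrite /blA /blB /blC /sl2 hmx_block scale_block_mx block_mxKul block_mxKur block_mxKdl.
have mcZ x : mc (x *: pmx R) = x%:C *: pmx C by rewrite map_mxZ map_delta_mx.
rewrite !map_onep !mcZ /onep.
have -> : ((a + d) / 2) +i* ((b - c) / 2) = 2^-1 * (a%:C + d%:C + I * (b%:C - c%:C)).
  by rewrite half; apply/eqP; rewrite eq_complex ?(ReM, ImM, ReD, ImD, ReN, ImN) /=; apply/andP; split; apply/eqP; field.
have -> : ((b + c) / 2) +i* ((a - d) / 2) = 2^-1 * (b%:C + c%:C + I * (a%:C - d%:C)).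
  by rewrite half; apply/eqP; rewrite eq_complex ?(ReM, ImM, ReD, ImD, ReN, ImN) /=; apply/andP; split; apply/eqP; field.
have -> : ((b + c) / 2) -i* ((a - d) / 2) = 2^-1 * (b%:C + c%:C - I * (a%:C - d%:C)).
  by rewrite half; apply/eqP; rewrite eq_complex ?(ReM, ImM, ReD, ImD, ReN, ImN) /=; apply/andP; split; apply/eqP; field.
move: (a%:C) (b%:C) (c%:C) (d%:C) (I) => x y z w u.
split; apply/matrixP => i j; rewrite !mxE;
  move: (((i == e) && (j == e))%:R : C) ((i == j)%:R : C) => p q; by field.
Qed.

(** The diagonal entry of Phi at [e]. The remaining rows and columns of Phi are those of the
    identity, so on this subgroup c is governed by the argument of this number. *)
Definition sl2_phase a b c d : C := ((a + d) / 2) +i* ((b - c) / 2).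

Lemma trace_pmx_pow (z : C) k : \tr ((z *: pmx C) ^+ k.+1) = z ^+ k.+1.
Proof.
have -> : (z *: pmx C) ^+ k.+1 = z ^+ k.+1 *: pmx C.
  elim: k => [|k IH]; first by rewrite !expr1.
  by rewrite exprS IH -mulmxE -scalemxAl -scalemxAr scalerA pmx_idem -exprS.
rewrite mxtraceZ /mxtrace (bigD1 e) //= big1 ?addr0 => [|i ie]; rewrite !mxE ?eqxx ?mulr1 //.
by rewrite (negPf ie).
Qed.

Lemma sl2_phase_neq0 a b c d : a * d - b * c = 1 -> sl2_phase a b c d != 0.
Proof.
move=> h; apply/eqP => h0.
have e1 : d = - a by move/(congr1 Re): h0 => /=; lra.
have e2 : c = b by move/(congr1 Im): h0 => /=; lra.
have := sqr_ge0 a; have := sqr_ge0 b; move: h; rewrite e1 e2; lra.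
Qed.

Let onep_bracket (x y u v : C) : x != 0 -> y != 0 ->
  invmx (onep x) *m (u *: pmx C) *m ((v *: pmx C) *m invmx (onep y)) =
  (x^-1 * u * (v * y^-1)) *: pmx C.
Proof.
move=> /onep_unit[_ ->] /onep_unit[_ ->]; rewrite onep_p p_onep.
by rewrite -scalemxAl -scalemxAr scalerA pmx_idem.
Qed.

(** The matrix in the logarithm has rank at most one, and 1 + z is the phase of the product divided
    by the two phases. So c and t12 - t1 - t2 agree modulo 2 pi. As |c| < pi/2, the bound 3/2 pi
    leaves a difference below 2 pi, hence zero. *)
Lemma berezin_sl2 a b c d a' b' c' d' (a2 := a * a' + b * c') (b2 := a * b' + b * d')
    (c2 := c * a' + d * c') (d2 := c * b' + d * d') t1 t2 t12 p1 p2 p12 :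
  a * d - b * c = 1 -> a' * d' - b' * c' = 1 ->
  sl2_phase a b c d = p1%:C * cis t1 -> sl2_phase a' b' c' d' = p2%:C * cis t2 ->
  sl2_phase a2 b2 c2 d2 = p12%:C * cis t12 ->
  0 < p1 -> 0 < p2 -> 0 < p12 -> `|t12 - t1 - t2| < 3 / 2 * pi ->
  berezin (sl2 a b c d) (sl2 a' b' c' d') = t12 - t1 - t2.
Proof.
move=> h h' f1 f2 f12 p10 p20 p120 small.
have s1 := in_Sp_sl2 h; have s2 := in_Sp_sl2 h'.
have [A1 B1 _] := hmx_sl2 a b c d; have [A2 _ C2] := hmx_sl2 a' b' c' d'.
have n1 := sl2_phase_neq0 h; have n2 := sl2_phase_neq0 h'.
have [u1 i1] := onep_unit n1; have [u2 i2] := onep_unit n2.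
pose z := (sl2_phase a b c d)^-1 * (((b + c) / 2) +i* ((a - d) / 2)) *
  ((((b' + c') / 2) -i* ((a' - d') / 2)) * (sl2_phase a' b' c' d')^-1).
have eZ : invmx (blA (sl2 a b c d)) *m blB (sl2 a b c d) *m
    (blC (sl2 a' b' c' d') *m invmx (blA (sl2 a' b' c' d'))) = z *: pmx C.
  by rewrite A1 B1 A2 C2; exact: onep_bracket.
have [r r01 hr] := pu_bndW_ex (hmx_pu s2).
have bZ := bndM1 (pu_bndZ (hmx_pu s1)) hr; rewrite eZ in bZ.
have /andP[r0 r1] := r01.
have zr : cabs z <= r.
  by have := bnd_entry e e r0 bZ; rewrite !mxE !eqxx mulr1.
rewrite (berezinE s1 s2) eZ (lnarg_rank1 r01 bZ zr); last exact: trace_pmx_pow.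
have z1 := le_lt_trans zr r1.
have ez : (1 + z) * (sl2_phase a b c d * sl2_phase a' b' c' d') = sl2_phase a2 b2 c2 d2.
  have -> : (1 + z) * (sl2_phase a b c d * sl2_phase a' b' c' d') =
      sl2_phase a b c d * sl2_phase a' b' c' d' + (((b + c) / 2) +i* ((a - d) / 2)) *
      (((b' + c') / 2) -i* ((a' - d') / 2)).
    by rewrite /z; field; rewrite n1 n2.
  apply/eqP; rewrite eq_complex /= /a2 /b2 /c2 /d2; apply/andP; split; apply/eqP; by field.
have pz : 0 < cabs (1 + z).
  rewrite lt_def cabs_ge0 andbT; apply/eqP => /cabs_eq0 /(congr1 Re).
  by rewrite ReD /= => z0; have := one_plus_re_gt0 z1; rewrite z0 ltxx.
have ec : cis (arg1p z + t1 + t2) = cis t12.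
  apply: (@cis_inj_scale _ (cabs (1 + z) * p1 * p2) p12) => //.
    by rewrite !mulr_gt0.
  rewrite -f12 -ez f1 f2 {2}(arg1pP z1) -/(cis _) !cisD !rmorphM /=.
  by move: (cis t1) (cis t2) (cis _) => x y w; ring.
apply/eqP; rewrite -subr_eq0; apply/eqP; apply: cis_eq1_small.
  have -> : arg1p z - (t12 - t1 - t2) = arg1p z + t1 + t2 + - t12 by ring.
  by rewrite cisD ec -cisD subrr cis0.
have : `|arg1p z| < pi / 2 by rewrite ltr_norml atan_gtNpi2 atan_ltpi2.
move: small; rewrite !ltr_norml; move: (arg1p z) => x /andP[? ?] /andP[? ?].
by apply/andP; split; lra.
Qed.

Lemma cis_atan (y : R) : exists2 p : R, 0 < p & 1 +i* y = p%:C * cis (atan y).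
Proof.
have cg : 0 < cos (atan y) by rewrite cos_gt0_pihalf // atan_gtNpi2 atan_ltpi2.
exists (cos (atan y))^-1; first by rewrite invr_gt0.
have t : sin (atan y) = cos (atan y) * y.
  by rewrite -{3}(atanK y) /tan mulrC divfK // gt_eqF.
apply/eqP; rewrite eq_complex ReM ImM /= t; apply/andP; split; apply/eqP; field; exact: lt0r_neq0.
Qed.

End Index.
Definition SpZ (A : 'M[R]_(n + n)) := in_Sp A /\ forall i j, A i j \is a Num.int.

Lemma SpZM A B : SpZ A -> SpZ B -> SpZ (A *m B).
Proof.
move=> [a1 a2] [b1 b2]; split; first exact: in_SpM.
by move=> i j; rewrite mxE; apply: rpred_sum => k _; exact: rpredM.
Qed.

Lemma SpZ1 : SpZ 1%:M.
Proof.
by split => [|i j]; [exact: in_Sp1|rewrite mxE; case: (i == j)].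
Qed.

Lemma block_int (a b c d : 'M[R]_n) :
  (forall i j, a i j \is a Num.int) -> (forall i j, b i j \is a Num.int) ->
  (forall i j, c i j \is a Num.int) -> (forall i j, d i j \is a Num.int) ->
  forall i j, block_mx a b c d i j \is a Num.int.
Proof.
move=> ha hb hc hd i j; rewrite -(splitK i) -(splitK j).
by case: (fintype.split i) => ?; case: (fintype.split j) => ? /=;
  rewrite ?(block_mxEul, block_mxEur, block_mxEdl, block_mxEdr).
Qed.

Lemma SpZ_sl2 e a b c d : a * d - b * c = 1 -> a \is a Num.int -> b \is a Num.int ->
  c \is a Num.int -> d \is a Num.int -> SpZ (sl2 e a b c d).
Proof.
move=> h ha hb hc hd; split; first exact: in_Sp_sl2.
have hB (x : bool) : x%:R \is a @Num.int R by rewrite rpred_nat.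
have hO x : x \is a Num.int -> forall i j, onep e x i j \is a @Num.int R.
  by move=> hx i j; rewrite !mxE rpredD // rpredM // rpredB ?rpred1.
have hP x : x \is a Num.int -> forall i j, (x *: pmx e R) i j \is a @Num.int R.
  by move=> hx i j; rewrite !mxE rpredM.
apply: block_int; [exact: hO|exact: hP|exact: hP|exact: hO].
Qed.

Section Cochain.
Variable gam : 'M[R]_(n + n) -> R.
Hypothesis gamP : forall A B, SpZ A -> SpZ B -> berezin A B = gam A + gam B - gam (A *m B).

Let gamM A B : SpZ A -> SpZ B -> gam (A *m B) = gam A + gam B - berezin A B.
Proof. by move=> hA hB; rewrite (gamP hA hB); ring. Qed.

Let K : R := n%:R * (pi / 2).

Let gam_close A B : SpZ A -> SpZ B -> `|gam (A *m B) - (gam A + gam B)| <= K.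
Proof.
move=> hA hB; rewrite (gamM hA hB) addrAC subrr sub0r normrN.
exact: berezin_le hA.1 hB.1.
Qed.

Section AtIndex.
Variable e : 'I_n.

(** The argument of 1 + i/2, which is the phase of T = [1 1; 0 1]. *)
Let th : R := atan (1 / 2).

Lemma atan_half_bounds : 0 < th < pi / 2.
Proof.
by rewrite atan_ltpi2 andbT -[X in X < _](@atan0 R) lt_atan ?divr_gt0.
Qed.

Let Tk k : 'M[R]_(n + n) := sl2 e 1 k%:R 0 1.
Let Tf : 'M[R]_(n + n) := sl2 e 1 0 (-1) 1.
Let w : 'M[R]_(n + n) := sl2 e 0 1 (-1) 0.

Let det_u (x : R) : 1 * 1 - x * 0 = 1. Proof. by rewrite mulr0 subr0 mulr1. Qed.

Lemma SpZ_Tk k : SpZ (Tk k).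
Proof. by apply: SpZ_sl2; rewrite ?det_u // ?rpred1 ?rpred0 ?rpred_nat. Qed.

Let SpZ_Tf : SpZ Tf.
Proof. by apply: SpZ_sl2; rewrite ?mul0r ?subr0 ?mulr1 // ?rpred1 ?rpred0 ?rpredN1. Qed.

Let SpZ_w : SpZ w.
Proof. by apply: SpZ_sl2; rewrite ?mul0r ?mul1r ?sub0r ?opprK // ?rpred1 ?rpred0 ?rpredN1. Qed.

Let phase_u (x : R) : exists2 p : R, 0 < p & sl2_phase 1 x 0 1 = p%:C * cis (atan (x / 2)).
Proof.
have [p p0 ep] := cis_atan (x / 2); exists p => //; rewrite -ep /sl2_phase.
by congr (_ +i* _); rewrite ?subr0 //; field.
Qed.

(** c(T^k, T) = atan((k+1)/2) - atan(k/2) - th, so the recursion for gamma telescopes. It starts at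
    gamma(1) = c(1, 1) = 0. *)
Lemma gam_Tk k : gam (Tk k) = k%:R * (gam (Tk 1) + th) - atan (k%:R / 2).
Proof.
elim: k => [|k IH].
  rewrite !mul0r atan0 subr0 /Tk sl2_1.
  have := gamM SpZ1 SpZ1; rewrite mulmx1.
  have -> : berezin (1%:M : 'M[R]_(n + n)) 1%:M = 0; last by lra.
  rewrite -(sl2_1 e) (@berezin_sl2 e _ _ _ _ _ _ _ _ 0 0 0 1 1 1) ?subr0 ?normr0 //;
    rewrite ?mul0r ?mulr0 ?mul1r ?subr0 ?addr0 ?cis0 ?mulr1 //.
  - by apply/eqP; rewrite eq_complex /=; apply/andP; split; apply/eqP; field.
  - by apply/eqP; rewrite eq_complex /=; apply/andP; split; apply/eqP; field.
  - by apply/eqP; rewrite eq_complex /=; apply/andP; split; apply/eqP; field.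
  - by rewrite mulr_gt0 ?pi_gt0 // divr_gt0.
have eT : Tk k.+1 = Tk k *m Tk 1.
  by rewrite /Tk sl2M; congr sl2; rewrite ?mulr0 ?mul0r ?mulr1 ?mul1r ?addr0 ?add0r // -natr1 addrC.
rewrite eT (gamM (SpZ_Tk k) (SpZ_Tk 1)) IH.
have [p1 p10 f1] := phase_u k%:R; have [p2 p20 f2] := phase_u 1; have [p3 p30 f3] := phase_u k.+1%:R.
have := @berezin_sl2 e 1 k%:R 0 1 1 1 0 1 _ _ (atan (k.+1%:R / 2)) p1 p2 p3 (det_u _) (det_u _) f1 f2.
have -> : 1 * 1 + k%:R * 0 = 1 :> R by ring.
have -> : 1 * 1 + k%:R * 1 = k.+1%:R :> R by rewrite -natr1; ring.
have -> : 0 * 1 + 1 * 0 = 0 :> R by ring.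
have -> : 0 * 1 + 1 * 1 = 1 :> R by ring.
move=> /(_ f3 p10 p20 p30) hb; rewrite hb /th; first by rewrite -natr1; ring.
have a0 (m : nat) : 0 <= atan (m%:R / 2 : R).
  by rewrite -[leLHS](@atan0 R); apply: le_atan; rewrite divr_ge0.
have a1 := a0 k; have a2 := atan_ltpi2 (k%:R / 2 : R).
have b1 := a0 k.+1; have b2 := atan_ltpi2 (k.+1%:R / 2 : R).
have /andP[c1 c2] := atan_half_bounds; rewrite /th in c1 c2.
by rewrite ltr_norml; apply/andP; split; lra.
Qed.

Let phase_f : exists2 p : R, 0 < p & sl2_phase 1 0 (-1) 1 = p%:C * cis th.
Proof.
have [p p0 ep] := cis_atan (1 / 2 : R); exists p => //; rewrite -ep /sl2_phase.
by congr (_ +i* _); field.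
Qed.

Let phase_fe : exists2 p : R, 0 < p & sl2_phase 1 1 (-1) 0 = p%:C * cis (pi / 2 - th).
Proof.
have [p p0 ep] := cis_atan (1 / 2 : R); exists p => //.
have e1 : p * cos th = 1.
  by move/(congr1 Re): ep; rewrite ReM /= mul0r subr0.
have e2 : p * sin th = 1 / 2.
  by move/(congr1 Im): ep; rewrite ImM /= mul0r addr0.
apply/eqP; rewrite eq_complex ReM ImM /= cosB sinB cos_pihalf sin_pihalf !mul0r !mul1r.
rewrite add0r subr0 addr0 subr0 e1 e2; apply/andP; split; apply/eqP; by field.
Qed.

Let phase_w : sl2_phase 0 1 (-1) 0 = (1 : R)%:C * cis (pi / 2).
Proof.
rewrite mul1r /cis cos_pihalf sin_pihalf /sl2_phase.
by congr (_ +i* _); field.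
Qed.

Let ber_fe : berezin Tf (Tk 1) = pi / 2 - th - th - th.
Proof.
have [p1 p10 f1] := phase_f; have [p2 p20 f2] := phase_u 1; have [p3 p30 f3] := phase_fe.
have d1 : 1 * 1 - 0 * (-1) = 1 :> R by ring.
have := @berezin_sl2 e 1 0 (-1) 1 1 1 0 1 _ _ (pi / 2 - th) p1 p2 p3 d1 (det_u _) f1 f2.
have -> : 1 * 1 + 0 * 0 = 1 :> R by ring.
have -> : 1 * 1 + 0 * 1 = 1 :> R by ring.
have -> : -1 * 1 + 1 * 0 = -1 :> R by ring.
have -> : -1 * 1 + 1 * 1 = 0 :> R by ring.
move=> /(_ f3 p10 p20 p30) ->; first by rewrite /th; ring.
rewrite -/th; have := pi_gt0 R; have /andP[] := atan_half_bounds.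
by move: th => t ? ? ?; rewrite ltr_norml; apply/andP; split; lra.
Qed.

Let ber_efe : berezin (Tk 1) (sl2 e 1 1 (-1) 0) = 0.
Proof.
have [p1 p10 f1] := phase_u 1; have [p2 p20 f2] := phase_fe.
have d1 : 1 * 0 - 1 * (-1) = 1 :> R by ring.
have := @berezin_sl2 e 1 1 0 1 1 1 (-1) 0 _ _ (pi / 2) p1 p2 1 (det_u _) d1 f1 f2.
have -> : 1 * 1 + 1 * (-1) = 0 :> R by ring.
have -> : 1 * 1 + 1 * 0 = 1 :> R by ring.
have -> : 0 * 1 + 1 * -1 = -1 :> R by ring.
have -> : 0 * 1 + 1 * 0 = 0 :> R by ring.
move=> /(_ phase_w p10 p20 ltr01) ->; first by rewrite /th; ring.
rewrite -/th (_ : _ - _ = 0); last by rewrite /th; ring.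
by rewrite normr0 mulr_gt0 ?pi_gt0 // divr_gt0.
Qed.

(* [w] is unitary, so its blocks off the diagonal vanish. *)
Let ber_wl g : in_Sp g -> berezin w g = 0.
Proof.
move=> hg; rewrite (berezinE SpZ_w.1 hg); have [_ -> _] := hmx_sl2 e 0 1 (-1) 0.
rewrite (_ : _ +i* _ = 0) ?scale0r ?mulmx0 ?mul0mx ?lnarg0 //.
by apply/eqP; rewrite eq_complex /=; apply/andP; split; apply/eqP; field.
Qed.

Let ber_wr g : in_Sp g -> berezin g w = 0.
Proof.
move=> hg; rewrite (berezinE hg SpZ_w.1); have [_ _ ->] := hmx_sl2 e 0 1 (-1) 0.
rewrite (_ : _ -i* _ = 0) ?scale0r ?mul0mx ?mulmx0 ?lnarg0 //.
by apply/eqP; rewrite eq_complex /=; apply/andP; split; apply/eqP; field.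
Qed.

(** c vanishes as soon as one argument is [w], so gamma is additive on the powers of [w]; and w^4 =
    1. *)
Lemma gam_w : gam w = 0.
Proof.
have g1 : gam (w *m w) = 2 * gam w by rewrite (gamM SpZ_w SpZ_w) (ber_wl SpZ_w.1); ring.
have s2 := SpZM SpZ_w SpZ_w.
have g2 : gam (w *m (w *m w)) = 3 * gam w by rewrite (gamM SpZ_w s2) (ber_wl s2.1) g1; ring.
have s3 := SpZM SpZ_w s2.
have g3 : gam (w *m (w *m (w *m w))) = 4 * gam w.
  by rewrite (gamM SpZ_w s3) (ber_wl s3.1) g2; ring.
have e4 : w *m (w *m (w *m w)) = Tk 0.
  by rewrite /w /Tk !sl2M; congr sl2; ring.
move: g3; rewrite e4 gam_Tk !mul0r atan0; lra.
Qed.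

(** From w T = F w, where c vanishes on both sides, gamma(F) = gamma(T). Then T F T = w and gamma(w)
    = 0 give 3 gamma(T) = c(F, T) + c(T, F T) = pi/2 - 3 th. *)
Lemma gam_T1 : gam (Tk 1) + th = pi / 6.
Proof.
have eF : Tf *m Tk 1 = sl2 e 1 1 (-1) 0 by rewrite /Tf /Tk sl2M; congr sl2; ring.
have eW : Tk 1 *m sl2 e 1 1 (-1) 0 = w by rewrite /Tk sl2M; congr sl2; ring.
have eC : w *m Tk 1 = Tf *m w by rewrite /w /Tf /Tk !sl2M; congr sl2; ring.
have sF : SpZ (sl2 e 1 1 (-1) 0) by rewrite -eF; exact: SpZM SpZ_Tf (SpZ_Tk 1).
have k1 := gamM SpZ_Tf (SpZ_Tk 1); rewrite eF ber_fe in k1.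
have k2 := gamM (SpZ_Tk 1) sF; rewrite eW ber_efe gam_w in k2.
have k3 := gamM SpZ_w (SpZ_Tk 1); rewrite (ber_wl (SpZ_Tk 1).1) eC in k3.
have k4 := gamM SpZ_Tf SpZ_w; rewrite (ber_wr SpZ_Tf.1) in k4.
move: k1 k2 k3 k4; move: (gam _) (gam _) (gam _) (gam _) (gam _) => x y z u v.
lra.
Qed.

Lemma gam_TkE k : gam (Tk k) = k%:R * (pi / 6) - atan (k%:R / 2).
Proof. by rewrite gam_Tk gam_T1. Qed.

End AtIndex.

(** * Unipotents attached to quadratic forms, and the contradiction *)

Definition umx (M : 'M[R]_n) : 'M[R]_(n + n) := block_mx 1%:M M 0 1%:M.

Lemma umxM M N : umx M *m umx N = umx (M + N).
Proof.
by rewrite /umx mulmx_block !mulmx1 !mul1mx !mulmx0 !mul0mx !addr0 add0r [N + M]addrC.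
Qed.

Lemma SpZ_umx M : M^T = M -> (forall i j, M i j \is a Num.int) -> SpZ (umx M).
Proof.
move=> tM iM; split; last first.
  by apply: block_int => // i j; rewrite !mxE ?rpred0 //; case: (_ == _); rewrite ?rpred1 ?rpred0.
rewrite /in_Sp /umx /std_symp tr_block_mx !trmx1 trmx0 tM !mulmx_block.
rewrite !(mulmx1, mul1mx, mulmx0, mul0mx, mulmxN, mulNmx, addr0, add0r, oppr0).
by rewrite ?subrr ?addNr.
Qed.

(** When A' is the inverse transpose of A, the block diagonal element whose conjugation changes M
    into A M A^T. *)
Definition lmx (A A' : 'M[R]_n) : 'M[R]_(n + n) := block_mx A 0 0 A'.

Lemma SpZ_lmx A A' : A^T *m A' = 1%:M -> (forall i j, A i j \is a Num.int) ->
  (forall i j, A' i j \is a Num.int) -> SpZ (lmx A A').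
Proof.
move=> h iA iA'; split; last by apply: block_int => // i j; rewrite mxE rpred0.
have h' : A'^T *m A = 1%:M.
  by have /(congr1 trmx) := h; rewrite trmx_mul trmxK trmx1.
rewrite /in_Sp /lmx /std_symp tr_block_mx !trmx0 !mulmx_block.
rewrite !(mulmx1, mul1mx, mulmx0, mul0mx, mulmxN, mulNmx, addr0, add0r, oppr0).
by rewrite h h'.
Qed.

Lemma lmx_umx A A' M : A^T *m A' = 1%:M ->
  lmx A A' *m umx M = umx (A *m M *m A^T) *m lmx A A'.
Proof.
move=> h; rewrite /lmx /umx !mulmx_block !mulmx0 !mul0mx !mulmx1 !mul1mx !addr0 !add0r.
by rewrite -(mulmxA (A *m M)) h mulmx1.
Qed.

(** Both sides of L U = U' L have gamma within [K] of the sum over their two factors, and gamma(L)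
    cancels. *)
Lemma gam_conj A A' M : A^T *m A' = 1%:M -> (forall i j, A i j \is a Num.int) ->
  (forall i j, A' i j \is a Num.int) -> M^T = M -> (forall i j, M i j \is a Num.int) ->
  `|gam (umx (A *m M *m A^T)) - gam (umx M)| <= K + K.
Proof.
move=> h iA iA' tM iM; have sL := SpZ_lmx h iA iA'; have sM := SpZ_umx tM iM.
have sN : SpZ (umx (A *m M *m A^T)).
  apply: SpZ_umx; first by rewrite !trmx_mul trmxK tM mulmxA.
  move=> i j; rewrite mxE; apply: rpred_sum => k _; apply: rpredM; last by rewrite mxE.
  by rewrite mxE; apply: rpred_sum => l _; apply: rpredM.
have := gam_close sL sM; have := gam_close sN sL; rewrite (lmx_umx _ h).
move: (gam _) (gam _) (gam _) (gam _) => x y z u; rewrite !ler_norml => /andP[? ?] /andP[? ?].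
by apply/andP; split; lra.
Qed.

Lemma umx_Tk e k : umx (k%:R *: pmx e R) = sl2 e 1 k%:R 0 1.
Proof. by rewrite /umx /sl2 onep1 scale0r. Qed.

(** With p = pi and L = m p/2, the four estimates give |k p/3 - 2 (a - b)| <= 6 L = 3 m p. Since a -
    b < p, this forces k < 9 m + 6, which k = 9 m + 7 violates. *)
Let gam_arith (k m p L S x y a b : R) : L = m * (p / 2) -> k = 9 * m + 7 -> 0 < p ->
  `|S - (x + y)| <= L ->
  `|S - ((k + k) * (p / 6) - a + ((k + k) * (p / 6) - a))| <= L ->
  `|x - (k * (p / 6) - b)| <= L + L -> `|y - (k * (p / 6) - b)| <= L + L ->
  a < p / 2 -> - (p / 2) < b -> False.
Proof.
move=> -> -> hp; rewrite !ler_norml.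
have -> : (9 * m + 7 + (9 * m + 7)) * (p / 6) = 3 * (m * p) + 7 / 3 * p by field.
have -> : (9 * m + 7) * (p / 6) = 3 / 2 * (m * p) + 7 / 6 * p by field.
have -> : m * (p / 2) = (m * p) / 2 by ring.
move: (m * p) => q => /andP[? ?] /andP[? ?] /andP[? ?] /andP[? ?] ? ?.
lra.
Qed.

Lemma gam_contradiction (e f : 'I_n) : e != f -> False.
Proof.
move=> ef; pose k := (9 * n + 7)%N.
pose d (x y : 'I_n) : 'M[R]_n := delta_mx x y.
(* [A] and [B] send the e-th basis column to the sum and to the difference of the e-th and f-th
   ones; [A'] and [B'] are their inverse transposes. *)
pose A : 'M[R]_n := 1%:M + d f e; pose A' : 'M[R]_n := 1%:M - d e f.
pose B : 'M[R]_n := 1%:M - d f e; pose B' : 'M[R]_n := 1%:M + d e f.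
have dd x y z : d x y *m d y z = d x z by rewrite /d mul_delta_mx.
have d0 x y z t : y != z -> d x y *m d z t = 0 by move=> h; rewrite /d mul_delta_mx_0.
have fe : f != e by rewrite eq_sym.
have td x y : (d x y)^T = d y x by rewrite /d trmx_delta.
have tA : A^T = 1%:M + d e f by rewrite /A [LHS]linearD /= trmx1 td.
have tB : B^T = 1%:M - d e f by rewrite /B [LHS]linearB /= trmx1 td.
have hA : A^T *m A' = 1%:M.
  rewrite tA /A' mulmxDl !mulmxBr !mulmx1 mul1mx (d0 _ _ _ _ fe) subr0.
  by rewrite subrK.
have hB : B^T *m B' = 1%:M.
  rewrite tB /B' mulmxBl !mulmxDr !mulmx1 mul1mx (d0 _ _ _ _ fe) addr0.
  by rewrite addrK.
have bi (x : bool) : x%:R \is a @Num.int R by rewrite rpred_nat.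
have iA i j : A i j \is a Num.int by rewrite !mxE rpredD.
have iA' i j : A' i j \is a Num.int by rewrite !mxE rpredB.
have iB i j : B i j \is a Num.int by rewrite !mxE rpredB.
have iB' i j : B' i j \is a Num.int by rewrite !mxE rpredD.
pose M : 'M[R]_n := k%:R *: pmx e R.
have tM : M^T = M by rewrite /M linearZ /= /pmx trmx_delta.
have iM i j : M i j \is a Num.int by rewrite !mxE rpredM ?rpred_nat.
(* The polarisation identity k (x_e + x_f)^2 + k (x_e - x_f)^2 = 2k x_e^2 + 2k x_f^2. *)
have sumE : A *m M *m A^T + B *m M *m B^T = (k + k)%:R *: pmx e R + (k + k)%:R *: pmx f R.
  rewrite /M -!scalemxAr -!scalemxAl -!scalerDr (_ : (k + k)%:R = k%:R * 2); last by rewrite natrD; ring.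
  rewrite -scalerA; congr (_ *: _).
  rewrite tA tB /A /B -/(d e e) -/(d f f).
  rewrite !(mulmxDl, mulmxDr, mulNmx, mulmxN, mul1mx, mulmx1, dd).
  by apply/matrixP => i j; rewrite !mxE; ring.
have sP x (m : nat) : SpZ (umx (m%:R *: pmx x R)).
  by rewrite umx_Tk; exact: SpZ_Tk.
have sN (X : 'M[R]_n) : (forall i j, X i j \is a Num.int) -> SpZ (umx (X *m M *m X^T)).
  move=> iX; apply: SpZ_umx; first by rewrite !trmx_mul trmxK tM mulmxA.
  move=> i j; rewrite mxE; apply: rpred_sum => l _; apply: rpredM; last by rewrite mxE.
  by rewrite mxE; apply: rpred_sum => l' _; apply: rpredM.
have c1 := gam_close (sN _ iA) (sN _ iB).
have c2 := gam_close (sP e (k + k)%N) (sP f (k + k)%N).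
rewrite umxM sumE -umxM in c1.
have c3 := gam_conj hA iA iA' tM iM.
have c4 := gam_conj hB iB iB' tM iM.
have gM : gam (umx M) = k%:R * (pi / 6) - atan (k%:R / 2) by rewrite /M umx_Tk gam_TkE.
have gP x : gam (umx ((k + k)%:R *: pmx x R)) = (k + k)%:R * (pi / 6) - atan ((k + k)%:R / 2).
  by rewrite umx_Tk gam_TkE.
rewrite !gP in c2; rewrite gM in c3 c4.
have := atan_ltpi2 ((k + k)%:R / 2 : R); have := atan_gtNpi2 (k%:R / 2 : R).
move=> hb ha.
have hk : k%:R = 9 * n%:R + 7 :> R by rewrite /k natrD natrM.
clearbody k; rewrite natrD in c1 c2 ha.
exact: gam_arith (erefl K) hk (pi_gt0 R) c1 c2 c3 c4 ha hb.
Qed.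

End Cochain.
End SpZ.

(** * Lebesgue measure on row vectors *)

Section Dyadic.
Variables (R : realType) (m : nat).
Local Notation V := 'rV[R]_m.

Definition dyadic_index (j : nat) (x : V) : 'rV[int]_m := \row_i Num.floor (2 ^+ j * x 0 i).

Definition dyadic (j : nat) (k : 'rV[int]_m) : set V := [set x | dyadic_index j x = k].

(** The floor of 2s is twice the floor of s, or one more, so it determines the floor of s. *)
Lemma dyadic_index_nested i j (x y : V) : (i <= j)%N ->
  dyadic_index j x = dyadic_index j y -> dyadic_index i x = dyadic_index i y.
Proof.
move=> ij; rewrite -(subnKC ij); move: (j - i)%N => l {ij j}.
elim: l => [|l IH]; first by rewrite addn0.
rewrite addnS => h; apply: IH; apply/rowP => c; rewrite !mxE.
have /rowP/(_ c) := h; rewrite !mxE !exprS -!mulrA.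
move: (2 ^+ _ * x 0 c) (2 ^+ _ * y 0 c) => s t e.
apply/esym/floor_def; have /andP[s1 s2] := floor_itv s.
move: s1 s2; move: (Num.floor s) => a s1 s2.
have [p1 p2] : (2 * a)%:~R <= 2 * s /\ 2 * s < (2 * a + 2)%:~R.
  by rewrite intrD intrM; rewrite intrD in s2; split; lra.
have q1 : 2 * a <= Num.floor (2 * s) by rewrite floor_ge_int.
have q2 : Num.floor (2 * s) < 2 * a + 2 by rewrite floor_lt_int.
have /andP[t1 t2] := floor_itv (2 * t); rewrite -e in t1 t2.
have r1 : (2 * a)%:~R <= 2 * t by apply: le_trans t1; rewrite ler_int.
have r2 : 2 * t < (2 * a + 2)%:~R.
  by apply: (lt_le_trans t2); rewrite ler_int lezD1.
by rewrite intrM in r1; rewrite intrD intrM in r2; rewrite intrD; apply/andP; split; lra.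
Qed.

(** Each point takes the largest of its cubes that lies in [O] and is good. By nestedness two such
    cubes coincide or are disjoint. The predicate [good] carries whatever else has to be known about
    the chosen cubes. *)
Lemma dyadic_decomposition (good : nat -> 'rV[int]_m -> Prop) (O : set V) :
  (forall x, O x -> exists j, dyadic j (dyadic_index j x) `<=` O /\ good j (dyadic_index j x)) ->
  exists S : nat -> set V, [/\ trivIset setT S, \bigcup_n S n = O &
    forall n, S n = set0 \/ exists j k, [/\ S n = dyadic j k, good j k & S n `<=` O]].
Proof.
move=> hO.
pose P j k := dyadic j k `<=` O /\ good j k.
pose first j x := P j (dyadic_index j x) /\ forall i, (i < j)%N -> ~ P i (dyadic_index i x).
(* Pairs of a scale and an index are numbered by [pickle]; a number that codes no pair, or a cube
   that is nowhere the first choice, gives the empty set. *)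
pose S n : set V := match (pickle_inv n : option (nat * 'rV[int]_m)) with
  | Some jk => [set x | dyadic_index jk.1 x = jk.2 /\ first jk.1 x]
  | None => set0 end.
have SP n x : S n x -> exists jk : nat * 'rV[int]_m,
    [/\ pickle jk = n, dyadic_index jk.1 x = jk.2 & first jk.1 x].
  rewrite /S; have := @pickle_invK (nat * 'rV[int]_m)%type n.
  by case: (pickle_inv n) => //= jk e [h1 h2]; exists jk.
exists S; split.
- apply/trivIsetP => n n' _ _ nn'; apply: contrapT => /eqP/set0P[x [/SP[jk [e1 e2 [f1 f2]]] /SP[jk' [e1' e2' [f1' f2']]]]].
  move/eqP: nn'; apply; rewrite -e1 -e1'; congr pickle.
  have ej : jk.1 = jk'.1.
    have [lt|lt|//] := ltngtP jk.1 jk'.1.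
      by have := f2' _ lt f1.
    by have := f2 _ lt f1'.
  by move: e2 e2'; rewrite ej => -> e2; case: (jk) (jk') ej e2 => a b [c d] /= -> ->.
- apply/seteqP; split=> [x [n _ /SP[jk [_ _ [[h _] _]]]]|x Ox]; first exact: h.
  have ex : exists j, `[< P j (dyadic_index j x) >].
    by have [j hj] := hO x Ox; exists j; apply/asboolP.
  pose j := ex_minn ex.
  exists (pickle (j, dyadic_index j x)) => //; rewrite /S pickleK_inv /=; split => //.
  rewrite /first /j; case: ex_minnP => k /asboolP hk hmin; split => // i ik hi.
  by have := hmin i; rewrite leqNgt ik => /(_ (asboolT hi)).
- move=> n; have [|/set0P[x Sx]] := eqVneq (S n) set0; first by left.
  right; have [[j k] [e1 /= e2 [f1 f2]]] := SP n x Sx; exists j, k.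
  have eS : S n = dyadic j k.
    apply/seteqP; split => [y /SP[jk [e1' e2' _]]|y hy].
      have : jk = (j, k) by apply: (pcan_inj (@pickleK _)); rewrite e1 e1'.
      by move=> ej; rewrite ej in e2'.
    rewrite -e1 /S pickleK_inv /=; split => //.
    have ee : dyadic_index j y = dyadic_index j x by rewrite e2.
    split; first by rewrite ee.
    by move=> i ij; rewrite (dyadic_index_nested (ltnW ij) ee); exact: f2.
  by rewrite eS -e2; split => //; case: f1.
Qed.

Lemma dyadic_coord j k (x y : V) i : dyadic j k x -> dyadic j k y ->
  `|x 0 i - y 0 i| < 2^-1 ^+ j.
Proof.
move=> hx hy; have : dyadic_index j x = dyadic_index j y by rewrite hx hy.
move=> /rowP/(_ i); rewrite !mxE => e.
have p : 0 < 2 ^+ j :> R by rewrite exprn_gt0.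
have /andP[a1 a2] := floor_itv (2 ^+ j * x 0 i); have /andP[b1 b2] := floor_itv (2 ^+ j * y 0 i).
rewrite e in a1 a2; rewrite intrD in a2 b2.
rewrite exprVn -(ltr_pM2l p) divff ?gt_eqF // -[X in X * _]gtr0_norm // -normrM mulrBr.
by rewrite ltr_norml; apply/andP; split; lra.
Qed.

Lemma half_pow_lt (e : R) : 0 < e -> exists j, forall i, (j <= i)%N -> 2^-1 ^+ i < e.
Proof.
move=> e0; have c : (fun i => 2^-1 ^+ i : R) @ \oo --> (0 : R).
  by apply: cvg_expr; rewrite ger0_norm // invf_lt1 // ltr1n.
have /cvgrPdist_lt /(_ _ e0)[j _ hj] := c.
exists j => i ij; have := hj i ij.
by rewrite sub0r normrN ger0_norm // exprn_ge0.
Qed.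

Lemma open_dyadic (O : set V) x : open O -> O x ->
  exists j, forall i, (j <= i)%N -> dyadic i (dyadic_index i x) `<=` O.
Proof.
move=> oO Ox; have /nbhs_ballP[e /= e0 he] : nbhs x O by exact: open_nbhs_nbhs.
have [j hj] := half_pow_lt e0; exists j => i ij y hy; apply: he; split => // a b.
rewrite -ball_normE /= !ord1.
by apply: (lt_trans _ (hj i ij)); apply: (dyadic_coord (k := dyadic_index i x)).
Qed.

End Dyadic.

Lemma open_of_nbhs (T : topologicalType) (X : set T) : (forall x, X x -> nbhs x X) -> open X.
Proof. by rewrite openE. Qed.

(** * Borel sets of row vectors and the image of Lebesgue measure *)

Section Borel.
Variables (R : realType) (m : nat).
Local Notation V := 'rV[R]_m.
Local Notation RM := (measurableTypeR R).

(** The measure of the statement lives on tuples with the product sigma-algebra, while charts and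
    derivatives live on normed row vectors. The latter get the Borel sets of their topology and, as
    [leb], the image measure. *)
Definition borel_rv := g_sigma_algebraType (@open V).
HB.instance Definition _ := Measurable.on borel_rv.
Local Notation B := borel_rv.

Lemma open_borel (U : set V) : open U -> measurable (U : set B).
Proof. by move=> oU; exact: sub_sigma_algebra. Qed.

Lemma continuous_on_borel_measurable (U : set V) (f : V -> R) : open U ->
  (forall x, U x -> f t @[t --> x] --> f x) -> measurable_fun (U : set B) (f : B -> RM).
Proof.
move=> oU cf; apply: (measurability _ (RGenOInfty.measurableE R)).
move=> _ [_ [a ->] <-]; apply: open_borel; apply: open_of_nbhs => x [Ux].
rewrite /preimage /= in_itv /= andbT => ax; apply: filterI; first exact: open_nbhs_nbhs.
have H : \forall t \near x, a < f t by exact: cvgr_gt (cf x Ux) _ ax.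
apply: filterS H => t /=.
by rewrite in_itv /= andbT.
Qed.

Lemma coord_borel (i : 'I_m) : measurable_fun setT ((fun x => x 0 i) : B -> RM).
Proof.
by apply: (@continuous_on_borel_measurable setT) => [|x _]; [exact: openT|exact: coord_continuous].
Qed.

Lemma floor_measurable (c : R) (k : int) : measurable ([set t | Num.floor (c * t) = k] : set RM).
Proof.
have -> : [set t | Num.floor (c * t) = k] = ( *%R c) @^-1` `[k%:~R, (k + 1)%:~R[%classic.
  apply/seteqP; split => t /=; rewrite in_itv /=.
    by move=> <-; exact: floor_itv.
  exact: floor_def.
rewrite -[X in measurable X]setTI.
have : measurable_fun setT ( *%R c : RM -> RM) by exact: mulrl_measurable.
by apply => //; exact: measurable_itv.
Qed.

Lemma dyadic_eq j k : dyadic j k = \bigcap_(i in [set: 'I_m]) [set x : V | Num.floor (2 ^+ j * x 0 i) = k 0 i].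
Proof.
apply/seteqP; split=> [x hx i _|x h] /=; first by rewrite -hx mxE.
by apply/rowP => i; rewrite mxE; exact: h.
Qed.

Lemma dyadic_borel j k : measurable (dyadic j k : set B).
Proof.
rewrite dyadic_eq; apply: fin_bigcap_measurable; first exact: finite_finset.
move=> i _; rewrite -[X in measurable X]setTI.
exact: (coord_borel i measurableT (floor_measurable _ _)).
Qed.

(** An open set is a countable union of dyadic cubes, and a cube is given by finitely many
    conditions on single coordinates. *)
Lemma row_of_tuple_measurable : measurable_fun setT (@row_of_tuple R m : m.-tuple RM -> B).
Proof.
apply: (@measurability _ _ _ B setT _ (@open V) erefl) => _ [U oU <-].
have [S [_ <- hS]] := @dyadic_decomposition R m (fun _ _ => True) U
  (fun x Ux => let: ex_intro j h := open_dyadic oU Ux in ex_intro _ j (conj (h j (leqnn j)) Logic.I)).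
rewrite setTI preimage_bigcup; apply: bigcup_measurable => n _.
have [->|[j [k [-> _ _]]]] := hS n; first by rewrite preimage_set0.
rewrite dyadic_eq preimage_bigcap; apply: fin_bigcap_measurable; first exact: finite_finset.
move=> i _.
have -> : @row_of_tuple R m @^-1` [set x | Num.floor (2 ^+ j * x 0 i) = k 0 i] =
    (fun t : m.-tuple RM => tnth t i) @^-1` [set t | Num.floor (2 ^+ j * t) = k 0 i].
  by apply/seteqP; split => t /=; rewrite mxE.
rewrite -[X in measurable X]setTI.
exact: (measurable_tnth i measurableT (floor_measurable _ _)).
Qed.

Definition leb (A : set B) : \bar R := lebesgue_tuple m (@row_of_tuple R m @^-1` A).

Let leb0 : leb set0 = 0%E.
Proof. by rewrite /leb preimage_set0 measure0. Qed.

Let leb_ge0 A : (0 <= leb A)%E.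
Proof. exact: measure_ge0. Qed.

Let leb_sigma_additive : semi_sigma_additive leb.
Proof.
move=> F mF tF mUF; rewrite /leb preimage_bigcup.
apply: measure_semi_sigma_additive.
- by move=> n; rewrite -[X in measurable X]setTI; exact: row_of_tuple_measurable.
- apply/trivIsetP => /= i j _ _ ij; rewrite -preimage_setI.
  by move/trivIsetP : tF => /(_ _ _ _ _ ij) ->//; rewrite preimage_set0.
- by rewrite -preimage_bigcup -[X in measurable X]setTI; exact: row_of_tuple_measurable.
Qed.

HB.instance Definition _ := isMeasure.Build _ _ _ leb leb0 leb_ge0 leb_sigma_additive.

End Borel.

Section Boxes.
Variable R : realType.
Local Notation RM := (measurableTypeR R).

Definition box m (A : 'I_m -> set RM) : set 'rV[R]_m := [set x | forall i, A i (x 0 i)].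

Lemma lebesgue_tuple_box m (A : 'I_m -> set RM) (a : 'I_m -> R) :
  (forall i, measurable (A i)) -> (forall i, lebesgue_measure (A i) = (a i)%:E) ->
  lebesgue_tuple m [set t | forall i, A i (tnth t i)] = (\prod_i a i)%:E.
Proof.
elim: m A a => [|m IH] A a mA eA.
  rewrite big_ord0 /= diracE mem_set //=.
  by case.
rewrite /= /lebesgue_cons /pushforward.
have -> : @tuple_cons R m @^-1` [set t | forall i, A i (tnth t i)] =
    A ord0 `*` [set t | forall i : 'I_m, A (lift ord0 i) (tnth t i)].
  apply/seteqP; split=> [[x t] h|[x t] [/= h1 h2]] /=.
    split; first by have := h ord0.
    by move=> i; have := h (lift ord0 i); rewrite /= !(tnth_nth 0).
  move=> i; case: (unliftP ord0 i) => [k ->|-> //].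
  by have := h2 k; rewrite !(tnth_nth 0).
rewrite product_measure1E //; last first.
  rewrite (_ : [set t | _] = \bigcap_(i in [set: 'I_m])
     ((fun t : m.-tuple RM => tnth t i) @^-1` A (lift ord0 i))); last first.
    by apply/seteqP; split=> [t h i _|t h i]; exact: h.
  apply: fin_bigcap_measurable; first exact: finite_finset.
  by move=> i _; rewrite -[X in measurable X]setTI; exact: measurable_tnth.
have -> := IH (fun i => A (lift ord0 i)) (fun i => a (lift ord0 i)) (fun i => mA _) (fun i => eA _).
rewrite big_ord_recl EFinM; congr (_ * _)%E.
exact: eA.
Qed.

Lemma leb_box m (A : 'I_m -> set RM) (a : 'I_m -> R) :
  (forall i, measurable (A i)) -> (forall i, lebesgue_measure (A i) = (a i)%:E) ->
  leb (box A) = (\prod_i a i)%:E.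
Proof.
move=> mA eA; rewrite -(lebesgue_tuple_box mA eA) /leb; congr (lebesgue_tuple m _).
by apply/seteqP; split => t h i; have := h i; rewrite mxE.
Qed.

End Boxes.

(** * From volumes of cubes to volumes of open sets *)

Section CubeComparison.
Variables (R : realType) (m : nat).
Local Notation V := 'rV[R]_m.
Local Notation B := (borel_rv R m).
Local Notation RM := (measurableTypeR R).
Local Notation mu := (@leb R m).

Lemma continuous_borel (f : V -> V) : continuous f -> measurable_fun setT (f : B -> B).
Proof.
move=> cf; apply: (@measurability _ _ _ B setT _ (@open V) erefl) => _ [U oU <-].
by rewrite setTI; apply: open_borel; move/continuousP : cf; exact.
Qed.

Lemma continuous_borel_preimage (f : V -> V) (A : set V) : continuous f ->
  measurable (A : set B) -> measurable (f @^-1` A : set B).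
Proof. by move=> cf mA; rewrite -[X in measurable X]setTI; exact: continuous_borel. Qed.

(** The cubes are disjoint, so the local bounds add up. The relation [c] is left abstract: it is an
    equality with a preimage in one use and a containment of transported points in another. *)
Lemma cover_cubes (O : set V) (K : R) (c : set V -> set V -> Prop) : 0 <= K ->
  (forall x, O x -> exists j W, [/\ dyadic j (dyadic_index j x) `<=` O, measurable (W : set B),
     c (dyadic j (dyadic_index j x)) W &
     (mu W <= K%:E * mu (dyadic j (dyadic_index j x)))%E]) ->
  exists S W : nat -> set V, [/\ \bigcup_n S n = O, forall n, measurable (W n : set B),
    forall n, S n = set0 \/ c (S n) (W n) & (\sum_(n <oo) mu (W n) <= K%:E * mu O)%E].
Proof.
move=> K0 h.
pose P (Q W : set V) := [/\ measurable (W : set B), c Q W & (mu W <= K%:E * mu Q)%E].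
have [S [tS US hS]] := @dyadic_decomposition R m (fun j k => exists W, P (dyadic j k) W) O
  (fun x Ox => let: ex_intro j (ex_intro W (And4 a b c d)) := h x Ox in
     ex_intro _ j (conj a (ex_intro _ W (And3 b c d)))).
have mS n : measurable (S n : set B).
  by have [->|[j [k [-> _ _]]]] := hS n; [exact: measurable0|exact: dyadic_borel].
have hW n : exists W, S n = set0 /\ W = set0 \/ P (S n) W.
  have [e|[j [k [-> [W hW] _]]]] := hS n; first by exists set0; left.
  by exists W; right.
have [W {}hW] := choice hW.
exists S, W; split => //.
- by move=> n; have [[_ ->]|[]] := hW n; first exact: measurable0.
- by move=> n; have [[-> _]|[]] := hW n; [left|right].
- rewrite -US measure_semi_bigcup //; last exact: bigcup_measurable.
  rewrite -nneseriesZl //; apply: lee_nneseries => // n _.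
  by have [[-> ->]|[]] := hW n; rewrite ?measure0 ?mule0.
Qed.

Lemma preimage_cubes_le (f : V -> V) (K : R) (O : set V) : 0 <= K -> continuous f ->
  (forall j k, (mu (f @^-1` dyadic j k) <= K%:E * mu (dyadic j k))%E) ->
  open O -> (mu (f @^-1` O) <= K%:E * mu O)%E.
Proof.
move=> K0 cf h oO.
have [|S [W [US mW hW hs]]] := @cover_cubes O K (fun Q W => W = f @^-1` Q) K0.
  move=> x Ox; have [j hj] := open_dyadic oO Ox.
  exists j, (f @^-1` dyadic j (dyadic_index j x)); split => //; first exact: hj.
  by apply: continuous_borel_preimage => //; exact: dyadic_borel.
apply: (le_trans _ hs); apply: measure_sigma_subadditive => //.
  by apply: continuous_borel_preimage => //; exact: open_borel.
move=> x; rewrite /preimage /= -US => -[n _ Sx]; exists n => //.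
by have [e|->//] := hW n; rewrite e in Sx.
Qed.

(** Preimages of disjoint cubes are disjoint, so both sides are sums over cubes that can be compared
    term by term. *)
Lemma preimage_cubes_ge (f : V -> V) (K : R) (O : set V) : 0 <= K -> continuous f ->
  (forall j k, (mu (dyadic j k) <= K%:E * mu (f @^-1` dyadic j k))%E) ->
  open O -> (mu O <= K%:E * mu (f @^-1` O))%E.
Proof.
move=> K0 cf h oO.
have [S [tS US hS]] := @dyadic_decomposition R m (fun _ _ => True) O
  (fun x Ux => let: ex_intro j h := open_dyadic oO Ux in ex_intro _ j (conj (h j (leqnn j)) Logic.I)).
have mS n : measurable (S n : set B).
  by have [->|[j [k [-> _ _]]]] := hS n; [exact: measurable0|exact: dyadic_borel].
rewrite -US preimage_bigcup !measure_semi_bigcup //; first last.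
- exact: bigcup_measurable.
- by apply: bigcup_measurable => n _; exact: continuous_borel_preimage.
- apply/trivIsetP => /= i j _ _ ij; rewrite -preimage_setI.
  by move/trivIsetP : tS => /(_ _ _ Logic.I Logic.I ij) ->; rewrite preimage_set0.
- by move=> n; exact: continuous_borel_preimage.
rewrite -nneseriesZl //; apply: lee_nneseries => // n _.
have [->|[j [k [-> _ _]]]] := hS n; last exact: h.
by rewrite measure0 mule_ge0.
Qed.

Lemma affine_floor_measure (a b : R) (k : int) : a != 0 ->
  lebesgue_measure ([set t | Num.floor (a * t + b) = k] : set RM) = (`|a|^-1)%:E.
Proof.
move=> a0.
have e1 : [set t | Num.floor (a * t + b) = k] = [set t | k%:~R <= a * t + b < (k + 1)%:~R].
  by apply/seteqP; split => t /=; [move=> <-; exact: floor_itv|exact: floor_def].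
have [ap|an] : 0 < a \/ a < 0 by move: a0; rewrite neq_lt => /orP[]; [right|left].
  have -> : [set t | Num.floor (a * t + b) = k] =
      `[(k%:~R - b) / a, ((k + 1)%:~R - b) / a[%classic.
    rewrite e1; apply/seteqP; split => t /=;
      by rewrite in_itv /= ler_pdivrMr // ltr_pdivlMr // lerBlDr ltrBrDr mulrC.
  rewrite lebesgue_measure_itv /= lte_fin ltr_pM2r ?invr_gt0 // ltrD2r ltr_int ltzD1 lexx.
  by rewrite -EFinB gtr0_norm // intrD; congr EFin; field.
have -> : [set t | Num.floor (a * t + b) = k] =
    `]((k + 1)%:~R - b) / a, (k%:~R - b) / a]%classic.
  rewrite e1; apply/seteqP; split => t /=;
    by rewrite in_itv /= ltr_ndivrMr // ler_ndivlMr // andbC lerBlDr ltrBrDr mulrC.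
rewrite lebesgue_measure_itv /= lte_fin ltr_nM2r ?invr_lt0 // ltrD2r ltr_int ltzD1 lexx.
by rewrite -EFinB ltr0_norm // intrD; congr EFin; field.
Qed.

Lemma affine_dyadic_measure (d v : 'I_m -> R) j k : (forall i, d i != 0) ->
  mu ([set x | dyadic j k (\row_i (d i * x 0 i + v i))]) = (\prod_i (2 ^+ j * `|d i|)^-1)%:E.
Proof.
move=> d0; have p : 0 < 2 ^+ j :> R by rewrite exprn_gt0.
have e i : lebesgue_measure ([set t | Num.floor (2 ^+ j * d i * t + 2 ^+ j * v i) = k 0 i] : set RM)
    = ((2 ^+ j * `|d i|)^-1)%:E.
  have ne : 2 ^+ j * d i != 0 by rewrite mulf_neq0 ?d0 // gt_eqF.
  by rewrite (affine_floor_measure _ _ ne) normrM (gtr0_norm p).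
rewrite -(leb_box _ e) => [|i].
  congr leb; apply/seteqP; split=> [x <- i|x h] /=.
    by rewrite /dyadic_index !mxE; congr Num.floor; ring.
  by apply/rowP => i; rewrite !mxE -(h i); congr Num.floor; ring.
have -> : [set t | Num.floor (2 ^+ j * d i * t + 2 ^+ j * v i) = k 0 i] =
    (fun t : RM => 2 ^+ j * d i * t + 2 ^+ j * v i : RM) @^-1` `[(k 0 i)%:~R, (k 0 i + 1)%:~R[%classic.
  apply/seteqP; split => t /=; rewrite in_itv /=.
    by move=> <-; exact: floor_itv.
  exact: floor_def.
rewrite -[X in measurable X]setTI.
have : measurable_fun setT (fun t : RM => 2 ^+ j * d i * t + 2 ^+ j * v i : RM).
  by apply: measurable_funD => //; exact: mulrl_measurable.
by apply => //; exact: measurable_itv.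
Qed.

Lemma dyadic_measure j k : mu (dyadic j k) = (\prod_(i < m) (2 ^+ j)^-1 : R)%:E.
Proof.
transitivity (mu [set x : V | dyadic j k (\row_i (1 * x 0 i + 0))]).
  congr leb; apply/seteqP; split => x /=;
    by rewrite (_ : \row_i _ = x) //; apply/rowP => i; rewrite mxE mul1r addr0.
rewrite (@affine_dyadic_measure (fun=> 1) (fun=> 0) j k (fun=> oner_neq0 R)).
by congr EFin; apply: eq_bigr => i _; rewrite normr1 mulr1.
Qed.

Lemma cont_row (f : V -> 'I_m -> R) : (forall i, continuous (fun x => f x i)) ->
  continuous (fun x => \row_i f x i : V).
Proof.
move=> cf x A /nbhs_ballP[e /= e0 he].
have h i : nbhs x [set y | ball (f x i) e (f y i)] by exact: (cf i x _ (nbhsx_ballx (f x i) e e0)).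
have H := @filter_forall _ _ _ (nbhs x) (nbhs_filter (x : V)) h.
change (nbhs x ((fun x => \row_i f x i : V) @^-1` A)).
apply: (@filterS _ _ (nbhs_filter (x : V)) _ _ _ H) => y hy; apply: he; split => // a i; rewrite !mxE; exact: hy.
Qed.

Lemma affine_diag_continuous (d v : 'I_m -> R) :
  continuous (fun x : V => \row_i (d i * x 0 i + v i) : V).
Proof.
apply: cont_row => i x.
have h : d i * y 0 i @[y --> (x : V)] --> d i * x 0 i by apply: cvgMr; exact: coord_continuous.
exact: (cvgD h (cvg_cst (v i))).
Qed.

(** The preimage of a cube is a box, of known volume; the two inequalities pass separately from
    cubes to open sets. *)
Lemma affine_diag_open (d v : 'I_m -> R) (O : set V) : (forall i, d i != 0) -> open O ->
  mu [set x | O (\row_i (d i * x 0 i + v i))] = ((\prod_i `|d i|)^-1%:E * mu O)%E.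
Proof.
move=> d0 oO; set c := \prod_i _; have c0 : 0 < c by apply: prodr_gt0 => i _; rewrite normr_gt0.
have cub j k : mu [set x | dyadic j k (\row_i (d i * x 0 i + v i))] = (c^-1%:E * mu (dyadic j k))%E.
  rewrite affine_dyadic_measure // dyadic_measure -EFinM; congr EFin.
  by rewrite /c -prodfV -big_split /=; apply: eq_bigr => i _; rewrite invfM mulrC.
have cf : continuous (fun x : V => \row_i (d i * x 0 i + v i) : V).
  exact: affine_diag_continuous.
apply/eqP; rewrite eq_le; apply/andP; split.
  apply: (preimage_cubes_le _ cf) => // [|j k]; first by rewrite invr_ge0 ltW.
  by rewrite [X in (X <= _)%E]cub.
rewrite -lee_pdivlMl ?invr_gt0 // invrK.
apply: (preimage_cubes_ge _ cf) => // [|j k]; first exact: ltW.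
by rewrite [X in (_ <= _ * X)%E]cub muleA -EFinM divff ?gt_eqF // mul1e.
Qed.

Lemma translate_open (v : V) (O : set V) : open O -> mu [set x | O (x + v)] = mu O.
Proof.
move=> oO; have := @affine_diag_open (fun=> 1) (fun i => v 0 i) O (fun=> oner_neq0 R) oO.
have -> : \prod_(i < m) `|1 : R| = 1 by rewrite big1 // => i _; rewrite normr1.
rewrite invr1 mul1e => <-.
congr leb; apply/seteqP; split => x /=;
  by rewrite (_ : \row_i _ = x + v) //; apply/rowP => i; rewrite !mxE mul1r.
Qed.

End CubeComparison.

(** * Volume under linear maps *)

Section LinearInvariance.
Variables (R : realType) (m : nat).
Local Notation V := 'rV[R]_m.
Local Notation B := (borel_rv R m).
Local Notation RM := (measurableTypeR R).
Local Notation mu := (@leb R m).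

Lemma mulmxr_continuous (M : 'M[R]_m) : continuous (fun x : V => x *m M).
Proof.
rewrite (_ : (fun x : V => x *m M) = (fun x => \row_i \sum_j x 0 j * M j i)); last first.
  by apply/funext => x; apply/rowP => i; rewrite !mxE.
apply: cont_row => i x.
have h : \sum_j y 0 j * M j i @[y --> (x : V)] --> \sum_j x 0 j * M j i.
  apply: cvg_big => [|j _]; first exact: add_continuous.
  by apply: cvgMl; exact: coord_continuous.
exact: h.
Qed.

Lemma open_mulmxr (M : 'M[R]_m) (O : set V) : open O -> open [set x | O (x *m M)].
Proof. by move=> oO; have /continuousP := @mulmxr_continuous M; exact. Qed.

(** An inequality, because it is stable under products and under limits; applied to a matrix and to
    its inverse it yields equality ([det1_open]). *)
Definition shrinks (M : 'M[R]_m) := forall O : set V, open O ->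
  (mu [set x | O (x *m M)] <= mu O)%E.

Lemma shrinksM M N : shrinks M -> shrinks N -> shrinks (M *m N).
Proof.
move=> hM hN O oO; apply: le_trans (hN O oO).
rewrite (_ : [set x | _] = [set x | [set y | O (y *m N)] (x *m M)]).
  by apply: hM; exact: open_mulmxr.
by apply/seteqP; split => x /=; rewrite mulmxA.
Qed.

Lemma shrinks1 : shrinks 1%:M.
Proof.
move=> O oO; have -> // : [set x | O (x *m 1%:M)] = O.
by apply/seteqP; split => x /=; rewrite mulmx1.
Qed.

Lemma diag_open (d : V) (O : set V) : (forall i, d 0 i != 0) -> open O ->
  mu [set x | O (x *m diag_mx d)] = ((\prod_i `|d 0 i|)^-1%:E * mu O)%E.
Proof.
move=> d0 oO; rewrite -(@affine_diag_open R m (d 0) (fun=> 0)) //.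
congr leb; apply/seteqP; split => x /=;
  by rewrite (_ : \row_i _ = x *m diag_mx d) //; apply/rowP => i; rewrite mul_mx_diag !mxE addr0 mulrC.
Qed.

Lemma shrinks_diag (d : V) : \prod_i `|d 0 i| = 1 -> shrinks (diag_mx d).
Proof.
move=> d1 O oO; rewrite diag_open // ?d1 ?invr1 ?mul1e // => i.
apply/eqP => d0; move: d1; rewrite (bigD1 i) //= d0 normr0 mul0r => /esym/eqP.
by rewrite oner_eq0.
Qed.

Lemma shrinks_perm (s : 'S_m) : shrinks (perm_mx s).
Proof.
move=> O oO; rewrite -[leRHS]mul1e; apply: preimage_cubes_le => //.
  exact: mulmxr_continuous.
move=> j k; rewrite mul1e (_ : _ @^-1` _ = dyadic j (\row_i k 0 (s i))) ?dyadic_measure //.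
have sE (x : V) i : (x *m perm_mx s) 0 (s i) = x 0 i.
  rewrite mxE (bigD1 i) //= big1 => [|l li]; rewrite !mxE ?eqxx ?mulr1 ?addr0 //.
  by rewrite (inj_eq perm_inj) (negPf li) mulr0.
apply/seteqP; split => x /= h; apply/rowP => i.
  by rewrite [LHS]mxE [RHS]mxE -h mxE sE.
by move: h => /rowP/(_ ((s^-1)%g i)); rewrite [LHS]mxE [RHS]mxE permKV => <-; rewrite mxE -(sE x) permKV.
Qed.

Lemma open_translate (v : V) (O : set V) : open O -> open [set u | O (u + v)].
Proof.
move=> oO; rewrite (_ : [set u | _] = (fun u : V => \row_i (1 * u 0 i + v 0 i)) @^-1` O).
  have /continuousP : continuous (fun u : V => \row_i (1 * u 0 i + v 0 i) : V); last by apply.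
  exact: (@affine_diag_continuous R m (fun=> 1) (fun i => v 0 i)).
apply/seteqP; split => x /=;
  by rewrite (_ : \row_i _ = x + v) //; apply/rowP => i; rewrite !mxE mul1r.
Qed.

Definition cbox (w : V) (r : R) : set V := [set z | forall i, `|z 0 i - w 0 i| < r].

Lemma cbox_open w r : open (cbox w r).
Proof.
apply: open_of_nbhs => x hx.
have h i : nbhs x [set y : V | `|y 0 i - w 0 i| < r].
  have c : `|y 0 i - w 0 i| @[y --> x] --> `|x 0 i - w 0 i|.
    by apply: cvg_norm; apply: cvgB; [exact: coord_continuous|exact: cvg_cst].
  exact: (cvgr_lt _ c _ (hx i)).
exact: (@filter_forall _ _ _ (nbhs x) (nbhs_filter (x : V)) h).
Qed.

Lemma cbox_measure w r : 0 < r -> mu (cbox w r) = ((2 * r) ^+ m)%:E.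
Proof.
move=> r0.
have e i : lebesgue_measure (`]w 0 i - r, w 0 i + r[%classic : set RM) = (2 * r)%:E.
  rewrite lebesgue_measure_itv /= lte_fin ifT; last by lra.
  by rewrite -EFinB; congr EFin; ring.
have := leb_box (fun i => measurable_itv _) e; rewrite prodr_const card_ord => <-.
congr leb; apply/seteqP; split=> x h i; have := h i; rewrite /= in_itv /= ltr_distl //.
Qed.

Lemma dyadic_center j k (y : V) i : dyadic j k y ->
  `|y 0 i - ((k 0 i)%:~R / 2 ^+ j + 2^-1 ^+ j / 2)| <= 2^-1 ^+ j / 2.
Proof.
move=> <-; rewrite mxE; have p : 0 < 2 ^+ j :> R by rewrite exprn_gt0.
have /andP[h1 h2] := floor_itv (2 ^+ j * y 0 i); rewrite intrD in h2.
move: h1 h2; move: (Num.floor _)%:~R => a h1 h2.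
rewrite exprVn; move: p h1 h2; move: (2 ^+ j) (y 0 i) => q u p h1 h2.
have e1 : a / q <= u by rewrite ler_pdivrMr // mulrC.
have e2 : u < a / q + q^-1 by rewrite -[X in _ + X]mul1r -mulrDl ltr_pdivlMr // mulrC.
by rewrite ler_norml; apply/andP; split; lra.
Qed.

(* Comparing [F] with its linearisation through the inverse [G] of the
   derivative shows that the image of a cube lies in a slightly larger
   parallelepiped. *)
Lemma image_cube_cover (F : V -> V) (G : 'M[R]_m) (x0 c : V) (eta : R) j k :
  shrinks G -> 0 < eta ->
  (forall y, dyadic j k y -> forall i,
     `|((F y - c) *m G) 0 i - (y 0 i - x0 0 i)| <= eta * 2^-1 ^+ j) ->
  exists W : set V, [/\ open W, F @` dyadic j k `<=` W &
    (mu W <= ((1 + 4 * eta) ^+ m)%:E * mu (dyadic j k))%E].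
Proof.
move=> hG eta0 hF; have s0 : 0 < 2^-1 ^+ j :> R by rewrite exprn_gt0 // invr_gt0.
move: s0 hF; set s : R := 2^-1 ^+ j => s0 hF.
pose w : V := \row_i ((k 0 i)%:~R / 2 ^+ j + s / 2 - x0 0 i).
(* Half the side plus twice the error, the error being counted twice because the box is open and
   needs a strict inequality. The side of the box is thus (1 + 4 eta) s. *)
pose r := s / 2 + 2 * eta * s.
have es0 : 0 < eta * s by rewrite mulr_gt0.
have r0 : 0 < r by rewrite /r; lra.
pose O1 := [set z | cbox w r (z *m G)].
have oO1 : open O1 by apply: open_mulmxr; exact: cbox_open.
exists [set u | O1 (u + - c)]; split.
- exact: open_translate.
- move=> _ [y Qy <-] i /=; have h1 := hF y Qy i; have h2 := dyadic_center i Qy.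
  rewrite -/s in h2.
  have -> : ((F y - c) *m G) 0 i - w 0 i = (((F y - c) *m G) 0 i - (y 0 i - x0 0 i)) +
      (y 0 i - ((k 0 i)%:~R / 2 ^+ j + s / 2)) by rewrite /w !mxE; ring.
  by apply: (le_lt_trans (ler_normD _ _)); apply: (le_lt_trans (lerD h1 h2)); rewrite /r; lra.
- rewrite (translate_open _ oO1); have hm := hG _ (@cbox_open w r); apply: (le_trans hm).
  rewrite cbox_measure // dyadic_measure -EFinM lee_fin prodr_const card_ord -exprMn.
  rewrite -exprVn -/s (_ : 2 * r = (1 + 4 * eta) * s) //.
  by rewrite /r; field.
Qed.

Lemma expr_close_1 (e : R) : 0 < e -> exists2 eta : R, 0 < eta & (1 + 4 * eta) ^+ m <= 1 + e.
Proof.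
move=> e0.
have c : (1 + 4 * x) ^+ m @[x --> (0 : R)] --> (1 + 4 * 0 : R) ^+ m.
  apply: (@continuous_comp _ _ _ (fun x : R => 1 + 4 * x) (fun y => y ^+ m)); last exact: exprn_continuous.
  by apply: cvgD; [exact: cvg_cst|apply: cvgMr; exact: cvg_id].
rewrite mulr0 addr0 expr1n in c.
have : \forall x \near (0 : R), (1 + 4 * x) ^+ m < 1 + e.
  by apply: (cvgr_lt _ c); lra.
move=> /nbhs_ballP[d /= d0 hd]; exists (d / 2); first by rewrite divr_gt0.
apply/ltW/hd; rewrite -ball_normE /= sub0r normrN gtr0_norm ?divr_gt0 //.
by rewrite ltr_pdivrMr //; lra.
Qed.

Lemma lee_mul_close (x y : \bar R) : (0 <= y)%E ->
  (forall e : R, 0 < e -> (x <= (1 + e)%:E * y)%E) -> (x <= y)%E.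
Proof.
move=> y0 h; case: y y0 h => [r| |] // r0 h; last exact: leey.
rewrite lee_fin in r0.
apply/lee_addgt0Pr => e e0.
(* Dividing by r + 1 rather than r covers r = 0. *)
have r1 : 0 < r + 1 by lra.
have := h (e / (r + 1)) (divr_gt0 e0 r1); move=> /le_trans; apply.
rewrite -EFinM -EFinD lee_fin mulrDl mul1r lerD2l mulrAC ler_pdivrMr //.
by rewrite ler_pM2l //; lra.
Qed.

(** The preimage of a cube under [M'] is its image under [M]; as the column sums of |M - 1| are at
    most eta, [image_cube_cover] applies with the identity as linearisation. *)
Lemma near_identity_open (M M' : 'M[R]_m) (eta : R) (O : set V) : M' *m M = 1%:M -> 0 < eta ->
  (forall i, \sum_j `|(M - 1%:M) j i| <= eta) -> open O ->
  (mu [set x | O (x *m M')] <= ((1 + 4 * eta) ^+ m)%:E * mu O)%E.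
Proof.
move=> MM eta0 hM oO.
apply: (preimage_cubes_le (f := fun x : V => x *m M')) => //.
- by rewrite exprn_ge0 // addr_ge0 // mulr_ge0 // ltW.
- exact: mulmxr_continuous.
move=> j k.
have mK : measurable ((fun x : V => x *m M') @^-1` dyadic j k : set B).
  by apply: continuous_borel_preimage; [exact: mulmxr_continuous|exact: dyadic_borel].
have [e|/set0P[x0 Qx0]] := eqVneq (dyadic j k : set V) set0.
  by rewrite e preimage_set0 measure0 mule0.
have [|||W [oW hW hm]] := @image_cube_cover (fun y => y *m M) 1%:M x0 (x0 *m M) eta j k.
- exact: shrinks1.
- exact: eta0.
- move=> y Qy i; rewrite mulmx1 -mulmxBl.
  have -> : ((y - x0) *m M) 0 i - (y 0 i - x0 0 i) = ((y - x0) *m (M - 1%:M)) 0 i.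
    by rewrite mulmxBr mulmx1 !mxE.
  rewrite mxE; apply: (le_trans (ler_norm_sum _ _ _)).
  apply: (@le_trans _ _ (\sum_l 2^-1 ^+ j * `|(M - 1%:M) l i|)).
    apply: ler_sum => l _; rewrite normrM ler_wpM2r //.
    by apply: ltW; rewrite [(y - x0) 0 l]mxE [(- x0) 0 l]mxE; exact: (dyadic_coord l Qy Qx0).
  by rewrite -mulr_sumr mulrC ler_wpM2r // exprn_ge0.
apply: (le_trans _ hm); apply: le_measure; [exact: mem_set|apply/mem_set; exact: open_borel|].
by move=> x /= Qx; apply: hW; exists (x *m M') => //; rewrite -mulmxA MM mulmx1.
Qed.

(* Conjugating by diag(t^f) with t -> 0 moves a unitriangular matrix to the identity. *)
Lemma shrinks_unitriangular (f : 'I_m -> nat) (U U' : 'M[R]_m) : U' *m U = 1%:M ->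
  (forall i, U i i = 1) -> (forall i j, i != j -> U i j != 0 -> (f j < f i)%N) ->
  shrinks U'.
Proof.
move=> UU U1 Uf O oO; apply: lee_mul_close => // e e0.
have [eta eta0 he] := expr_close_1 e0.
pose S : R := \sum_i \sum_j `|U j i|.
have S0 : 0 <= S by apply: sumr_ge0 => i _; exact: sumr_ge0.
(* Conjugation multiplies the entry (i, j) of [U] by t^(f i - f j), with a positive exponent off the
   diagonal where the entry is nonzero. So for t <= 1 the column sums off the diagonal are at most t
   S, and t S <= eta. *)
pose t : R := Num.min 1 (eta / (S + 1)).
have S1 : 0 < S + 1 by lra.
have t0 : 0 < t by rewrite lt_min ltr01 divr_gt0.
have t1 : t <= 1 by rewrite ge_min lexx.
have tS : t * S <= eta.
  apply: (@le_trans _ _ (eta / (S + 1) * S)); first by rewrite ler_wpM2r // ge_min lexx orbT.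
  by rewrite mulrAC ler_pdivrMr // ler_pM2l //; lra.
pose d : V := \row_i t ^+ f i; pose d' : V := \row_i t ^- f i.
have tf i : t ^+ f i != 0 by rewrite expf_neq0 // gt_eqF.
have dd : diag_mx d *m diag_mx d' = 1%:M.
  rewrite mulmx_diag -diag_const_mx; congr diag_mx; apply/rowP => i; rewrite !mxE divff //.
have dd' : diag_mx d' *m diag_mx d = 1%:M by exact: mulmx1C.
pose M := diag_mx d *m U *m diag_mx d'; pose M' := diag_mx d *m U' *m diag_mx d'.
have MM : M' *m M = 1%:M.
  by rewrite /M /M' !mulmxA -(mulmxA (diag_mx d *m U')) dd' mulmx1 -(mulmxA (diag_mx d)) UU mulmx1.
have UE : U' = diag_mx d' *m M' *m diag_mx d.
  by rewrite /M' !mulmxA dd' mul1mx -mulmxA dd' mulmx1.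
have hM i : \sum_j `|(M - 1%:M) j i| <= eta.
  apply: (le_trans _ tS); rewrite /S [X in _ <= _ * X](bigD1 i) //= mulrDr.
  apply: ler_wpDr.
    by apply: mulr_ge0; [exact: ltW|apply: sumr_ge0 => ? _; exact: sumr_ge0].
  rewrite mulr_sumr; apply: ler_sum => j _.
  rewrite /M mul_mx_diag mul_diag_mx !mxE.
  have [->|ji] := eqVneq j i.
    by rewrite U1 mulr1 divff // subrr normr0; apply: mulr_ge0 => //; exact: ltW.
  rewrite subr0 normrM normrM mulrAC -mulrA.
  have [->|Uji] := eqVneq (U j i) 0; first by rewrite normr0 !mulr0.
  have lt := Uf _ _ ji Uji.
  have tp l : 0 <= t ^+ l by rewrite exprn_ge0 // ltW.
  rewrite mulrA ler_wpM2r // normfV !(ger0_norm (tp _)).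
  rewrite -(subnK (ltnW lt)) exprD mulfK //.
  rewrite -[leRHS]expr1; apply: ler_wiXn2l => //; first exact: ltW.
  by rewrite subn_gt0.
have od : open [set z | O (z *m diag_mx d)] by exact: open_mulmxr.
have oO1 : open [set y | O (y *m M' *m diag_mx d)].
  by rewrite (_ : [set y | _] = [set y | [set z | O (z *m diag_mx d)] (y *m M')]) //; exact: open_mulmxr.
have p i : d 0 i != 0 by rewrite mxE.
have p' i : d' 0 i != 0 by rewrite mxE invr_eq0.
have -> : [set x | O (x *m U')] = [set x | [set y | O (y *m M' *m diag_mx d)] (x *m diag_mx d')].
  by apply/seteqP; split => x /=; rewrite UE !mulmxA.
rewrite (diag_open p' oO1).
have k1 : (mu [set y | O (y *m M' *m diag_mx d)] <=
    ((1 + 4 * eta) ^+ m)%:E * mu [set z | O (z *m diag_mx d)])%E.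
  exact: near_identity_open MM eta0 hM od.
rewrite (diag_open p oO) in k1.
have e1 : (\prod_i `|d' 0 i|)^-1 = \prod_i `|d 0 i|.
  by rewrite -prodfV; apply: eq_bigr => i _; rewrite !mxE normfV invrK.
have c0 : 0 < \prod_i `|d 0 i| by apply: prodr_gt0 => i _; rewrite normr_gt0.
rewrite e1.
have := lee_wpmul2l (_ : (0 <= (\prod_i `|d 0 i|)%:E)%E) k1; rewrite lee_fin ltW // => /(_ isT).
move=> /le_trans; apply.
rewrite muleCA [X in (_ * X)%E]muleA -EFinM divff ?gt_eqF // mul1e.
by apply: lee_wpmul2r => //; rewrite lee_fin.
Qed.

End LinearInvariance.

Section DetOne.
Variable R : realType.

(** The LUP decomposition P A = L D U1 gives A^-1 = U1^-1 D^-1 L^-1 P. Here L and U1 are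
    unitriangular and D is diagonal with determinant of modulus 1, so every factor shrinks. *)
Let shrinks_inv_S m (A A' : 'M[R]_m.+1) : A' *m A = 1%:M -> `|\det A| = 1 -> shrinks A'.
Proof.
move=> AA dA.
have := cormen_lup_correct A; have := cormen_lup_perm A; have := cormen_lup_detL A.
have := @cormen_lup_lower _ m A; have := @cormen_lup_upper _ m A.
case: (cormen_lup A) => [[P L] U] /= hU hL dL /is_perm_mxP[s eP] e.
have dP : `|\det P| = 1 by rewrite eP det_perm normr_sign.
have dU : `|\det U| = 1.
  have /(congr1 (fun X => `|\det X|)) := e.
  by rewrite !det_mulmx !normrM dP dA dL normr1 !mul1r.
have trigU : \det U = \prod_i U i i.
  rewrite -det_tr det_trig; first by apply: eq_bigr => i _; rewrite mxE.
  by apply/is_trig_mxP => i j ij; rewrite mxE hU.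
pose d : 'rV[R]_m.+1 := \row_i U i i; pose d' : 'rV[R]_m.+1 := \row_i (U i i)^-1.
have Ui i : U i i != 0.
  apply/eqP => Ui; move: dU; rewrite trigU (bigD1 i) //= Ui mul0r normr0 => /esym/eqP.
  by rewrite oner_eq0.
have dd : diag_mx d *m diag_mx d' = 1%:M.
  by rewrite mulmx_diag -diag_const_mx; congr diag_mx; apply/rowP => i; rewrite !mxE divff.
have dd' : diag_mx d' *m diag_mx d = 1%:M by exact: mulmx1C.
have nd' : \prod_i `|d' 0 i| = 1.
  transitivity (`|\det U|^-1); last by rewrite dU invr1.
  by rewrite trigU normr_prod -prodfV; apply: eq_bigr => i _; rewrite mxE normfV.
pose U1 := diag_mx d' *m U.
have UE : U = diag_mx d *m U1 by rewrite /U1 mulmxA dd mul1mx.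
have dL1 : L \in unitmx by rewrite unitmxE dL unitr1.
have uU : U \in unitmx by rewrite unitmxE unitfE -normr_eq0 dU oner_eq0.
have uU1 : U1 \in unitmx.
  rewrite unitmx_mul uU andbT; have /mulmx1_unit [] := dd'; done.
(* For the upper triangular factor the weights have to decrease with the index. *)
have sU1 : shrinks (invmx U1).
  apply: (@shrinks_unitriangular R m.+1 (fun i => m.+1 - i)%N U1) => [|i|i j ij].
  - by rewrite mulVmx.
  - by rewrite /U1 mul_diag_mx !mxE mulVf.
  - rewrite /U1 mul_diag_mx mxE => h.
    have : ~~ (j < i)%N by apply: contra h => /hU ->; rewrite mulr0.
    rewrite -leqNgt leq_eqVlt => /orP[/eqP /val_inj e1|lt]; first by rewrite e1 eqxx in ij.
    by rewrite ltn_sub2l // (leq_trans (ltn_ord i)).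
have sL : shrinks (invmx L).
  apply: (@shrinks_unitriangular R m.+1 (fun i => i) L) => [|i|i j ij].
  - by rewrite mulVmx.
  - by rewrite hL // eqxx.
  - move=> h; rewrite ltnNge; apply: contra h => /hL ->; rewrite (negPf ij).
    by [].
have -> : A' = invmx U1 *m diag_mx d' *m invmx L *m P.
  have uA : A \in unitmx by case: (mulmx1_unit AA).
  have -> : A' = invmx A by rewrite -[LHS]mulmx1 -(mulmxV uA) mulmxA AA mul1mx.
  have e2 : P *m A = L *m (diag_mx d *m U1) by rewrite -UE; exact: e.
  apply: (can_inj (mulmxK uA)); rewrite mulVmx // -(mulmxA _ P A) e2 !mulmxA.
  rewrite mulmxKV // -(mulmxA _ (diag_mx d') (diag_mx d)) dd' mulmx1. by rewrite -mulmxA -/U1 mulVmx.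
apply: shrinksM; last by rewrite eP; exact: shrinks_perm.
apply: shrinksM => //; apply: shrinksM => //; exact: shrinks_diag.
Qed.

Variable m : nat.
Local Notation V := 'rV[R]_m.
Local Notation B := (borel_rv R m).
Local Notation mu := (@leb R m).

Lemma det_abs1_unit (A : 'M[R]_m) : `|\det A| = 1 -> A \in unitmx.
Proof. by move=> h; rewrite unitmxE unitfE -normr_eq0 h oner_eq0. Qed.

Lemma det_abs1_inv (A : 'M[R]_m) : `|\det A| = 1 -> `|\det (invmx A)| = 1.
Proof. by move=> h; rewrite det_inv normfV h invr1. Qed.

Lemma shrinks_det1 (A : 'M[R]_m) : `|\det A| = 1 -> shrinks A.
Proof.
move=> dA; have uA := det_abs1_unit dA; have dA' := det_abs1_inv dA.
have := mulmxV uA; move: (invmx A) dA' => A' dA' AA.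
case: m A A' AA dA' {dA uA} => [|k] A A' AA dA'; last exact: shrinks_inv_S AA dA'.
have -> : A = 1%:M by apply/matrixP => -[].
exact: shrinks1.
Qed.

Lemma det1_open (A : 'M[R]_m) (O : set V) : `|\det A| = 1 -> open O ->
  mu [set x | O (x *m A)] = mu O.
Proof.
move=> dA oO; apply/eqP; rewrite eq_le; apply/andP; split; first exact: shrinks_det1.
have := shrinks_det1 (det_abs1_inv dA) (@open_mulmxr _ _ A _ oO).
have -> // : [set x | [set y | O (y *m A)] (x *m invmx A)] = O.
by apply/seteqP; split => x /=; rewrite mulmxKV // det_abs1_unit.
Qed.

(** Open sets are stable under intersection and generate the Borel sets, and the boxes around 0
    exhaust the space with finite volume, so the measure is determined by its values on open
    sets. *)
Lemma borel_open_ext (f : V -> V) : continuous f ->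
  (forall O, open O -> mu (f @^-1` O) = mu O) ->
  forall A : set B, measurable A -> mu (f @^-1` A) = mu A.
Proof.
move=> cf h A mA.
apply: (@measure_unique _ R B (@open V) (fun k => cbox 0 k.+1%:R) erefl _ _ _
  (pushforward mu (f : B -> B)) mu) => //.
- by move=> X Y oX oY; exact: openI.
- by move=> k; exact: cbox_open.
- apply/seteqP; split => // x' _; pose x : V := x'.
  have [k hk] : exists k : nat, forall i : 'I_m, `|x 0 i| < k.+1%:R.
    exists (\sum_(i < m) Num.trunc `|x ord0 i|)%N => i.
    apply: (lt_le_trans (truncnS_gt _)); rewrite ler_nat ltnS (bigD1 i) //= leq_addr.
    by [].
  by exists k => // i; rewrite mxE subr0.
  exact: continuous_borel.
move=> mf k; have e := h _ (@cbox_open R m 0 k.+1%:R).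
by rewrite /pushforward [X in (X < _)%E]e cbox_measure ?ltry.
Qed.

Lemma det1_borel (A : 'M[R]_m) (E : set V) : `|\det A| = 1 -> measurable (E : set B) ->
  mu [set x | E (x *m A)] = mu E.
Proof.
move=> dA mE; apply: (borel_open_ext (f := fun x : V => x *m A)) => //.
  exact: mulmxr_continuous.
by move=> O oO; exact: det1_open.
Qed.

Lemma translate_continuous (v : V) : continuous (fun x : V => x + v).
Proof. by apply/continuousP => O oO; exact: open_translate. Qed.

Lemma translate_borel (v : V) (E : set V) : measurable (E : set B) ->
  mu [set x | E (x + v)] = mu E.
Proof.
move=> mE; apply: (borel_open_ext (f := fun x : V => x + v)) => //.
  exact: translate_continuous.
by move=> O oO; exact: translate_open.
Qed.

End DetOne.

(** * Symplectic charts of the torus *)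

Section TorusMeasure.
Variables (R : realType) (m : nat).
Local Notation V := 'rV[R]_m.
Local Notation B := (borel_rv R m).
Local Notation T := (torus R m).
Local Notation mu := (@leb R m).
Local Notation tpi := (@torus_pi R m).

Definition int_row (v : V) := forall i, v 0 i \is a Num.int.

Lemma torus_piP (x y : V) : tpi x = tpi y <-> int_row (x - y).
Proof.
split=> [/eqmodP /= /forallP h i|h]; first by have := h i; rewrite !mxE.
by apply/eqmodP; apply/forallP => i; have := h i; rewrite !mxE.
Qed.

Lemma int_rowN v : int_row v -> int_row (- v).
Proof. by move=> h i; rewrite mxE rpredN. Qed.

Lemma int_rowD u v : int_row u -> int_row v -> int_row (u + v).
Proof. by move=> h1 h2 i; rewrite mxE rpredD. Qed.

Lemma int_rowM v (A : 'M[R]_m) : int_row v -> (forall i j, A i j \is a Num.int) ->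
  int_row (v *m A).
Proof. by move=> hv hA i; rewrite mxE; apply: rpred_sum => j _; exact: rpredM. Qed.

Lemma torus_piDint (x v : V) : int_row v -> tpi (x + v) = tpi x.
Proof. by move=> h; apply/torus_piP; rewrite addrAC subrr add0r. Qed.

Lemma torus_pi_surj (t : T) : exists x, tpi x = t.
Proof. by exists (generic_quotient.repr t); rewrite /torus_pi generic_quotient.reprK. Qed.

Lemma open_torus (U : set T) : open U <-> open (tpi @^-1` U).
Proof. by []. Qed.

Definition sat (S : set V) : set V := tpi @^-1` (tpi @` S).

Lemma satP S x : sat S x <-> exists2 v, int_row v & S (x + v).
Proof.
split=> [[y Sy /torus_piP h]|[v hv Sv]].
  by exists (y - x) => //; rewrite addrC subrK.
by exists (x + v) => //; rewrite torus_piDint.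
Qed.

Definition of_int_row (k : 'rV[int]_m) : V := map_mx (fun z : int => z%:~R) k.

Lemma int_of_int_row k : int_row (of_int_row k).
Proof. by move=> i; rewrite mxE intr_int. Qed.

Lemma int_rowE v : int_row v -> exists k, v = of_int_row k.
Proof.
move=> h; exists (\row_i Num.floor (v 0 i)); apply/rowP => i; rewrite !mxE.
by have /intrP[z ->] := h i; rewrite intrKfloor.
Qed.

Definition unit_cube : set V := dyadic 0 0.

Lemma unit_cubeP x : unit_cube x <-> forall i, 0 <= x 0 i < 1.
Proof.
split=> [h i|h].
  have := floor_itv (x 0 i); have /rowP/(_ i) := h.
  by rewrite !mxE expr0 mul1r => ->; rewrite add0r.
apply/rowP => i; rewrite !mxE expr0 mul1r; apply: floor_def.
by rewrite add0r; exact: h.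
Qed.

Definition frac (x : V) : V := x - of_int_row (dyadic_index 0 x).

Lemma frac_unit_cube x : unit_cube (frac x).
Proof.
apply/unit_cubeP => i; rewrite !mxE expr0 mul1r; have := floor_itv (x 0 i).
by rewrite intrD => /andP[h1 h2]; apply/andP; split; lra.
Qed.

Lemma torus_pi_frac x : tpi (frac x) = tpi x.
Proof. by apply: torus_piDint; apply: int_rowN; exact: int_of_int_row. Qed.

Lemma unit_cube_inj x v : unit_cube x -> unit_cube (x + v) -> int_row v -> v = 0.
Proof.
move=> /unit_cubeP h1 /unit_cubeP h2 hv; apply/rowP => i; rewrite mxE.
have /intrP[z ez] := hv i; have := h1 i; have := h2 i; rewrite mxE ez => /andP[a b] /andP[c d].
have z1 : (z%:~R : R) < 1%:~R by lra.
have z2 : ((-1)%:~R : R) < z%:~R by rewrite intrN; lra.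
move: z1 z2; rewrite !ltr_int => z1 z2.
by rewrite (_ : z = 0) //; lia.
Qed.

Lemma unit_cube_borel : measurable (unit_cube : set B).
Proof. exact: dyadic_borel. Qed.

Lemma unit_cube_measure : mu unit_cube = 1%E.
Proof. by rewrite dyadic_measure expr0 invr1 big1. Qed.

(** Numbers a family indexed by Z^m, with the empty set at the numbers that code no index. *)
Let kseq (n : nat) (S : 'rV[int]_m -> set V) : set V :=
  match (pickle_inv n : option 'rV[int]_m) with Some k => S k | None => set0 end.

Lemma sat_union (S : set V) : sat S = \bigcup_n kseq n (fun k => [set x | S (x + of_int_row k)]).
Proof.
apply/seteqP; split=> [x /satP[v /int_rowE[k ->] Sv]|x [n _]].
  by exists (pickle k) => //; rewrite /kseq pickleK_inv.
rewrite /kseq; case: (pickle_inv n) => // k /= Sk.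
by apply/satP; exists (of_int_row k) => //; exact: int_of_int_row.
Qed.

Lemma translate_measurable (S : set V) (v : V) : measurable (S : set B) ->
  measurable ([set x | S (x + v)] : set B).
Proof. by move=> mS; apply: (@continuous_borel_preimage R m (fun x => x + v)) => //; exact: translate_continuous. Qed.

Lemma sat_borel (S : set V) : measurable (S : set B) -> measurable (sat S : set B).
Proof.
move=> mS; rewrite sat_union; apply: bigcup_measurable => n _.
rewrite /kseq; case: (pickle_inv n) => [k|]; last exact: measurable0.
exact: translate_measurable.
Qed.

(* Each integer translate of the cube meets [S] in a disjoint piece. *)
Lemma sat_measure_le (S : set V) : measurable (S : set B) ->
  (mu (unit_cube `&` sat S) <= mu S)%E.
Proof.
move=> mS.
pose F n := kseq n (fun k => [set x | unit_cube x /\ S (x + of_int_row k)]).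
pose G n := kseq n (fun k => [set y | unit_cube (y - of_int_row k) /\ S y]).
have mF n : measurable (F n : set B).
  rewrite /F /kseq; case: (pickle_inv n) => [k|]; last exact: measurable0.
  by apply: measurableI; [exact: unit_cube_borel|exact: translate_measurable].
have mG n : measurable (G n : set B).
  rewrite /G /kseq; case: (pickle_inv n) => [k|]; last exact: measurable0.
  by apply: measurableI => //; apply: translate_measurable; exact: unit_cube_borel.
have FG n : mu (F n) = mu (G n).
  have := mG n; rewrite /F /G /kseq; case: (pickle_inv n) => [k|//] mGk.
  rewrite -(translate_borel (of_int_row k) mGk); congr leb.
  by apply/seteqP; split => x /=; rewrite addrK.
have tG : trivIset setT G.
  apply/trivIsetP => n n' _ _ nn'; apply: contrapT => /eqP/set0P[x [Gx Gx']].
  move/eqP: nn'; apply; move: Gx Gx'; rewrite /G /kseq.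
  have := @pickle_invK 'rV[int]_m n; have := @pickle_invK 'rV[int]_m n'.
  case: (pickle_inv n) => // k; case: (pickle_inv n') => // k' /= <- <- [c1 _] [c2 _].
  congr pickle; have e : x - of_int_row k' = x - of_int_row k + (of_int_row k - of_int_row k').
    by rewrite addrA subrK.
  rewrite e in c2.
  have /eqP := unit_cube_inj c1 c2 (int_rowD (int_of_int_row k) (int_rowN (int_of_int_row k'))).
  rewrite subr_eq0 => /eqP ek; apply/rowP => i.
  by have /rowP/(_ i) := ek; rewrite !mxE => /intr_inj.
apply: (@le_trans _ _ (\sum_(n <oo) mu (F n))%E).
  apply: measure_sigma_subadditive => //.
    by apply: measurableI; [exact: unit_cube_borel|exact: sat_borel].
  move=> x [cx]; rewrite sat_union => -[n _ Sx]; exists n => //.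
  by move: Sx; rewrite /F /kseq; case: (pickle_inv n).
rewrite (eq_eseriesr (g := fun n => mu (G n))); last by move=> n _; exact: FG.
have mU : measurable (\bigcup_n G n : set B) by exact: bigcup_measurable.
have := measure_semi_bigcup mu mG tG mU; move=> <-.
apply: le_measure; [exact: mem_set|exact: mem_set|].
by move=> x [n _]; rewrite /G /kseq; case: (pickle_inv n) => // k [].
Qed.

(** A point x of the unit cube with xA in [E] is congruent modulo Z^m to a point that [A] sends into
    the part of [E] in the unit cube. The set of the latter points has the volume of that part, and
    passing to representatives in the cube does not increase volume. *)
Lemma periodic_linear_le (A A' : 'M[R]_m) (E : set V) : A *m A' = 1%:M ->
  `|\det A| = 1 -> (forall i j, A' i j \is a Num.int) -> measurable (E : set B) ->
  (forall x v, int_row v -> E x -> E (x + v)) ->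
  (mu (unit_cube `&` [set x | E (x *m A)]) <= mu (unit_cube `&` E))%E.
Proof.
move=> AA dA iA' mE pE.
have mDE : measurable (unit_cube `&` E : set B) by apply: measurableI => //; exact: unit_cube_borel.
have lin (X : set V) : measurable (X : set B) -> measurable ([set x | X (x *m A)] : set B).
  by move=> mX; apply: (@continuous_borel_preimage R m (fun x => x *m A)) => //; exact: mulmxr_continuous.
rewrite -[leRHS](det1_borel dA mDE).
apply: (le_trans _ (sat_measure_le (lin _ mDE))).
apply: le_measure.
- by apply: mem_set; apply: measurableI; [exact: unit_cube_borel|exact: lin].
- by apply: mem_set; apply: measurableI; [exact: unit_cube_borel|apply: sat_borel; exact: lin].
move=> x [cx Ex]; split => //; apply/satP.
pose k := of_int_row (dyadic_index 0 (x *m A)).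
have ik : int_row k by exact: int_of_int_row.
(* Subtracting k A', which is integral, from x subtracts k from xA and so replaces xA by its
   fractional part. *)
exists (- (k *m A')); first by apply: int_rowN; exact: int_rowM.
rewrite /=; have -> : (x + - (k *m A')) *m A = frac (x *m A).
  have AA' : A' *m A = 1%:M by exact: mulmx1C.
  by rewrite mulmxDl mulNmx -mulmxA AA' mulmx1.
split; first exact: frac_unit_cube.
by apply: pE => //; exact: int_rowN.
Qed.

End TorusMeasure.

(** * Derivatives in the row convention and derivatives of lifts *)

Section RowDifferential.
Variables (R : realType) (m : nat).
Local Notation V := 'rV[R]_m.

Lemma nbhs_rowS2 (x : V) (P Q S : set V) : (forall y, P y -> Q y -> S y) ->
  nbhs x P -> nbhs x Q -> nbhs x S.
Proof. exact: (@filterS2 _ _ (nbhs_filter x)). Qed.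

Lemma nbhs_rowS3 (x : V) (P Q S U : set V) : (forall y, P y -> Q y -> S y -> U y) ->
  nbhs x P -> nbhs x Q -> nbhs x S -> nbhs x U.
Proof. exact: (@filterS3 _ _ (nbhs_filter x)). Qed.

Lemma cvg_rowP (f : V -> V) (x l : V) :
  f y @[y --> x] --> l <-> forall e : R, 0 < e -> \forall y \near x, `|l - f y| < e.
Proof. exact: (@cvgrPdist_lt _ _ _ _ (nbhs_filter x)). Qed.

(** The derivative as a matrix acting on rows from the right, hence the transpose of the Jacobi
    matrix ([rdiff_jacobi]); the explicit estimate is what the volume comparison uses. *)
Definition rdiff (f : V -> V) (x : V) (L : 'M[R]_m) := forall e : R, 0 < e ->
  \forall y \near x, `|f y - f x - (y - x) *m L| <= e * `|y - x|.

Lemma mulmxr_bounded (L : 'M[R]_m) : exists2 C : R, 0 < C & forall v : V, `|v *m L| <= C * `|v|.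
Proof.
have [k k0 h] := @linear_lipschitz R V V (mulmxr L) (@mulmxr_continuous R m L).
by exists k => // v; exact: h.
Qed.

Lemma near_sub (x : V) (P : V -> Prop) : (\forall y \near x, P y) <-> \forall h \near (0 : V), P (h + x).
Proof. by rewrite nbhs0P; split; apply: filterS => y; rewrite addrC. Qed.

Lemma rdiffP (f : V -> V) (x : V) (L : 'M[R]_m) :
  rdiff f x L <-> f \o shift x = cst (f x) + mulmxr L +o_ (0 : V) id.
Proof.
split=> [h|/eqaddoP h e e0].
  apply/eqaddoP => e e0; have /near_sub := h e e0; apply: filterS => y /=.
  rewrite /shift /= addrK => hy; rewrite !fctE /=.
  by move: hy; rewrite opprD addrA.
apply/near_sub; have := h e e0; apply: filterS => y /=.
by rewrite addrK !fctE /= opprD addrA.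
Qed.

Lemma differentiable_rdiff (f : V -> V) x : differentiable f x -> rdiff f x ('J f x).
Proof.
move=> /diff_locally h; apply/rdiffP.
have e : 'd f x = mulmxr ('J f x) :> (V -> V) by apply/funext => v; rewrite /= mul_rV_lin1.
by rewrite -e.
Qed.

Lemma rdiff_jacobi (f : V -> V) x L : rdiff f x L -> jacobi_mx f x = L^T.
Proof.
move=> /rdiffP h; rewrite /jacobi_mx /jacobian; congr (_^T).
have e : 'd f x = mulmxr L :> (V -> V) by apply: diff_unique => //; exact: mulmxr_continuous.
by apply/row_matrixP => i; rewrite !rowE mul_rV_lin1 e.
Qed.

Lemma rdiff_continuous (f : V -> V) (x : V) L : rdiff f x L -> f y @[y --> x] --> f x.
Proof.
move=> h; have [C C0 hC] := mulmxr_bounded L.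
apply/cvg_rowP => e e0.
have C1 : 0 < C + 1 by rewrite addr_gt0.
have h1 := h _ ltr01.
have h2 : \forall y \near x, `|x - y| < e / (C + 1).
  by have /cvg_rowP := @cvg_id _ (nbhs x); apply; rewrite divr_gt0.
apply: nbhs_rowS2 h1 h2 => y h1 h2; rewrite distrC.
rewrite -(subrK ((y - x) *m L) (f y - f x)); apply: (le_lt_trans (ler_normD _ _)).
apply: (le_lt_trans (lerD h1 (hC _))); rewrite -mulrDl addrC -ltr_pdivlMl // mulrC -normrN opprB.
exact: h2.
Qed.

Lemma mx_norm_coord (v : V) i : `|v 0 i| <= `|v|.
Proof. by rewrite [leRHS]mx_normrE; apply: (le_bigmax _ (fun ij => `|v ij.1 ij.2|) (0, i)). Qed.

Lemma int_row_small (v : V) : int_row v -> `|v| < 1 -> v = 0.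
Proof.
move=> iv v1; apply/rowP => i; rewrite mxE.
have /intrP[z ez] := iv i; have := le_lt_trans (mx_norm_coord v i) v1.
by rewrite ez -intr_norm ltrz1 => h; have -> : z = 0 by move: h; case: (z) => [[|]|[|]].
Qed.

(** As a <= 1/2, the term a|h| can be absorbed: |h| <= (2C' + 1)|d|. Inserting this gives |h - L| <=
    a (2C' + 2)|d|. *)
Lemma lip_absorb (a : R) (h d : V) (L : V) (e C' : R) : 2 * a <= 1 -> a * (2 * C' + 2) <= e ->
  0 < a -> `|h - L| <= a * (`|h| + `|d|) -> `|L| <= C' * `|d| -> `|h - L| <= e * `|d|.
Proof.
move=> a1 ae a0 est hL.
have := ler_normB h L; have := ler_normD (h - L) L; rewrite subrK => h1 _.
move: (normr_ge0 h) (normr_ge0 d) (normr_ge0 L) h1 est hL.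
move: `|h - L| `|h| `|d| `|L| => u v w z v0 w0 z0 h1 est hL.
have h2 : v <= (2 * C' + 1) * w by nra.
have h3 : a * (v + w) <= a * ((2 * C' + 2) * w) by rewrite ler_pM2l //; nra.
by rewrite (le_trans est) // (le_trans h3) // mulrA ler_wpM2r.
Qed.

(** F(q(x)) - H(x) is continuous and integral, hence constant near x0, so the increments of F(q) and
    of H agree there. The invertible derivative of F then turns the mere continuity of q into
    differentiability, as in the easy half of the inverse function theorem. *)
Lemma rdiff_lift (F q H : V -> V) (x0 : V) JF G JH : JF *m G = 1%:M ->
  q y @[y --> x0] --> q x0 -> rdiff F (q x0) JF -> rdiff H x0 JH ->
  (\forall x \near x0, int_row (F (q x) - H x)) -> rdiff q x0 (JH *m G).
Proof.
move=> JG qc dF dH int.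
have const : \forall x \near x0, F (q x) - F (q x0) = H x - H x0.
  have c1 : F (q x) - H x @[x --> x0] --> F (q x0) - H x0.
    have cF := rdiff_continuous dF; have cH := rdiff_continuous dH.
    have c0 : F (q x) @[x --> x0] --> F (q x0) by exact: (@cvg_comp _ _ _ _ _ _ _ _ qc cF).
    exact: (@cvgB _ _ _ _ (nbhs_filter x0) _ _ _ _ c0 cH).
  have /cvg_rowP/(_ _ ltr01) c2 := c1.
  have i0 : int_row (F (q x0) - H x0) := @nbhs_singleton _ x0 _ int.
  apply: nbhs_rowS2 int c2 => x ix hx.
  have /eqP : F (q x0) - H x0 - (F (q x) - H x) = 0.
    by apply: int_row_small => //; apply: int_rowD => //; exact: int_rowN.
  rewrite subr_eq0 => /eqP e.
  have aux (a b c : V) : a - b + c - a = c - b by rewrite addrAC (addrC a) addrK addrC.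
  by rewrite -(subrK (H x) (F (q x))) -e aux.
have [C C0 hC] := mulmxr_bounded G.
have [C' C'0 hC'] := mulmxr_bounded (JH *m G).
move=> e e0.
have k0 : 0 < C * (2 * C' + 2) by rewrite mulr_gt0 // addr_gt0 // mulr_gt0.
have k1 : 0 < 2 * C by rewrite mulr_gt0.
(* The first entry makes C e1 <= 1/2, the second C e1 (2C' + 2) <= e: the two hypotheses of
   [lip_absorb]. *)
pose e1 := Num.min (2 * C)^-1 (e / (C * (2 * C' + 2))).
have e10 : 0 < e1 by rewrite lt_min invr_gt0 k1 divr_gt0.
have e1C : 2 * (C * e1) <= 1.
  by rewrite mulrA -ler_pdivlMl // mulr1; by rewrite ge_min lexx.
have e1e : C * e1 * (2 * C' + 2) <= e.
  by rewrite mulrAC -ler_pdivlMl // mulrC; by rewrite ge_min lexx orbT.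
have hF := qc _ (dF _ e10); have hH := dH _ e10.
apply: nbhs_rowS3 const hF hH => x hx hF hH.
have est : `|q x - q x0 - (x - x0) *m (JH *m G)| <= C * e1 * (`|q x - q x0| + `|x - x0|).
  have -> : q x - q x0 - (x - x0) *m (JH *m G) =
    ((H x - H x0 - (x - x0) *m JH) - (F (q x) - F (q x0) - (q x - q x0) *m JF)) *m G.
    have aux (a b c : V) : (a - b) - (a - c) = c - b by rewrite addrAC opprB [a + _]addrC subrK.
    by rewrite hx aux [RHS]mulmxBl -!mulmxA JG mulmx1.
  apply: (le_trans (hC _)); rewrite -mulrA; apply: ler_wpM2l; first exact: ltW.
  apply: (le_trans (ler_normB _ _)).
  by rewrite mulrDr addrC lerD.
apply: lip_absorb e1C e1e _ est (hC' _); exact: mulr_gt0.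
Qed.
End RowDifferential.

Section LocalCover.
Variables (R : realType) (m : nat).
Local Notation V := 'rV[R]_m.
Local Notation B := (borel_rv R m).
Local Notation mu := (@leb R m).

Lemma nbhs_dyadic (N : set V) x : nbhs x N ->
  exists j, forall i, (j <= i)%N -> dyadic i (dyadic_index i x) `<=` N.
Proof.
rewrite nbhsE => -[U [oU Ux] UN]; have [j hj] := open_dyadic oU Ux.
by exists j => i ji; apply: subset_trans (hj _ ji) UN.
Qed.

Lemma dyadic_norm j k (x y : V) : dyadic j k x -> dyadic j k y -> `|x - y| <= 2^-1 ^+ j.
Proof.
move=> hx hy; rewrite [leLHS]mx_normrE; apply: bigmax_le; first exact: exprn_ge0.
by move=> [a i] _ /=; rewrite (ord1 a) !mxE ltW //; exact: dyadic_coord hx hy.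
Qed.

Lemma rdiff_cube_cover (f : V -> V) (x : V) L (N : set V) (eta : R) : nbhs x N ->
  rdiff f x L -> `|\det L| = 1 -> 0 < eta -> exists j W,
    [/\ dyadic j (dyadic_index j x) `<=` N, open W, f @` dyadic j (dyadic_index j x) `<=` W &
      (mu W <= ((1 + 4 * eta) ^+ m)%:E * mu (dyadic j (dyadic_index j x)))%E].
Proof.
move=> Nx df dL eta0; have uL := det_abs1_unit dL.
have [C C0 hC] := mulmxr_bounded (invmx L).
(* [C] bounds the inverse derivative, so the error eta is still respected after its application. *)
have e0 : 0 < eta / C by rewrite divr_gt0.
have [j hj] := nbhs_dyadic (@filterI _ _ (nbhs_filter x) _ _ Nx (df _ e0)).
have {hj} := hj _ (leqnn j).
set Q := dyadic _ _ => hj.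
have Qx : Q x by [].
have hy y : Q y -> forall i, `|((f y - f x) *m invmx L) 0 i - (y 0 i - x 0 i)| <= eta * 2^-1 ^+ j.
  move=> Qy i; have [_ /= hd] := hj _ Qy.
  have e : ((f y - f x) *m invmx L) 0 i - (y 0 i - x 0 i) =
      ((f y - f x - (y - x) *m L) *m invmx L) 0 i.
    have aux (a b : V) : (a - b *m L) *m invmx L = a *m invmx L - b.
      by rewrite mulmxBl -mulmxA mulmxV // mulmx1.
    by rewrite aux; move: (_ *m _) => u; rewrite !mxE.
  rewrite e; apply: (le_trans (mx_norm_coord _ _)); apply: (le_trans (hC _)).
  rewrite -ler_pdivlMl // (le_trans hd) // mulrA [C^-1 * _]mulrC ler_pM2l //.
  exact: (dyadic_norm Qy Qx).
have [W [oW sW mW]] := image_cube_cover (shrinks_det1 (det_abs1_inv dL)) eta0 hy.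
by exists j, W; split => // y Qy; have [] := hj _ Qy.
Qed.

(* [r x] is the set of points to which the point [x] is transported. *)
Lemma transport_measure_le (r : V -> set V) (O X : set V) : measurable (O : set B) ->
  measurable (X : set B) -> (forall y, X y -> exists2 x, O x & r x y) ->
  (forall (eta : R) x, 0 < eta -> O x -> exists j W,
    [/\ dyadic j (dyadic_index j x) `<=` O, measurable (W : set B),
      (forall x' y, dyadic j (dyadic_index j x) x' -> r x' y -> W y) &
      (mu W <= ((1 + 4 * eta) ^+ m)%:E * mu (dyadic j (dyadic_index j x)))%E]) ->
  (mu X <= mu O)%E.
Proof.
move=> mO mX hX hloc; apply: lee_mul_close => // e e0.
have [eta eta0 heta] := @expr_close_1 R m e e0.
have K0 : 0 <= (1 + 4 * eta) ^+ m :> R by rewrite exprn_ge0 // addr_ge0 // mulr_ge0 // ltW.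
have [S [W [SO mW cS sW]]] := @cover_cubes R m O _
  (fun S W => forall x' y, S x' -> r x' y -> W y) K0 (fun x => hloc eta x eta0).
apply: (@le_trans _ _ (((1 + 4 * eta) ^+ m)%:E * mu O)%E); last first.
  by apply: lee_wpmul2r; rewrite ?lee_fin.
apply: (le_trans _ sW); apply: measure_sigma_subadditive => // y /hX[x].
rewrite -SO => -[n _ Snx] rxy; exists n => //.
by have [S0|h] := cS n; [rewrite S0 in Snx|exact: h Snx rxy].
Qed.

End LocalCover.

Section TorusDerivative.
Variables (R : realType) (m : nat).
Local Notation V := 'rV[R]_m.
Local Notation T := (torus R m).
Local Notation tpi := (@torus_pi R m).

Lemma rdiff_inj (f : V -> V) x L L' : rdiff f x L -> rdiff f x L' -> L = L'.
Proof. by move=> /rdiff_jacobi h /rdiff_jacobi; rewrite h => /trmx_inj. Qed.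

Lemma rdiff_mulmxr (f : V -> V) x L M : rdiff f x L -> rdiff (fun y => f y *m M) x (L *m M).
Proof.
move=> h e e0; have [C C0 hC] := mulmxr_bounded M.
have := h _ (divr_gt0 e0 C0); apply: (@filterS _ _ (nbhs_filter x)) => y hy.
rewrite mulmxA -!mulmxBl; apply: (le_trans (hC _)).
by rewrite -ler_pdivlMl // (le_trans hy) // mulrA [C^-1 * _]mulrC.
Qed.

Lemma rdiff_id (x : V) : rdiff id x 1%:M.
Proof.
move=> e e0; apply: (@filterE _ _ (nbhs_filter x)) => y /=.
by rewrite mulmx1 subrr normr0 mulr_ge0 // ltW.
Qed.

(** Independent of the lift by [tdiff_inj]: two differentiable lifts differ near x by a constant
    integral vector. *)
Definition tdiff (u : V -> T) (x : V) (L : 'M[R]_m) := exists2 F : V -> V,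
  (\forall y \near x, u y = tpi (F y)) & rdiff F x L.

Lemma tdiff_inj u x L L' : tdiff u x L -> tdiff u x L' -> L = L'.
Proof.
move=> [F hF dF] [F' hF' dF'].
have : rdiff F x (L' *m 1%:M).
  apply: (rdiff_lift (F := id) (JF := 1%:M) _ (rdiff_continuous dF) (@rdiff_id _) dF').
    by rewrite mulmx1.
  by apply: nbhs_rowS2 hF hF' => y -> /torus_piP.
by rewrite mulmx1; exact: rdiff_inj.
Qed.

Lemma torus_pi_tdiff x : tdiff tpi x 1%:M.
Proof. by exists id; [exact: (@filterE _ _ (nbhs_filter x))|exact: rdiff_id]. Qed.

Lemma tdiff_nbhs u x L (U : set T) : tdiff u x L -> open U -> U (u x) -> nbhs x (u @^-1` U).
Proof.
move=> [F hF dF] /open_torus oU Ux.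
have e : u x = tpi (F x) := @nbhs_singleton _ x _ hF.
have := rdiff_continuous dF (open_nbhs_nbhs (conj oU _)).
rewrite /= -e => /(_ Ux) h.
by apply: nbhs_rowS2 hF h => y /= ->.
Qed.
End TorusDerivative.

(** * Linear symplectomorphisms of the torus *)

Section TorusLinear.
Variables (R : realType) (n : nat).
Local Notation m := (n + n)%N.
Local Notation V := 'rV[R]_m.
Local Notation T := (torus R m).
Local Notation tpi := (@torus_pi R m).

(** Rows are multiplied by the transpose, so that the Jacobi matrix is [A] itself and composition
    corresponds to the product of matrices in the same order. *)
Definition torus_linear (A : 'M[R]_m) (t : T) : T := tpi (generic_quotient.repr t *m A^T).

Lemma torus_linear_pi A x : SpZ A -> torus_linear A (tpi x) = tpi (x *m A^T).
Proof.
move=> [_ iA]; apply/torus_piP; rewrite -mulmxBl; apply: int_rowM; last by move=> i j; rewrite mxE.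
by apply/torus_piP; rewrite /torus_pi generic_quotient.reprK.
Qed.

Lemma torus_linear_comp A B : SpZ A -> SpZ B ->
  torus_linear A \o torus_linear B = torus_linear (A *m B).
Proof.
move=> hA hB; apply/funext => t; have [x <-] := torus_pi_surj t.
by rewrite /= !torus_linear_pi ?trmx_mul ?mulmxA //; exact: SpZM.
Qed.

(** A formula for the inverse without division: integrality of the inverse and its continuity in [A]
    are read off it. *)
Lemma in_Sp_invmx (A : 'M[R]_m) : in_Sp A -> invmx A = - std_symp R n *m A^T *m std_symp R n.
Proof.
move=> sA; have h : (- std_symp R n *m A^T *m std_symp R n) *m A = 1%:M.
  by rewrite -!mulmxA (mulmxA A^T) sA mulNmx std_symp_mul opprK.
by rewrite -[RHS](mulmxK (in_Sp_unit sA)) h mul1mx.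
Qed.

Lemma SpZV (A : 'M[R]_m) : SpZ A -> SpZ (invmx A).
Proof.
move=> [sA iA]; split; first exact: in_SpV.
have iK i j : std_symp R n i j \is a Num.int.
  by rewrite !mxE; case: splitP => a _; rewrite mxE; case: splitP => b _;
     rewrite !mxE ?rpredN ?rpred0 ?rpred_nat.
move=> i j; rewrite in_Sp_invmx // mxE; apply: rpred_sum => k _; apply: rpredM => //.
rewrite mxE; apply: rpred_sum => l _; apply: rpredM; last by rewrite mxE.
by rewrite mxE rpredN.
Qed.

Lemma Cinfty_cst (W : set V) (c : V) : Cinfty W (cst c).
Proof.
move=> k; elim: k c => [|k IH] c /=; first by move=> x _; exact: differentiable_continuous (differentiable_cst _ _).
split=> [x _|v]; first exact: differentiable_cst.
have -> : (fun x => 'D_v (cst c : V -> V) x) = cst 0 by apply/funext => x; exact: derive_cst.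
exact: IH.
Qed.

Lemma Cinfty_mulmxr (W : set V) (M : 'M[R]_m) : Cinfty W (mulmxr M : V -> V).
Proof.
have c := @mulmxr_continuous R m M.
case=> [|k] /=; first by move=> x _; exact: c.
split=> [x _|v]; first exact: linear_differentiable.
have -> : (fun x => 'D_v (mulmxr M : V -> V) x) = cst (v *m M); last exact: Cinfty_cst.
by apply/funext => x; rewrite deriveE ?diff_lin //; exact: linear_differentiable.
Qed.

Lemma torus_linear_symplectic A : SpZ A -> symplectic_on setT (torus_linear A \o tpi).
Proof.
move=> hA x _; exists setT, (mulmxr A^T); split => //.
- by split => //; exact: openT.
- exact: Cinfty_mulmxr.
- by move=> y _; exact: torus_linear_pi.
move=> y _; have d := rdiff_mulmxr (A^T) (@rdiff_id R m y).
by rewrite (rdiff_jacobi d) mul1mx trmxK; case: hA.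
Qed.

Lemma SpZ_unit (A : 'M[R]_m) : SpZ A -> A \in unitmx.
Proof. by move=> [/in_Sp_unit]. Qed.

Lemma torus_linear1 : torus_linear 1%:M = id.
Proof. by apply/funext => t; rewrite /torus_linear trmx1 mulmx1 /torus_pi generic_quotient.reprK. Qed.

Lemma torus_linearK A : SpZ A -> cancel (torus_linear A) (torus_linear (invmx A)).
Proof.
move=> hA t; have /(congr1 (fun f => f t)) := torus_linear_comp (SpZV hA) hA.
by rewrite mulVmx ?SpZ_unit // torus_linear1.
Qed.

Lemma torus_linear_Symp A : SpZ A -> @Symp R n (torus_linear A).
Proof.
move=> hA; split; first exact: torus_linear_symplectic.
exists (torus_linear (invmx A)); split; [exact: torus_linearK| |].
  by move=> t; have := torus_linearK (SpZV hA) t; rewrite invmxK.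
by apply: torus_linear_symplectic; exact: SpZV.
Qed.
End TorusLinear.

(** * A symplectic chart preserves volume *)

Section Chart.
Variables (R : realType) (n : nat).
Local Notation m := (n + n)%N.
Local Notation V := 'rV[R]_m.
Local Notation B := (borel_rv R m).
Local Notation T := (torus R m).
Local Notation mu := (@leb R m).
Local Notation tpi := (@torus_pi R m).
Variables (Omega : set V) (iota : V -> T).
Hypotheses (oOmega : open Omega) (hiota : symplectic_embedding Omega iota).

Local Notation psi := (pinv Omega iota).

(** The transpose of the Jacobi matrix P(y) of the chart. It is chosen from the relation [tdiff],
    with junk value 0 where no derivative exists. *)
Definition dchart (y : V) : 'M[R]_m := xget 0 [set L | tdiff iota y L].

Lemma tdiff_symplectic U (f : V -> T) : symplectic_on U f -> forall x, U x ->
  exists W (F : V -> V), [/\ open W, W x /\ W `<=` U, Cinfty W F &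
    forall y, W y -> tdiff f y ('J F y) /\ in_Sp ('J F y)^T].
Proof.
move=> hf x Ux; have [W [F [[oW Wx] WU cF fF sF]]] := hf x Ux.
exists W, F; split => // y Wy; split; last exact: sF.
have Wn : nbhs y W by exact: open_nbhs_nbhs.
exists F; first exact: (@filterS _ _ (nbhs_filter y)) Wn.
by apply: differentiable_rdiff; have [+ _] := cF 1; apply.
Qed.

Lemma dchart_tdiff y : Omega y -> tdiff iota y (dchart y).
Proof.
case: hiota => h _ _ Oy; have [W [F [_ [Wy _] _ hF]]] := tdiff_symplectic h Oy.
by apply: (@xgetPex _ 0 [set L | tdiff iota y L]); exists ('J F y); have [] := hF _ Wy.
Qed.

Lemma dchart_Sp y : Omega y -> in_Sp (dchart y)^T.
Proof.
case: (hiota) => h _ _ Oy; have [W [F [_ [Wy _] _ hF]]] := tdiff_symplectic h Oy.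
by have [d s] := hF _ Wy; rewrite (tdiff_inj (dchart_tdiff Oy) d).
Qed.

(** Near x the entries are partial derivatives of one smooth local lift. *)
Lemma dchart_continuous x i j : Omega x -> dchart y i j @[y --> x] --> dchart x i j.
Proof.
case: (hiota) => h _ _ Ox; have [W [F [oW [Wx WO] cF hF]]] := tdiff_symplectic h Ox.
have [dF cD] := cF 1; have {}cD := cD (delta_mx 0 i) x Wx.
have e y : W y -> dchart y i j = ('D_(delta_mx 0 i) F y) 0 j.
  move=> Wy; have Oy : Omega y by exact: WO.
  have [d _] := hF _ Wy; rewrite (tdiff_inj (dchart_tdiff Oy) d) deriveE; last exact: dF.
  by rewrite /jacobian mxE.
rewrite (e _ Wx).
have c : ('D_(delta_mx 0 i) F y) 0 j @[y --> x] --> ('D_(delta_mx 0 i) F x) 0 j.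
  exact: (@cvg_comp _ _ _ _ _ _ _ _ cD (@coord_continuous R 1 m 0 j _)).
have We : nbhs x W by exact: open_nbhs_nbhs.
move=> N /c; apply: nbhs_rowS2 We => y Wy /=.
by rewrite e.
Qed.

Lemma dchart_det y : Omega y -> `|\det (dchart y)| = 1.
Proof. by move=> Oy; rewrite -det_tr; apply: in_Sp_det; exact: dchart_Sp. Qed.

Lemma pinv_iota x : Omega x -> psi (iota x) = x.
Proof. by case: hiota => _ inj _ Ox; exact: (pinvKV _ inj (mem_set Ox)). Qed.

Lemma pinv_image t : (iota @` Omega) t -> Omega (psi t) /\ iota (psi t) = t.
Proof.
move=> ht; split; last by apply: pinvK; exact: mem_set.
by case: ht => x Ox <-; rewrite pinv_iota.
Qed.

Lemma iota_open O : open O -> O `<=` Omega -> open (iota @` O).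
Proof. by case: hiota => _ _; apply. Qed.

(** The inverse chart is continuous because [iota] maps open subsets of [Omega] to open sets. *)
Lemma pinv_continuous u x L : tdiff u x L -> (iota @` Omega) (u x) ->
  psi (u y) @[y --> x] --> psi (u x).
Proof.
move=> du ux; have [Op ip] := pinv_image ux => N.
rewrite nbhsE => -[U [oU Up] UN].
have oi : open (iota @` (U `&` Omega)) by apply: iota_open; [exact: openI|exact: subIsetr].
have ui : (iota @` (U `&` Omega)) (u x) by exists (psi (u x)).
have h := tdiff_nbhs du oi ui.
apply: (@filterS _ _ (nbhs_filter x) _ _ _ h) => y [z [Uz Oz] zu].
by rewrite /= -zu pinv_iota //; exact: UN.
Qed.

Lemma pinv_tdiff u x L : tdiff u x L -> (iota @` Omega) (u x) ->
  rdiff (fun y => psi (u y)) x (L *m invmx (dchart (psi (u x)))).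
Proof.
move=> du ux; have [Op ip] := pinv_image ux.
have qc := pinv_continuous du ux.
have [F hF dF] := dchart_tdiff Op; have [H hH dH] := du.
apply: (rdiff_lift _ qc dF dH).
  by apply: mulmxV; apply: det_abs1_unit; exact: dchart_det.
have hi := tdiff_nbhs du (iota_open oOmega (@subset_refl _ Omega)) ux.
have hF' := qc _ hF.
apply: nbhs_rowS3 hi hF' hH => y /pinv_image[_ iy] /= hy hy'.
by apply/torus_piP; rewrite -hy iy.
Qed.

Local Notation cube := (@unit_cube R m).
(** The volume of iota(O) in the torus, measured on the fundamental domain. *)
Local Notation lam O := (mu (cube `&` tpi @^-1` (iota @` O))).

Lemma preimage_open O : open O -> O `<=` Omega -> open (tpi @^-1` (iota @` O)).
Proof. by move=> oO /(iota_open oO)/open_torus. Qed.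

Lemma preimage_borel O : open O -> O `<=` Omega ->
  measurable (cube `&` tpi @^-1` (iota @` O) : set B).
Proof.
move=> oO sO; apply: measurableI; first exact: unit_cube_borel.
by apply: open_borel; exact: preimage_open.
Qed.

(** A local lift of the chart has derivative of determinant +-1, so it sends small cubes into sets
    [W] of almost the same volume. Saturating [W] and cutting it back to the unit cube does not
    increase the volume. *)
Lemma lam_le O : open O -> O `<=` Omega -> (lam O <= mu O)%E.
Proof.
move=> oO sO; apply: (@transport_measure_le R m (fun x => [set y | cube y /\ tpi y = iota x])).
- exact: open_borel.
- exact: preimage_borel.
- by move=> y [cy [x Ox e]]; exists x.
move=> eta x eta0 Ox; have [F hF dF] := dchart_tdiff (sO _ Ox).
have Nx : nbhs x (O `&` [set y | iota y = tpi (F y)]).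
  by apply: (@filterI _ _ (nbhs_filter x)) => //; exact: open_nbhs_nbhs.
have [j [W [sN oW FW mW]]] := rdiff_cube_cover Nx dF (dchart_det (sO _ Ox)) eta0.
have mW' := open_borel oW.
exists j, (cube `&` sat W); split.
- by move=> y /sN[].
- by apply: measurableI; [exact: unit_cube_borel|exact: sat_borel].
- move=> x' y Qx' [cy yx']; split => //; have [_ /= e] := sN _ Qx'.
  by rewrite /sat /= yx' e; exists (F x') => //; apply: FW; exists x'.
- by apply: (le_trans _ mW); exact: sat_measure_le.
Qed.

(** The transport in the other direction, by the inverse chart after the projection; its derivative
    is inverse to that of the chart, so it too hardly enlarges small cubes. *)
Lemma le_lam O : open O -> O `<=` Omega -> (mu O <= lam O)%E.
Proof.
move=> oO sO; apply: (@transport_measure_le R m (fun y => [set x | x = psi (tpi y)])).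
- exact: preimage_borel.
- exact: open_borel.
- move=> x Ox; have [z zx] := torus_pi_surj (iota x).
  exists (frac z); last by rewrite /= torus_pi_frac zx pinv_iota //; exact: sO.
  by split; [exact: frac_unit_cube|rewrite /= torus_pi_frac zx; exists x].
move=> eta y eta0 [cy [x Ox xy]].
have yO : (iota @` Omega) (tpi y) by rewrite -xy; exists x => //; exact: sO.
have [Op _] := pinv_image yO.
have Ny : nbhs y (tpi @^-1` (iota @` O)).
  by apply: open_nbhs_nbhs; split; [exact: preimage_open|exists x].
have dpsi := pinv_tdiff (@torus_pi_tdiff R m y) yO.
have [|j [W [sN oW FW mW]]] := rdiff_cube_cover Ny dpsi _ eta0.
  by rewrite mul1mx; apply: det_abs1_inv; exact: dchart_det.
exists j, W; split => //.
- move=> y' Qy'; split; last exact: sN.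
  (* The unit cube is itself the dyadic cube of scale 0, so it contains every dyadic cube that meets
     it. *)
  by rewrite /unit_cube /dyadic /= -cy; exact: dyadic_index_nested Qy'.
- exact: open_borel.
- by move=> y' z Qy' ->; apply: FW; exists y'.
Qed.

Lemma lam_measure O : open O -> O `<=` Omega -> lam O = mu O.
Proof. by move=> oO sO; apply/eqP; rewrite eq_le lam_le // le_lam. Qed.

End Chart.

(** * The action of Sp(2n, Z) read in the chart *)

Section Action.
Variables (R : realType) (n : nat).
Local Notation m := (n + n)%N.
Local Notation V := 'rV[R]_m.
Local Notation B := (borel_rv R m).
Local Notation T := (torus R m).
Local Notation mu := (@leb R m).
Local Notation tpi := (@torus_pi R m).
Local Notation cube := (@unit_cube R m).
Variables (Omega : set V) (iota : V -> T).
Hypotheses (oOmega : open Omega) (hiota : symplectic_embedding Omega iota).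
Hypothesis hfull : torus_null (~` (iota @` Omega)).

Local Notation Q x := ((dchart iota x)^T).
Local Notation q A := (in_chart Omega iota (torus_linear A)).

(** The points that q_A maps into [O]. For O = Omega it is the domain on which q_A is meaningful;
    elsewhere the inverse chart has a junk value. *)
Definition transfer (A : 'M[R]_m) (O : set V) : set V :=
  [set x | Omega x /\ (iota @` O) (torus_linear A (iota x))].

Lemma transfer_tdiff A x : SpZ A -> Omega x ->
  tdiff (torus_linear A \o iota) x (dchart iota x *m A^T).
Proof.
move=> hA Ox; have [F hF dF] := dchart_tdiff hiota Ox.
exists (fun y => F y *m A^T); last exact: rdiff_mulmxr.
by apply: (@filterS _ _ (nbhs_filter x) _ _ _ hF) => y /= ->; exact: torus_linear_pi.
Qed.

Lemma transfer_open A O : SpZ A -> open O -> O `<=` Omega -> open (transfer A O).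
Proof.
move=> hA oO sO; apply: open_of_nbhs => x [Ox Oax].
have h := tdiff_nbhs (transfer_tdiff hA Ox) (iota_open hiota oO sO) Oax.
have hO : nbhs x Omega by exact: open_nbhs_nbhs.
by apply: nbhs_rowS2 h hO.
Qed.

Lemma transferE A O x : O `<=` Omega ->
  transfer A O x <-> transfer A Omega x /\ O (q A x).
Proof.
move=> sO; split=> [[Ox [z Oz e]]|[[Ox h] Oq]].
  split; first by split => //; exists z => //; exact: sO.
  by rewrite /in_chart /= -e (pinv_iota hiota) //; exact: sO.
by split => //; exists (q A x) => //; have [] := pinv_image hiota h.
Qed.

Lemma transfer_rdiff A x : SpZ A -> transfer A Omega x ->
  rdiff (q A) x (dchart iota x *m A^T *m invmx (dchart iota (q A x))).
Proof. by move=> hA [Ox h]; exact: (pinv_tdiff oOmega hiota (transfer_tdiff hA Ox)). Qed.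

Lemma transfer_jacobi A x : SpZ A -> transfer A Omega x ->
  jacobi_mx (q A) x = invmx (Q (q A x)) *m A *m Q x.
Proof.
move=> hA hx; rewrite (rdiff_jacobi (transfer_rdiff hA hx)).
by rewrite !trmx_mul trmx_inv trmxK mulmxA.
Qed.

Lemma transfer_comp A B x : SpZ A -> SpZ B -> transfer B Omega x ->
  transfer A Omega (q B x) -> transfer (A *m B) Omega x /\ q (A *m B) x = q A (q B x).
Proof.
move=> hA hB [Ox h] [Oq h2]; have [_ iq] := pinv_image hiota h.
have e : torus_linear (A *m B) (iota x) = torus_linear A (iota (q B x)).
  by rewrite -torus_linear_comp //= /in_chart /= iq.
by split; [split => //; rewrite e|rewrite /in_chart /= e].
Qed.

Local Notation Y := (tpi @^-1` (iota @` Omega)).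

Lemma chart_conull : mu (~` Y) = 0%E.
Proof.
have oY := preimage_open hiota oOmega (@subset_refl _ Omega).
have mY : measurable (~` Y : set B) by apply: measurableC; exact: open_borel.
have mS : measurable (@row_of_tuple R m @^-1` (~` Y)).
  by rewrite -[X in measurable X]setTI; exact: row_of_tuple_measurable.
exact: (@negligibleP _ _ _ (lebesgue_tuple m) _ mS).1 hfull.
Qed.

Lemma chart_conullI (X : set V) : measurable (X : set B) -> mu (X `&` Y) = mu X.
Proof.
move=> mX; have oY := preimage_open hiota oOmega (@subset_refl _ Omega).
have mY : measurable (Y : set B) by exact: open_borel.
have mXY : measurable (X `&` Y : set B) by exact: measurableI.
apply/eqP; rewrite eq_le; apply/andP; split.
  by apply: le_measure; [exact: mem_set|exact: mem_set|exact: subIsetl].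
have mC : measurable (~` Y : set B) by exact: measurableC.
apply: (@le_trans _ _ (mu ((X `&` Y) `|` ~` Y))).
  apply: le_measure; [exact: mem_set|by apply: mem_set; exact: measurableU|].
  by move=> x Xx; case: (pselect (Y x)) => h; [left|right].
apply: (le_trans (measureU2 _ mXY mC)).
have e (a b : \bar R) : b = 0%E -> (a + b <= a)%E by move=> ->; rewrite adde0.
exact: (e _ _ chart_conull).
Qed.

Lemma chart_measure : mu Omega = 1%E.
Proof.
rewrite -(lam_measure oOmega hiota oOmega) // chart_conullI ?unit_cube_measure //.
exact: unit_cube_borel.
Qed.

(** By [lam_measure] both volumes can be computed on the torus. Up to a null set they are the parts
    in the unit cube of a periodic set and of its preimage under the integral matrix;
    [periodic_linear_le] for [A] and for its inverse compares them. *)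
Lemma transfer_measure A O : SpZ A -> open O -> O `<=` Omega -> mu (transfer A O) = mu O.
Proof.
move=> hA oO sO; have oT := transfer_open hA oO sO.
rewrite -(lam_measure oOmega hiota oT) => [|x []//].
rewrite -(lam_measure oOmega hiota oO) //.
set E := tpi @^-1` (iota @` O).
have oE : open E := preimage_open hiota oO sO.
have mE : measurable (E : set B) by exact: open_borel.
have linE (M : 'M[R]_m) : measurable ([set x | E (x *m M)] : set B).
  by apply: (@continuous_borel_preimage R m (fun x => x *m M)) => //; exact: mulmxr_continuous.
have -> : tpi @^-1` (iota @` transfer A O) = [set x | E (x *m A^T)] `&` Y.
  apply/seteqP; split=> x /=.
    move=> [z [Oz h] e]; split; last by exists z.
    by rewrite /E /= -torus_linear_pi // -e.
  move=> [h [z Oz e]]; exists z => //; split => //.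
  by rewrite e torus_linear_pi.
have mC : measurable (cube `&` [set x | E (x *m A^T)] : set B).
  by apply: measurableI => //; exact: unit_cube_borel.
rewrite setIA chart_conullI //.
have dA : `|\det A^T| = 1 by rewrite det_tr; apply: in_Sp_det; case: hA.
have dV : `|\det (invmx A)^T| = 1 by rewrite det_tr; apply: in_Sp_det; case: (SpZV hA).
have AV : A^T *m (invmx A)^T = 1%:M by rewrite -trmx_mul mulVmx ?trmx1 ?SpZ_unit.
have VA : (invmx A)^T *m A^T = 1%:M by exact: mulmx1C.
have iA i j : A^T i j \is a Num.int by rewrite mxE; case: hA.
have iV i j : (invmx A)^T i j \is a Num.int by rewrite mxE; case: (SpZV hA).
have pE x v : int_row v -> E x -> E (x + v) by move=> iv; rewrite /E /= torus_piDint.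
apply/eqP; rewrite eq_le; apply/andP; split.
  exact: (periodic_linear_le AV dA).
have := @periodic_linear_le R m (invmx A)^T A^T [set x | E (x *m A^T)] VA dV iA (linE _).
have -> : [set x | [set x | E (x *m A^T)] (x *m (invmx A)^T)] = E.
  by apply/seteqP; split=> x /=; rewrite -mulmxA VA mulmx1.
apply => x v iv /= h; rewrite mulmxDl; apply: pE => //; exact: int_rowM.
Qed.

End Action.

(** * Integration of the cocycle *)

Section NullSets.
Import HBNNSimple.
Context d (T : measurableType d) (R : realType) (mu : {measure set T -> \bar R}).
Local Open Scope ereal_scope.

Lemma sintegral_null (h : {nnsfun T >-> R}) (N : set T) (mN : measurable N) : mu N = 0 ->
  sintegral mu h = sintegral mu (proj_nnsfun h (measurableC mN)).
Proof.
move=> N0; rewrite -!integralT_nnsfun.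
rewrite (ge0_negligible_integral mN _ _ _ N0) //=; last 2 first.
- exact/measurable_EFinP.
- by move=> x _; rewrite lee_fin.
rewrite setTD integral_mkcond; apply: eq_integral => x _; rewrite /= /patch.
by rewrite /= /mindic indicE; case: (x \in _); rewrite ?mulr1 ?mulr0.
Qed.

(* No measurability of the integrands is assumed. *)
Lemma eq_integral_null (D N : set T) (f g : T -> \bar R) : measurable N -> mu N = 0 ->
  (forall x, D x -> ~ N x -> f x = g x) ->
  \int[mu]_(x in D) f x = \int[mu]_(x in D) g x.
Proof.
move=> mN N0 fg.
(* The integral is a supremum over simple functions, and cutting a simple function off to the
   complement of [N] does not change its integral. *)
have le (u v : T -> \bar R) : (forall x, 0 <= v x) -> (forall x, ~ N x -> u x = v x) ->
    ereal_sup [set sintegral mu h | h in [set h : {nnsfun T >-> R} | forall x, (h x)%:E <= u x]] <=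
    ereal_sup [set sintegral mu h | h in [set h : {nnsfun T >-> R} | forall x, (h x)%:E <= v x]].
  move=> v0 uv; apply: ge_ereal_sup => _ [h hu <-]; rewrite (sintegral_null h mN N0).
  apply: ereal_sup_ubound; exists (proj_nnsfun h (measurableC mN)) => // x /=.
  rewrite /mindic indicE; case: (boolP (x \in ~` N)) => xN; last by rewrite mulr0.
  have Nx : ~ N x := set_mem xN.
  by rewrite mulr1 -uv.
have eq (u v : T -> \bar R) : (forall x, 0 <= u x) -> (forall x, 0 <= v x) ->
    (forall x, ~ N x -> u x = v x) ->
    ereal_sup [set sintegral mu h | h in [set h : {nnsfun T >-> R} | forall x, (h x)%:E <= u x]] =
    ereal_sup [set sintegral mu h | h in [set h : {nnsfun T >-> R} | forall x, (h x)%:E <= v x]].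
  by move=> u0 v0 uv; apply/eqP; rewrite eq_le !le // => x /uv.
have e x : ~ N x -> (f \_ D) x = (g \_ D) x.
  by move=> Nx; rewrite /patch; case: ifPn => // /set_mem Dx; exact: fg.
by rewrite /integral; congr (_ - _); apply: eq => // x Nx;
  rewrite ?funeposE ?funenegE e.
Qed.

End NullSets.

Lemma bounded_integrable d (T : measurableType d) (R : realType)
    (mu : {measure set T -> \bar R}) (D : set T) (f : T -> R) (K : R) :
  measurable D -> (mu D < +oo)%E -> measurable_fun D f -> (forall x, D x -> `|f x| <= K) ->
  mu.-integrable D (EFin \o f).
Proof.
move=> mD Doo mf fK; apply: measurable_bounded_integrable => //.
exists K; split; first exact: num_real.
by move=> M KM x Dx /=; apply: (le_trans (fK x Dx)); exact: ltW.
Qed.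

(** The measures are compared on subsets of [S] only, so [f] is first extended by 0 off [S]. *)
Lemma Rintegral_transfer d1 d2 (X : measurableType d1) (Y : measurableType d2) (R : realType)
    (phi : X -> Y) (mu : {measure set X -> \bar R}) (nu : {measure set Y -> \bar R})
    (S : set Y) (f : Y -> R) (K : R) :
  measurable_fun setT phi -> measurable S -> (nu S < +oo)%E -> measurable_fun S f ->
  (forall y, S y -> `|f y| <= K) ->
  (forall A, measurable A -> A `<=` S -> mu (phi @^-1` A) = nu A) ->
  \int[mu]_(x in phi @^-1` S) f (phi x) = \int[nu]_(y in S) f y.
Proof.
move=> mphi mS Soo mf fK munu; rewrite /Rintegral; congr fine.
pose g : Y -> \bar R := (EFin \o f) \_ S.
have mg : measurable_fun setT g by apply/(measurable_restrictT _ mS); exact/measurable_EFinP.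
have mpS : measurable (phi @^-1` S) by rewrite -[X in measurable X]setTI; exact: mphi.
have eg y : S y -> g y = (f y)%:E by move=> Sy; rewrite /g /patch mem_set.
have K0 y : S y -> 0 <= K by move=> /fK; exact: le_trans.
have ig : mu.-integrable (phi @^-1` S) (g \o phi).
  apply: (@eq_integrable _ _ _ _ _ mpS (EFin \o (f \o phi))).
    by move=> x /set_mem Sx; rewrite /= eg.
  apply: (@bounded_integrable _ _ _ _ _ _ K) => //.
  - by rewrite [X in (X < _)%E]munu.
  - apply: (measurable_comp mS) => //; first by move=> _ [x Sx <-].
    exact: measurable_funS mphi.
  - by move=> x; exact: fK.
transitivity (\int[mu]_(x in phi @^-1` S) (g \o phi) x)%E.
  by apply: eq_integral => x /set_mem Sx; rewrite /= eg.
rewrite -(integral_pushforward mphi mg ig mS).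
apply: (etrans (eq_measure_integral nu _)) => [A mA AS|]; first exact: munu.
by apply: eq_integral => y /set_mem Sy; rewrite eg.
Qed.

Lemma borel_open_unique (R : realType) (m : nat) (mu nu : {measure set (borel_rv R m) -> \bar R})
    (S E : set 'rV[R]_m) : open S -> (mu S < +oo)%E ->
  (forall O, open O -> nu (O `&` S) = mu (O `&` S)) ->
  measurable (E : set (borel_rv R m)) -> E `<=` S -> nu E = mu E.
Proof.
move=> oS Soo h mE ES; have mS : measurable (S : set (borel_rv R m)) by exact: open_borel.
have -> : E = E `&` S by apply/seteqP; split=> [x Ex|x []//]; split => //; exact: ES.
apply: (@measure_unique _ R (borel_rv R m) (@open 'rV[R]_m) (fun=> setT) erefl _ _ _
  (mrestr nu mS) (mrestr mu mS)) => //.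
- by move=> X Y oX oY; exact: openI.
- by move=> _; exact: openT.
- by apply/seteqP; split => // x _; exists 0%N.
- move=> _; have e : nu (setT `&` S) = mu S := etrans (h _ openT) (congr1 mu (setTI S)).
  by rewrite -e in Soo; exact: Soo.
Qed.

(** * Change of variables by the action *)

Section ChartIntegral.
Variables (R : realType) (n : nat).
Local Notation m := (n + n)%N.
Local Notation V := 'rV[R]_m.
Local Notation B := (borel_rv R m).
Local Notation T := (torus R m).
Local Notation mu := (@leb R m).
Variables (Omega : set V) (iota : V -> T).
Hypotheses (n0 : (0 < n)%N) (oOmega : open Omega) (hiota : symplectic_embedding Omega iota).
Hypothesis hfull : torus_null (~` (iota @` Omega)).

Local Notation q A := (in_chart Omega iota (torus_linear A)).
Local Notation transfer := (transfer Omega iota).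

(** [Omega] has volume 1, whereas the open cube of side 2 has volume 2^(2n). The point found serves
    as a dummy value in [phi]. *)
Lemma chart_proper : exists z, ~ Omega z.
Proof.
apply: contrapT => h; have OT : Omega = setT.
  by apply/seteqP; split=> // x _; apply: contrapT => hx; apply: h; exists x.
have := chart_measure oOmega hiota hfull; rewrite OT => m1.
have oc := @cbox_open R m 0 1.
have : (mu (cbox 0 1) <= mu [set: V])%E.
  by apply: le_measure; [apply: mem_set; exact: open_borel|apply: mem_set; exact: measurableT|].
rewrite m1 cbox_measure // lee_fin mulr1 leNgt => /negP; apply.
by rewrite exprn_egt1 ?ltr1n // -lt0n addn_gt0 n0.
Qed.

Section Preservation.
Variables (A : 'M[R]_m) (S : set V) (z : V).
Hypotheses (hA : SpZ A) (oS : open S) (sS : S `<=` Omega) (hz : ~ Omega z).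

Let D := transfer A S.
(** A total version of q_A. Points outside the domain go to [z], which is not in [Omega], so they
    enter no preimage of a subset of [S]. *)
Let phi (x : V) : V := if pselect (D x) then q A x else z.

Let phi_preimage (E : set V) : phi @^-1` (E `&` S) = transfer A (E `&` S).
Proof.
have sES : E `&` S `<=` Omega by move=> x [_ /sS].
apply/seteqP; split=> x /=; rewrite /phi; case: pselect => Dx.
- move=> h; have [Dx' _] := (transferE hiota A x sS).1 Dx.
  exact: (transferE hiota A x sES).2 (conj Dx' h).
- by move=> [_ /sS].
- by move=> /(transferE hiota A x sES)[].
- move=> /(transferE hiota A x sES)[h [_ Sq]]; case: Dx.
  exact: (transferE hiota A x sS).2 (conj h Sq).
Qed.

Let phi_measurable : measurable_fun setT (phi : B -> B).
Proof.
have oD : open D := transfer_open oOmega hiota hA oS sS.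
apply: (@measurability _ _ _ B setT _ (@open V) erefl) => _ [U oU <-].
(* Off [D] the map is constant, so the complement of [D] enters the preimage as a whole or not at
   all. *)
rewrite setTI (_ : phi @^-1` U = transfer A (U `&` S) `|` ((~` D) `&` [set _ | U z])).
  apply: measurableU.
    by apply: open_borel; apply: transfer_open => //; [exact: openI|move=> x [_ /sS]].
  apply: measurableI; first by apply: measurableC; exact: open_borel.
  case: (pselect (U z)) => h.
    by rewrite (_ : [set _ | U z] = setT) //; apply/seteqP; split.
  by rewrite (_ : [set _ | U z] = set0) //; apply/seteqP; split.
have sES : U `&` S `<=` Omega by move=> x [_ /sS].
apply/seteqP; split=> x /=; rewrite /phi; case: pselect => Dx.
- move=> h; left; have [Dx' Sq] := (transferE hiota A x sS).1 Dx.
  exact: (transferE hiota A x sES).2 (conj Dx' (conj h Sq)).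
- by move=> h; right.
- by move=> [/(transferE hiota A x sES)[_ []]//|[]].
- move=> [/(transferE hiota A x sES)[h [_ Sq]]|[]//]; case: Dx.
  exact: (transferE hiota A x sS).2 (conj h Sq).
Qed.

Let mS : measurable (S : set B). Proof. exact: open_borel. Qed.

Let Sfin : (mu S < +oo)%E.
Proof.
apply: (@le_lt_trans _ _ (mu Omega)); last by rewrite (chart_measure oOmega hiota hfull) ltry.
by apply: le_measure => //; apply: mem_set; exact: open_borel.
Qed.

Let phi_measure (E : set B) : measurable E -> E `<=` S -> mu (phi @^-1` E) = mu E.
Proof.
apply: (@borel_open_unique R m mu (pushforward mu (phi : B -> B)) S E oS Sfin) => // O oO.
have OS : O `&` S `<=` Omega by move=> x [_ /sS].
have e : mu (phi @^-1` (O `&` S)) = mu (O `&` S).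
  by rewrite phi_preimage (transfer_measure oOmega hiota hfull) //; exact: openI.
exact: e.
Qed.

Lemma Rintegral_action (f : V -> R) (K : R) : measurable_fun (S : set B) f ->
  (forall x, S x -> `|f x| <= K) ->
  \int[mu]_(x in transfer A S) f (q A x) = \int[mu]_(x in S) f x.
Proof.
move=> mf fK; transitivity (\int[mu]_(x in phi @^-1` S) f (phi x)).
  have -> : phi @^-1` S = transfer A S by have := phi_preimage S; rewrite setIid.
  by apply: eq_Rintegral => x /set_mem Dx; rewrite /phi; case: pselect.
exact: (@Rintegral_transfer _ _ B B R phi mu mu S f K phi_measurable mS Sfin mf fK phi_measure).
Qed.
End Preservation.

(** Replaces the integral of the statement, whose integrand may be junk on a null set, by an
    integral over the good open set [D]; nothing is assumed of [F] off [D]. *)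
Lemma lebesgue_Rintegral_chart (D : set V) (F F0 : V -> R) (K : R) : open D -> D `<=` Omega ->
  mu D = 1%E -> (forall x, D x -> F x = F0 x) -> measurable_fun (D : set B) F0 ->
  (forall x, D x -> `|F0 x| <= K) -> lebesgue_Rintegral Omega F = \int[mu]_(x in D) F0 x.
Proof.
move=> oD sD D1 FF mF FK.
have Dfin : (mu D < +oo)%E by rewrite D1 ltry.
pose row := @row_of_tuple R m.
have mrow (E : set V) : measurable (E : set B) -> measurable (row @^-1` E).
  by move=> mE; rewrite -[X in measurable X]setTI; exact: row_of_tuple_measurable.
have mD : measurable (D : set B) by exact: open_borel.
have mO : measurable (Omega : set B) by exact: open_borel.
have mDc : measurable (Omega `\` D : set B) by exact: measurableD.
have N0 : lebesgue_tuple m (row @^-1` (Omega `\` D)) = 0%E.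
  have O1 := chart_measure oOmega hiota hfull.
  have Ofin : (mu Omega < +oo)%E by rewrite O1 ltry.
  have e1 : mu (Omega `&` D) = 1%E by rewrite (setIidr sD).
  have sub (a b : \bar R) : a = 1%E -> b = 1%E -> (a - b = 0)%E by move=> -> ->; exact: subee.
  exact: (etrans (measureD mO mD Ofin) (sub _ _ O1 e1)).
rewrite -(@Rintegral_transfer _ _ _ B R row (lebesgue_tuple m) mu D F0 K) //.
- rewrite /lebesgue_Rintegral /Rintegral; congr fine.
  have -> : row @^-1` D = row @^-1` Omega `&` row @^-1` D.
    by apply/seteqP; split=> [t Dt|t []//]; split => //; exact: sD.
  rewrite integral_mkcondr; apply: (@eq_integral_null _ _ _ (lebesgue_tuple m) _ (row @^-1` (Omega `\` D))).
  + exact: mrow.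
  + exact: N0.
  move=> t Ot nN; have Dt : D (row t) by apply: contrapT => h; apply: nN.
  by rewrite /patch mem_set //= FF.
- exact: row_of_tuple_measurable.
Qed.

End ChartIntegral.

Section EntrywiseContinuity.
Variables (R : realType) (k : nat).
Local Notation V := 'rV[R]_k.

Definition econt (p r : nat) (F : V -> 'M[R]_(p, r)) (x : V) :=
  forall i j, F y i j @[y --> x] --> F x i j.

Lemma econt_cst p r (M : 'M[R]_(p, r)) x : econt (fun=> M) x.
Proof. by move=> i j; exact: (@cvg_cst _ _ _ (nbhs x) (nbhs_filter x)). Qed.

Lemma econt_tr p r (F : V -> 'M[R]_(p, r)) x : econt F x -> econt (fun y => (F y)^T) x.
Proof.
move=> h i j; rewrite mxE (_ : (fun y => (F y)^T i j) = (fun y => F y j i)); first exact: h.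
by apply/funext => y; rewrite mxE.
Qed.

Lemma econt_mul p r s (F : V -> 'M[R]_(p, r)) (G : V -> 'M[R]_(r, s)) x :
  econt F x -> econt G x -> econt (fun y => F y *m G y) x.
Proof.
move=> hF hG i j; rewrite mxE.
rewrite (_ : (fun y => (F y *m G y) i j) = (fun y => \sum_l F y i l * G y l j)); last first.
  by apply/funext => y; rewrite mxE.
apply: (@cvg_big _ _ _ _ _ _ _ (nbhs x) _ _ _ (nbhs_filter x)); first exact: add_continuous.
by move=> l _; apply: (@cvgM _ _ (nbhs x) (nbhs_filter x)); [exact: hF|exact: hG].
Qed.

Lemma econt_near p r (F G : V -> 'M[R]_(p, r)) x : (\forall y \near x, F y = G y) ->
  econt G x -> econt F x.
Proof.
move=> h hG i j; have e : F x = G x := @nbhs_singleton _ x _ h.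
rewrite e => N /(hG i j); apply: nbhs_rowS2 h => y /= FG.
by rewrite FG.
Qed.
End EntrywiseContinuity.

(** * The integrand is c up to a coboundary *)

Section ChartCoboundary.
Variables (R : realType) (n : nat).
Local Notation m := (n + n)%N.
Local Notation V := 'rV[R]_m.
Local Notation T := (torus R m).

Local Notation c := (@berezin R n).

Let cocycle_aux (aAP X aADz APY AP ADz PY Pp oDz pDz oo AD ADz' Dz : R) :
  aAP + X = aADz + APY -> AP + APY = ADz + PY -> Pp + oDz = PY + pDz -> oo + oDz = oDz + oDz ->
  AD + ADz' = ADz + Dz ->
  X = AD + (ADz' + aADz) - (AP + aAP - Pp - oo) - (Dz + pDz).
Proof. move=> *; lra. Qed.

(** With Z = D z and Y = P^-1 Z, this is a linear combination of the cocycle identity at the triples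
    (a, AP, Y), (A, P, Y), (P, P^-1, Z), (1, 1, Z) and (A, D, z). *)
Lemma berezin_conj (a A P D z : 'M[R]_m) : in_Sp a -> in_Sp A -> in_Sp P -> in_Sp D -> in_Sp z ->
  c (a *m (A *m P)) (invmx P *m (D *m z)) = c A D +
    (c (A *m D) z + c a (A *m (D *m z))) -
    (c A P + c a (A *m P) - c P (invmx P) - c 1%:M 1%:M) -
    (c D z + c (invmx P) (D *m z)).
Proof.
move=> sa sA sP sD sz; have sp := in_SpV sP; have uP := in_Sp_unit sP.
have s1 := @in_Sp1 R n.
have sDz := in_SpM sD sz; have sAP := in_SpM sA sP.
have sY := in_SpM sp sDz.
have PY : P *m (invmx P *m (D *m z)) = D *m z by exact: mulKVmx.
have APY : A *m P *m (invmx P *m (D *m z)) = A *m (D *m z).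
  by apply: etrans (esym (mulmxA _ _ _)) _; rewrite PY.
move: PY APY sY sDz; set Y := invmx P *m (D *m z); set Z := D *m z => PY APY sY sZ.
have e1 := etrans (berezin_cocycle sa sAP sY) (congr1 (fun M => c a M + c (A *m P) Y) APY).
have e2 := etrans (berezin_cocycle sA sP sY) (congr1 (fun M => c A M + c P Y) PY).
have e3 := etrans (esym (congr1 (fun M => c P (invmx P) + c M Z) (mulmxV uP)))
  (berezin_cocycle sP sp sZ).
have e4 := etrans (esym (congr1 (fun M => c 1%:M 1%:M + c M Z) (mul1mx _)))
  (etrans (berezin_cocycle s1 s1 sZ) (congr1 (fun M => c 1%:M M + c 1%:M Z) (mul1mx _))).
exact: (cocycle_aux e1 e2 e3 e4 (berezin_cocycle sA sD sz)).
Qed.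

Let berezin_conj_left (a A P D z : 'M[R]_m) :
  in_Sp a -> in_Sp A -> in_Sp P -> in_Sp D -> in_Sp z ->
  c (a *m A *m P) (invmx P *m D *m z) = c A D +
    (c (A *m D) z + c a (A *m D *m z)) -
    (c A P + c a (A *m P) - c P (invmx P) - c 1%:M 1%:M) -
    (c D z + c (invmx P) (D *m z)).
Proof.
move=> sa sA sP sD sz; have e := berezin_conj sa sA sP sD sz.
by rewrite -(mulmxA a A P) -(mulmxA (invmx P) D z) -(mulmxA A D z).
Qed.

(** Adds and subtracts the same constants, so that the three corrections become values of one
    function [chart_cob]. *)
Let cob_aux (AD u v w t s o y r k : R) : AD + (u + v) - (w + t - s - o) - (y + r) =
  AD + (u + v - k - o) - (w + t - s - o) - (y + r - k - o).
Proof. ring. Qed.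

Variables (Omega : set V) (iota : V -> T).
Hypotheses (oOmega : open Omega) (hiota : symplectic_embedding Omega iota).

Local Notation Q x := ((dchart iota x)^T).
Local Notation q A := (in_chart Omega iota (torus_linear A)).
Local Notation transfer := (transfer Omega iota).

(** The function b(A, x) of the coboundary. Its last two terms come from the triples (P, P^-1, Z)
    and (1, 1, Z) in [berezin_conj]. *)
Definition chart_cob (A : 'M[R]_m) (x : V) : R :=
  c A (Q x) + c (invmx (Q (q A x))) (A *m Q x) - c (Q x) (invmx (Q x)) - c 1%:M 1%:M.

Lemma transfer_Sp A x : transfer A Omega x -> in_Sp (Q x) /\ in_Sp (Q (q A x)).
Proof.
move=> h; have [[Ox _] Oq] := (transferE hiota A x (@subset_refl _ _)).1 h.
by split; exact: (dchart_Sp hiota).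
Qed.

Lemma cocycle_chart A D x : SpZ A -> SpZ D -> transfer D (transfer A Omega) x ->
  c (jacobi_mx (q A) (q D x)) (jacobi_mx (q D) x) =
  c A D + chart_cob (A *m D) x - chart_cob A (q D x) - chart_cob D x.
Proof.
move=> hA hD hx; have sO : transfer A Omega `<=` Omega by move=> y [].
have [hDx hAqx] := (transferE hiota D x sO).1 hx.
rewrite (transfer_jacobi oOmega hiota hA hAqx) (transfer_jacobi oOmega hiota hD hDx).
have [sz sP] := transfer_Sp hDx; have [_ s2] := transfer_Sp hAqx.
have [_ qq] := transfer_comp hiota hA hD hDx hAqx.
rewrite /chart_cob qq.
exact: (etrans (berezin_conj_left (in_SpV s2) hA.1 sP hD.1 sz) (cob_aux _ _ _ _ _ _ _ _ _ _)).
Qed.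

Lemma chart_cob_le A x : SpZ A -> transfer A Omega x ->
  `|chart_cob A x| <= 4 * (n%:R * (pi / 2)).
Proof.
move=> [sA _] h; have [sz sP] := transfer_Sp h; rewrite /chart_cob.
have s1 := @in_Sp1 R n.
have aux (a b d e K : R) : `|a| <= K -> `|b| <= K -> `|d| <= K -> `|e| <= K ->
    `|a + b - d - e| <= 4 * K.
  by rewrite !ler_norml => /andP[? ?] /andP[? ?] /andP[? ?] /andP[? ?]; apply/andP; split; lra.
apply: aux; apply: berezin_le => //; [exact: in_SpV|exact: in_SpM|exact: in_SpV].
Qed.

Lemma chart_cob_continuous A x : SpZ A -> transfer A Omega x ->
  chart_cob A y @[y --> x] --> chart_cob A x.
Proof.
move=> hA h.
have near_tr : \forall y \near x, transfer A Omega y.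
  by apply: open_nbhs_nbhs; split => //; exact: (transfer_open oOmega hiota hA oOmega).
have [[Ox _] Oq] := (transferE hiota A x (@subset_refl _ _)).1 h.
have cQ : econt (fun y => Q y) x by apply: econt_tr => i j; exact: (dchart_continuous hiota).
have qc : q A y @[y --> x] --> q A x := rdiff_continuous (transfer_rdiff oOmega hiota hA h).
have cQq : econt (fun y => Q (q A y)) x.
  apply: (@econt_tr _ _ _ _ (fun y => dchart iota (q A y))) => i j.
  have dc := @dchart_continuous R n Omega iota hiota _ i j Oq.
  exact: (@cvg_comp _ _ _ (q A) (fun y => dchart iota y i j) _ _ _ qc dc).
have cV (F : V -> 'M[R]_m) : econt F x -> (\forall y \near x, in_Sp (F y)) ->
    econt (fun y => invmx (F y)) x.
  move=> cF sF; apply: (@econt_near _ _ _ _ _ (fun y => - std_symp R n *m (F y)^T *m std_symp R n)).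
    by apply: (@filterS _ _ (nbhs_filter x) _ _ _ sF) => y; exact: in_Sp_invmx.
  apply: econt_mul; last exact: econt_cst.
  by apply: econt_mul; [exact: econt_cst|exact: econt_tr].
have sQ : \forall y \near x, in_Sp (Q y).
  by apply: (@filterS _ _ (nbhs_filter x) _ _ _ near_tr) => y /transfer_Sp[].
have sQq : \forall y \near x, in_Sp (Q (q A y)).
  by apply: (@filterS _ _ (nbhs_filter x) _ _ _ near_tr) => y /transfer_Sp[].
have bc (F G : V -> 'M[R]_m) : econt F x -> econt G x -> (\forall y \near x, in_Sp (F y)) ->
    (\forall y \near x, in_Sp (G y)) -> c (F y) (G y) @[y --> x] --> c (F x) (G x).
  by move=> cF cG sF sG; apply: berezin_continuous => //; apply: nbhs_rowS2 sF sG.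
have sA : \forall y \near x, in_Sp A by apply: (@filterE _ _ (nbhs_filter x)) => y; case: hA.
have sV (F : V -> 'M[R]_m) : (\forall y \near x, in_Sp (F y)) -> \forall y \near x, in_Sp (invmx (F y)).
  by move=> sF; apply: (@filterS _ _ (nbhs_filter x) _ _ _ sF) => y; exact: in_SpV.
have sM : \forall y \near x, in_Sp (A *m Q y).
  by apply: nbhs_rowS2 sA sQ => y; exact: in_SpM.
have cA := @econt_cst R m m m A x.
have c1 := bc _ _ cA cQ sA sQ.
have c2 := bc _ _ (cV _ cQq sQq) (econt_mul cA cQ) (sV _ sQq) sM.
have c3 := bc _ _ cQ (cV _ cQ sQ) sQ (sV _ sQ).
have c4 := @cvg_cst _ (c 1%:M 1%:M) _ (nbhs x) (nbhs_filter x).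
have F := nbhs_filter x.
exact: (cvgB (cvgB (cvgD c1 c2) c3) c4).
Qed.

End ChartCoboundary.

Section CocycleOnLinearMaps.
Variables (R : realType) (n : nat).
Local Notation m := (n + n)%N.
Local Notation V := 'rV[R]_m.
Local Notation B := (borel_rv R m).
Local Notation T := (torus R m).
Local Notation mu := (@leb R m).
Local Notation c := (@berezin R n).
Variables (Omega : set V) (iota : V -> T).
Hypotheses (n0 : (0 < n)%N) (oOmega : open Omega) (hiota : symplectic_embedding Omega iota).
Hypothesis hfull : torus_null (~` (iota @` Omega)).

Local Notation q A := (in_chart Omega iota (torus_linear A)).
Local Notation transfer := (transfer Omega iota).
Local Notation beta := (chart_cob Omega iota).

Lemma Rintegral_conull (D E : set V) (f : V -> R) : open D -> open E -> D `<=` E ->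
  mu D = 1%E -> mu E = 1%E -> \int[mu]_(x in D) f x = \int[mu]_(x in E) f x.
Proof.
move=> oD oE DE D1 E1; rewrite /Rintegral; congr fine.
have mD : measurable (D : set B) by exact: open_borel.
have mE : measurable (E : set B) by exact: open_borel.
have Efin : (mu E < +oo)%E by rewrite E1 ltry.
have e1 : mu (E `&` D) = 1%E by rewrite (setIidr DE).
have sub (a b : \bar R) : a = 1%E -> b = 1%E -> (a - b = 0)%E by move=> -> ->; exact: subee.
have N0 : mu (E `\` D) = 0%E := etrans (measureD mE mD Efin) (sub _ _ E1 e1).
rewrite -[X in (\int[_]_(_ in X) _)%E = _](setIidr DE) integral_mkcondr.
apply: (@eq_integral_null _ B R mu E (E `\` D)) => //; first exact: measurableD.
by move=> x Ex nN; rewrite /patch mem_set //; apply: contrapT => h; exact: nN.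
Qed.

Definition chart_cob_int (A : 'M[R]_m) : R := \int[mu]_(x in transfer A Omega) beta A x.

(** The pointwise identity [cocycle_chart] is integrated over a domain of volume 1, where c(A, D) is
    constant; measure preservation turns the integral of b(A, q_D x) into that of b(A, x). *)
Lemma symp_cocycle_torus_linear A D : SpZ A -> SpZ D ->
  symp_cocycle Omega iota (torus_linear A) (torus_linear D) =
  c A D + chart_cob_int (A *m D) - chart_cob_int A - chart_cob_int D.
Proof.
move=> hA hD; have hAD := SpZM hA hD.
have [z nz] := chart_proper n0 oOmega hiota hfull.
have oT M : SpZ M -> open (transfer M Omega) by move=> hM; exact: (transfer_open oOmega hiota hM oOmega).
have sT M O : transfer M O `<=` Omega by move=> x [].
have mT M : SpZ M -> mu (transfer M Omega) = 1%E.
  by move=> hM; rewrite (transfer_measure oOmega hiota hfull hM oOmega) // (chart_measure oOmega hiota hfull).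
(* [D0] is where q_D and then q_A are both meaningful; it still has full volume. *)
pose S := transfer A Omega; pose D0 := transfer D S.
have oS : open S by exact: oT.
have oD0 : open D0 by exact: (transfer_open oOmega hiota hD oS (@sT _ _)).
have D01 : mu D0 = 1%E.
  by rewrite (transfer_measure oOmega hiota hfull hD oS (@sT _ _)); exact: mT.
have hD0 x : D0 x -> transfer D Omega x /\ S (q D x).
  by move=> h; exact: (transferE hiota D x (@sT A Omega)).1 h.
have D0AD : D0 `<=` transfer (A *m D) Omega.
  by move=> x /hD0[h1 h2]; have [] := transfer_comp hiota hA hD h1 h2.
have D0D : D0 `<=` transfer D Omega by move=> x /hD0[].
pose K := 4 * (n%:R * (pi / 2)) : R.
have mb (U : set V) M : SpZ M -> open U -> U `<=` transfer M Omega -> measurable_fun (U : set B) (beta M).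
  move=> hM oU UM; apply: continuous_on_borel_measurable => // x Ux.
  by apply: chart_cob_continuous => //; exact: UM.
have m1 := mb D0 _ hAD oD0 D0AD; have m2 := mb D0 _ hD oD0 D0D.
have m3 : measurable_fun (D0 : set B) (fun x => beta A (q D x)).
  apply: continuous_on_borel_measurable => // x /hD0[h1 h2].
  have qc := rdiff_continuous (transfer_rdiff oOmega hiota hD h1).
  have bc := chart_cob_continuous oOmega hiota hA h2.
  exact: (@cvg_comp _ _ _ (q D) (beta A) _ _ _ qc bc).
have b1 x : D0 x -> `|beta (A *m D) x| <= K by move=> h; apply: chart_cob_le => //; exact: D0AD.
have b2 x : D0 x -> `|beta D x| <= K by move=> h; apply: chart_cob_le => //; exact: D0D.
have b3 x : D0 x -> `|beta A (q D x)| <= K by move=> /hD0[_ h]; exact: chart_cob_le.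
have mD0 : measurable (D0 : set B) by exact: open_borel.
have D0fin : (mu D0 < +oo)%E by rewrite D01 ltry.
pose k (x : V) := c A D.
have mk : measurable_fun (D0 : set B) k by exact: measurable_cst.
have i0 := bounded_integrable mD0 D0fin mk (fun x _ => lexx `|c A D|).
have i1 := bounded_integrable mD0 D0fin m1 b1.
have i2 := bounded_integrable mD0 D0fin m2 b2.
have i3 := bounded_integrable mD0 D0fin m3 b3.
pose F0 x := k x + beta (A *m D) x - beta A (q D x) - beta D x.
have mF0 : measurable_fun (D0 : set B) F0.
  exact: (measurable_funB (measurable_funB (measurable_funD mk m1) m3) m2).
have F0K x : D0 x -> `|F0 x| <= `|c A D| + K + K + K.
  move=> h; rewrite /F0; apply: (le_trans (ler_normB _ _)); apply: lerD; last exact: b2.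
  apply: (le_trans (ler_normB _ _)); apply: lerD; last exact: b3.
  by apply: (le_trans (ler_normD _ _)); apply: lerD => //; exact: b1.
have eF x : D0 x -> c (jacobi_mx (q A) (q D x)) (jacobi_mx (q D) x) = F0 x.
  by move=> h; exact: cocycle_chart.
rewrite /symp_cocycle (lebesgue_Rintegral_chart oOmega hiota hfull oD0 (@sT _ _) D01 eF mF0 F0K).
have i01 := integrableD mD0 i0 i1.
have i013 := integrableB mD0 i01 i3.
have aux (x0 x1 x2 x3 y0 y1 y2 y3 : R) :
  x0 = y0 -> x1 = y1 -> x2 = y2 -> x3 = y3 -> x0 + x1 - x2 - x3 = y0 + y1 - y2 - y3.
  by move=> -> -> -> ->.
have mS : measurable_fun (S : set B) (beta A) by exact: mb.
have j0 : \int[mu]_(x in D0) k x = c A D.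
  apply: etrans (Rintegral_cst mu mD0 _) _.
  by apply: etrans (congr1 (fun a => _ * fine a) D01) _; rewrite mulr1.
have j1 := Rintegral_conull (beta (A *m D)) oD0 (oT _ hAD) D0AD D01 (mT _ hAD).
have j2 := Rintegral_action oOmega hiota hfull hD oS (@sT _ _) nz mS
  (fun x Sx => chart_cob_le hiota hA Sx).
have j3 := Rintegral_conull (beta D) oD0 (oT _ hD) D0D D01 (mT _ hD).
apply: etrans (RintegralB mD0 i013 i2) _.
apply: etrans (congr1 (fun a => a - _) (RintegralB mD0 i01 i3)) _.
apply: etrans (congr1 (fun a => a - _ - _) (RintegralD mD0 i0 i1)) _.
exact: aux j0 j1 j2 j3.
Qed.

End CocycleOnLinearMaps.

Theorem theorem1p6 (R : realType) (n : nat) (hn : (3 <= n)%N)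
    (Omega : set 'rV[R]_(n + n)) (iota : 'rV[R]_(n + n) -> torus R (n + n))
    (hOmega : open Omega) (hiota : symplectic_embedding Omega iota)
    (hfull : torus_null (~` (iota @` Omega))%classic) :
  ~ trivial_extension (@Symp R n) (symp_cocycle Omega iota).
Proof.
move=> [gamma hg]; have n0 : (0 < n)%N by exact: leq_trans hn.
have n1 : (1 < n)%N by exact: leq_trans hn.
(* The integrated coboundary is absorbed into gamma; this leaves a trivialisation of c itself on
   Sp(2n, Z). *)
pose gam (A : 'M[R]_(n + n)) := gamma (torus_linear A) + chart_cob_int Omega iota A.
have aux (k x y z a b d : R) : k + x - y - z = a + b - d ->
    k = (a + y) + (b + z) - (d + x) by move=> e; lra.
have hgam (A B : 'M[R]_(n + n)) : SpZ A -> SpZ B ->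
    berezin A B = gam A + gam B - gam (A *m B).
  move=> hA hB; have := hg _ _ (torus_linear_Symp hA) (torus_linear_Symp hB).
  rewrite (symp_cocycle_torus_linear n0 hOmega hiota hfull hA hB) torus_linear_comp // /gam.
  exact: aux.
exact: (gam_contradiction hgam (e := Ordinal n0) (f := Ordinal n1)).
Qed.
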